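(* Let $\nu_{\boldsymbol\mu}$ be a self-affine measure on a sponge $F\subset\mathbb R^d$ satisfying the SPPC. Then $$\dim_{\mathrm F}\nu_{\boldsymbol\mu}=\min_{\sigma\in\mathcal A}\inf_{\mathbf P_{\!\sigma}\in\mathcal Q^\sigma}S_\sigma(\mathbf P_{\!\sigma})=\lim_{q\to+\infty}\frac{T(\nu_{\boldsymbol\mu},q)}{-q}\ge\max\Big\{0,\min_{\sigma\in\mathcal A}\underline S_d^{\boldsymbol\mu,\sigma}\Big\},$$ $$\dim_{\mathrm B}\nu_{\boldsymbol\mu}=\max_{\sigma\in\mathcal A}\sup_{\mathbf P_{\!\sigma}\in\mathcal Q^\sigma}S_\sigma(\mathbf P_{\!\sigma})=\lim_{q\to-\infty}\frac{T(\nu_{\boldsymbol\mu},q)}{-q}\le\max_{\sigma\in\mathcal A}\overline S_d^{\boldsymbol\mu,\sigma}.$$ In particular, if $F$ is a $\sigma$-ordered Lalley–Gatzouras sponge, then $\dim_{\mathrm F}\nu_{\boldsymbol\mu}=\underline S_d^{\boldsymbol\mu,\sigma}$ and $\dim_{\mathrm B}\nu_{\boldsymbol\mu}=\overline S_d^{\boldsymbol\mu,\sigma}$.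
   Context: Sponge setup: $d\ge1$, $\mathcal I=\{1,\dots,N\}$, $f_i(x)=A_ix+t_i$ with $A_i=\mathrm{diag}(a_i^{(1)},\dots,a_i^{(d)})$, $\lambda_i^{(n)}=|a_i^{(n)}|\in(0,1)$, $f_i([0,1]^d)\subset[0,1]^d$, no two distinct $f_i$ agree on $[0,1]^d$, and for some $r_0>0$ each face $\{x_n=u\}$ ($u\in\{0,1\}$) of $[0,1]^d$ is at distance $\ge r_0$ from some $f_k([0,1]^d)$. $F$ the attractor, $\Sigma=\mathcal I^{\mathbb N}$, $\pi(\mathbf i)=\lim f_{i_1}\circ\dots\circ f_{i_k}(0)$. Orderings: for a permutation $\sigma$, $E_n^\sigma$ = span of coordinate axes $\sigma_1,\dots,\sigma_n$, $\Pi_n^\sigma$ orthogonal projection; $f_i,f_j$ overlap exactly on $E_n^\sigma$ if $\Pi_n^\sigma f_i=\Pi_n^\sigma f_j$ on $[0,1]^d$; $\mathcal I_n^\sigma$ = smallest elements of classes of this equivalence relation, $\Pi_n^\sigma j$ = smallest element of class of $j$. $L_\delta(\mathbf i,n)$ is the unique integer with $\prod_{\ell\le L_\delta(\mathbf i,n)}\lambda_{i_\ell}^{(n)}\le\delta<\prod_{\ell\le L_\delta(\mathbf i,n)-1}\lambda_{i_\ell}^{(n)}$; $\mathcal A$ = set of permutations $\sigma$ for which some $\mathbf i,\delta$ satisfy $L_\delta(\mathbf i,\sigma_d)\le\dots\le L_\delta(\mathbf i,\sigma_1)$ (ties broken by $\sigma_n>\sigma_{n-1}$). Variational quantities: $\mathcal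 P_n^\sigma$ = probability vectors on $\mathcal I_n^\sigma$, $\mathcal P^\sigma=\mathcal P_d^\sigma\times\dots\times\mathcal P_1^\sigma$, elements $(\mathbf p_{\sigma_d},\dots,\mathbf p_{\sigma_1})$; $\chi_n^\sigma(\mathbf p_{\sigma_m})=-\sum_{i\in\mathcal I_m^\sigma}p_{\sigma_m}(i)\log\lambda_i^{(\sigma_n)}$; $C_d^{(d),\sigma}=1/\chi_d^\sigma(\mathbf p_{\sigma_d})$, $C_n^{(d),\sigma}=(1-\sum_{m>n}C_m^{(d),\sigma}\chi_n^\sigma(\mathbf p_{\sigma_m}))/\chi_n^\sigma(\mathbf p_{\sigma_n})$; $\mathcal Q^\sigma=\{\mathbf P_{\!\sigma}:C_n^{(d),\sigma}(\mathbf P_{\!\sigma})\ge0\ \forall n\}$. Measure: $\boldsymbol\mu$ strictly positive probability vector on $\mathcal I$, $\nu_{\boldsymbol\mu}=\boldsymbol\mu^{\mathbb N}\circ\pi^{-1}$, $\mu_n^\sigma(i)=\sum_{j:\Pi_n^\sigma j=i}\mu(j)$. $S_\sigma(\mathbf P_{\!\sigma})=-\sum_nC_n^{(d),\sigma}(\mathbf P_{\!\sigma})\sum_{i\in\mathcal I_n^\sigma}p_{\sigma_n}(i)\log\mu_n^\sigma(i)$. $\overline S_0^{\boldsymbol\mu,\sigma}=\underline S_0^{\boldsymbol\mu,\sigma}=0$, $\overline S_n^{\boldsymbol\mu,\sigma}=\overline S_{n-1}^{\boldsymbol\mu,\sigma}+\max_{i\in\mathcal I_n^\sigma}\frac{1}{\log\lambda_i^{(\sigma_n)}}\big(\log\mu_n^\sigma(i)+\sum_{m=1}^{n-1}(\overline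 S_{m-1}^{\boldsymbol\mu,\sigma}-\overline S_m^{\boldsymbol\mu,\sigma})\log\lambda_i^{(\sigma_m)}\big)$, and $\underline S_n^{\boldsymbol\mu,\sigma}$ the same with $\min$ and $\underline S$. SPPC: for every $\sigma\in\mathcal A$, $n$, $i,j$: either $f_i,f_j$ overlap exactly on $E_n^\sigma$ or $\Pi_n^\sigma(f_i((0,1)^d))\cap\Pi_n^\sigma(f_j((0,1)^d))=\emptyset$. A $\sigma$-ordered Lalley–Gatzouras sponge satisfies the SPPC and $\lambda_i^{(\sigma_d)}\le\dots\le\lambda_i^{(\sigma_1)}$ for all $i$. Dimensions: $T(\nu,q)=\lim_{\delta\to0}\log T_\delta(\nu,q)/(-\log\delta)$ with $T_\delta(\nu,q)=\sup\sum_i\nu(B(x_i,\delta))^q$ over disjoint closed balls centred in $\mathrm{supp}\,\nu$. $\dim_{\mathrm F}\nu=\sup\{s\ge0:\exists C\ge1,\ \nu(B(x,\delta))\le C\delta^s\ \forall x\in\mathrm{supp}\,\nu,0<\delta<1\}$; $\overline\dim_{\mathrm B}\nu=\inf\{s\ge0:\exists c>0,\ \nu(B(x,\delta))\ge c\delta^s\ \forall x\in\mathrm{supp}\,\nu,0<\delta<1\}$; $\underline\dim_{\mathrm B}\nu$ is defined the same except that the inequality need only hold along some sequence $\delta_n\to0$; $\dim_{\mathrm B}\nu$ is their common value when they agree. *)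

(* Defs.v *)
From HB Require Import structures.
From mathcomp Require Import all_boot all_order all_algebra all_fingroup.
From mathcomp Require Import all_classical all_reals all_analysis.
Set Implicit Arguments. Unset Strict Implicit. Unset Printing Implicit Defensive.
Import Order.TTheory GRing.Theory Num.Theory.
Import numFieldNormedType.Exports.
Local Open Scope classical_set_scope.
Local Open Scope ring_scope.

Section Sponge.
Variable R : realType.
Variables d N : nat.
(* points of R^d are functions 'I_d -> R; coordinates are 0-indexed *)
Notation vec := ('I_d -> R).
(* f_i(x) = A_i x + t_i with A_i = diag(a i 0, ..., a i (d-1)) *)
Variables (a t : 'I_N -> 'I_d -> R).

Definition ifsmap (i : 'I_N) (x : vec) : vec := fun n => a i n * x n + t i n.

Definition lam (i : 'I_N) (n : 'I_d) : R := `|a i n|.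

Definition cube : set vec := [set x | forall n, 0 <= x n <= 1].
Definition ocube : set vec := [set x | forall n, 0 < x n < 1].

Definition eucl_dist (x y : vec) : R := Num.sqrt (\sum_(n < d) (x n - y n) ^+ 2).
Definition cballE (x : vec) (r : R) : set vec := [set y | eucl_dist x y <= r].

Definition Sigma := nat -> 'I_N.

(* f_{s_0} o f_{s_1} o ... o f_{s_{k-1}}  (paper: f_{i_1} o ... o f_{i_k}) *)
Fixpoint compo (s : Sigma) (k : nat) : vec -> vec :=
  match k with 0 => id | k'.+1 => compo s k' \o ifsmap (s k') end.

Definition coding (s : Sigma) : vec :=
  fun n => lim ((fun k => compo s k (fun _ => 0) n) @ \oo).

Definition cyl (k : nat) (w : 'I_k -> 'I_N) : set Sigma :=
  [set s | forall j : 'I_k, s j = w j].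

(* coordinate sigma_n (paper, 1 <= n <= d) = sigma (n-1) *)
Definition sigc (s : {perm 'I_d}) (n : nat) : option 'I_d :=
  if (insub n.-1 : option 'I_d) is Some c then Some (s c) else None.

Definition lamS (s : {perm 'I_d}) (i : 'I_N) (n : nat) : R :=
  if sigc s n is Some c then lam i c else 1.

Definition projE (s : {perm 'I_d}) (n : nat) (v : vec) : vec :=
  fun c => if [exists k : 'I_d, ((k < n)%N && (s k == c))] then v c else 0.

Definition overlap (s : {perm 'I_d}) (n : nat) (i j : 'I_N) : Prop :=
  forall x, cube x -> projE s n (ifsmap i x) = projE s n (ifsmap j x).

Definition Iset (s : {perm 'I_d}) (n : nat) (i : 'I_N) : bool :=
  `[< forall k : 'I_N, overlap s n k i -> (i <= k)%N >].

Definition Prep (s : {perm 'I_d}) (n : nat) (j : 'I_N) : 'I_N :=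
  [arg min_(k < j | `[< overlap s n k j >]) (k : nat)].


Definition Lprop (x : Sigma) (delta : R) (c : 'I_d) (L : nat) : Prop :=
  (0 < L)%N /\ \prod_(l < L) lam (x l) c <= delta < \prod_(l < L.-1) lam (x l) c.

Definition Aset : set {perm 'I_d} :=
  [set s | exists (x : Sigma) (delta : R), 0 < delta < 1 /\
     exists Lf : 'I_d -> nat, (forall c, Lprop x delta c (Lf c)) /\
       forall k1 k2 : 'I_d, (k2 : nat) = k1.+1 ->
         (Lf (s k2) <= Lf (s k1))%N /\ (Lf (s k2) = Lf (s k1) -> (s k1 < s k2)%N)].

Definition SPPC : Prop :=
  forall s, Aset s -> forall n, (1 <= n <= d)%N -> forall i j : 'I_N,
    overlap s n i j \/
    [set projE s n y | y in ifsmap i @` ocube] `&` [set projE s n y | y in ifsmap j @` ocube] = set0.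

Definition LG_ordered (s : {perm 'I_d}) : Prop :=
  SPPC /\ forall i n, (1 <= n < d)%N -> lamS s i n.+1 <= lamS s i n.

(* ---- variational quantities ----
   An element (p_{sigma_d}, ..., p_{sigma_1}) of P^sigma is represented by
   p : nat -> 'I_N -> R, with p n = p_{sigma_n} (1 <= n <= d), each p n being a
   probability vector on I_n^sigma (extended by 0 outside I_n^sigma). *)
Definition Pvalid (s : {perm 'I_d}) (p : nat -> 'I_N -> R) : Prop :=
  forall n, (1 <= n <= d)%N ->
    (forall i, 0 <= p n i) /\ (forall i, ~~ Iset s n i -> p n i = 0) /\
    \sum_(i | Iset s n i) p n i = 1.

Definition chi (s : {perm 'I_d}) (p : nat -> 'I_N -> R) (n m : nat) : R :=
  - \sum_(i | Iset s m i) p m i * ln (lamS s i n).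

(* C_n^{(d),sigma}, computed downwards from n = d (fuel-based recursion) *)
Fixpoint Caux (s : {perm 'I_d}) (p : nat -> 'I_N -> R) (fuel n : nat) : R :=
  match fuel with
  | 0 => 0
  | f.+1 => (1 - \sum_(n.+1 <= m < d.+1) Caux s p f m * chi s p n m) / chi s p n n
  end.
Definition Cn (s : {perm 'I_d}) (p : nat -> 'I_N -> R) (n : nat) : R :=
  Caux s p d.+1 n.

Definition Qset (s : {perm 'I_d}) : set (nat -> 'I_N -> R) :=
  [set p | Pvalid s p /\ forall n, (1 <= n <= d)%N -> 0 <= Cn s p n].

Variable mu : 'I_N -> R.

Definition mun (s : {perm 'I_d}) (n : nat) (i : 'I_N) : R :=
  \sum_(j | Prep s n j == i) mu j.

Definition Ssig (s : {perm 'I_d}) (p : nat -> 'I_N -> R) : R :=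
  - \sum_(1 <= n < d.+1) Cn s p n * \sum_(i | Iset s n i) p n i * ln (mun s n i).

(* \overline S_n (ext = sup, i.e. max over the finite set) and
   \underline S_n (ext = inf, i.e. min), fuel-based recursion *)
Fixpoint Saux (ext : set R -> R) (s : {perm 'I_d}) (fuel n : nat) : R :=
  match fuel with
  | 0 => 0
  | f.+1 => match n with
            | 0 => 0
            | n'.+1 => Saux ext s f n' +
                ext [set (ln (lamS s i n'.+1))^-1 *
                       (ln (mun s n'.+1 i) +
                        \sum_(1 <= m < n'.+1) (Saux ext s f m.-1 - Saux ext s f m) * ln (lamS s i m))
                    | i in [set i | Iset s n'.+1 i]]
            end
  end.
Definition Sbar (s : {perm 'I_d}) (n : nat) : R := Saux sup s n n.
Definition Sund (s : {perm 'I_d}) (n : nat) : R := Saux inf s n n.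

End Sponge.

Section Dimensions.
Variable R : realType.
Variable d : nat.
Notation vec := ('I_d -> R).
Local Open Scope ereal_scope.

Definition msupp (nu : set vec -> \bar R) : set vec :=
  [set x | forall r : R, (0 < r)%R -> 0 < nu (cballE x r)].

Definition dimF (nu : set vec -> \bar R) : \bar R :=
  ereal_sup [set s%:E | s in [set s : R | (0 <= s)%R /\ exists C : R, (1 <= C)%R /\
     forall x, msupp nu x -> forall delta : R, (0 < delta < 1)%R ->
       nu (cballE x delta) <= (C * delta `^ s)%:E]].

Definition dimBup (nu : set vec -> \bar R) : \bar R :=
  ereal_inf [set s%:E | s in [set s : R | (0 <= s)%R /\ exists c : R, (0 < c)%R /\
     forall x, msupp nu x -> forall delta : R, (0 < delta < 1)%R ->
       (c * delta `^ s)%:E <= nu (cballE x delta)]].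

Definition dimBlow (nu : set vec -> \bar R) : \bar R :=
  ereal_inf [set s%:E | s in [set s : R | (0 <= s)%R /\ exists c : R, (0 < c)%R /\
     exists dl : nat -> R, (forall k, (0 < dl k < 1)%R) /\ dl @ \oo --> 0%R /\
     forall x, msupp nu x -> forall k,
       (c * dl k `^ s)%:E <= nu (cballE x (dl k))]].

Definition Tdelta (nu : set vec -> \bar R) (q delta : R) : R :=
  sup [set z : R | exists (k : nat) (xs : 'I_k -> vec),
     (forall j, msupp nu (xs j)) /\
     (forall j1 j2, j1 != j2 -> cballE (xs j1) delta `&` cballE (xs j2) delta = set0) /\
     z = (\sum_(j < k) (fine (nu (cballE (xs j) delta))) `^ q)%R].

End Dimensions.

Arguments cube {R d}.
Arguments ocube {R d}.
Arguments Sigma : clear implicits.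

(* Main.v *)
(** A sequence [x] and a scale [delta] determine an approximate cube: the sequences whose
    [l]-th letter agrees with that of [x] on the coordinates [c] with [l < L_delta(x, c)]. By
    the SPPC the cuboids carrying distinct approximate cubes have disjoint interiors, so a
    ball of radius [delta] meets boundedly many of them and the moment sums [T_delta(q)] are
    comparable to sums over approximate cubes. Interleaving [r] words with the same cutoffs
    produces a cube of size about [delta ^ r] whose measure is about the product of the
    measures; hence [log T_delta(q)] is almost superadditive in [- log delta] and [T(q)]
    exists.

    In the variables [w = C_n p_n], the set [Q^sigma] is a polytope on which [S_sigma] is
    linear. Letter frequencies of approximate cubes are approximate points of these polytopes
    and every point of a polytope is realized by words, whence [- q z <= T(q)] for every value
    [z] of [S_sigma], and, by compactness, [T(q) <= C - q v] with [v] the least value if [q >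
    0] and the largest if [q < 0]. Both dimensions follow from these two bounds. The
    increments of [Sund] and [Sbar] are feasible for the dual program, and optimal for a
    Lalley-Gatzouras sponge. *)

Require Import Defs.
From HB Require Import structures.
From mathcomp Require Import all_boot all_order all_algebra all_fingroup.
From mathcomp Require Import all_classical all_reals all_analysis.
From mathcomp Require Import measurable_realfun.
From mathcomp Require Import ring lra zify.
Set Implicit Arguments. Unset Strict Implicit. Unset Printing Implicit Defensive.
Import Order.TTheory GRing.Theory Num.Theory.
Import numFieldNormedType.Exports.
Local Open Scope classical_set_scope.
Local Open Scope ring_scope.

(** * Sums, products and extrema *)

Lemma sum_itv_indicator (m n H : nat) : (n <= H)%N ->
  (\sum_(l < H) (m <= l < n) = n - m)%N.
Proof.
move=> nH; rewrite -[RHS]muln1 -sum_nat_const_nat big_geq_mkord.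
rewrite (big_ord_widen_cond _ (fun l => (m <= l)%N) (fun=> 1%N) nH) [RHS]big_mkcond.
by apply: eq_bigr => l _; case: (_ && _).
Qed.

Section Indices.
Variable d : nat.
Implicit Types k m : 'I_d.

Lemma ord_of_pos (n : nat) : (1 <= n <= d)%N -> exists k : 'I_d, n = k.+1.
Proof.
move=> /andP[n1 nd]; have nd' : (n.-1 < d)%N by rewrite prednK.
by exists (Ordinal nd'); rewrite /= prednK.
Qed.

Lemma ord_downward_ind (Q : 'I_d -> Prop) :
  (forall k, (forall m, (k < m)%N -> Q m) -> Q k) -> forall k, Q k.
Proof.
move=> step k; have [n] := ubnP (d - k); elim: n k => // n IH k; rewrite ltnS => dn.
apply: step => m km; apply: IH; apply: leq_trans dn.
by have := ltn_ord m; have := ltn_ord k; lia.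
Qed.
End Indices.

Section FiniteSums.
Variable R : numDomainType.

Lemma ler_sum_card (I : finType) (V : pred I) (F : I -> R) (B : R) :
  (forall i, V i -> F i <= B) -> \sum_(i | V i) F i <= #|V|%:R * B.
Proof. by move=> FB; rewrite mulr_natl -sumr_const; exact: ler_sum. Qed.

Lemma sum_inj_le (I J : finType) (h : I -> J) (Q : pred J) (F : J -> R) : injective h ->
  (forall i, Q (h i)) -> (forall j, 0 <= F j) -> \sum_i F (h i) <= \sum_(j | Q j) F j.
Proof.
move=> h_inj Qh F0.
have -> : \sum_i F (h i) = \sum_(j in [set h i | i in [set: I]%SET]%SET) F j.
  by rewrite big_imset /= => [|i i' _ _]; [apply: eq_bigl => i; rewrite inE | exact: h_inj].
rewrite [leLHS]big_mkcond [leRHS]big_mkcond; apply: ler_sum => j _.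
case: ifP => [/imsetP[i _ ->]|_]; first by rewrite Qh.
by case: ifP.
Qed.

Lemma expn_le_prod (n : nat) (F : 'I_n -> R) (b : R) :
  0 <= b -> (forall l, b <= F l) -> b ^+ n <= \prod_l F l.
Proof.
move=> b0 bF; rewrite -[X in _ ^+ X]card_ord -prodr_const.
by apply: ler_prod => l _; rewrite b0 bF.
Qed.

Lemma prod_le_expn (n : nat) (F : 'I_n -> R) (b : R) :
  (forall l, 0 <= F l <= b) -> \prod_l F l <= b ^+ n.
Proof.
move=> Fb; rewrite -[X in _ ^+ X]card_ord -prodr_const.
by apply: ler_prod => l _; exact: Fb.
Qed.
End FiniteSums.

Lemma sum_ord_geq_recl (R : nmodType) (d : nat) (F : 'I_d -> R) (k : 'I_d) :
  \sum_(m < d | (k <= m)%N) F m = F k + \sum_(m < d | (k < m)%N) F m.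
Proof.
rewrite (bigD1 k) //=; congr (_ + _); apply: eq_bigl => m.
by rewrite [(k < m)%N]ltn_neqAle [k == m :> nat]eq_sym andbC.
Qed.

Lemma sum_nat_ord_geq (R : nmodType) (d : nat) (F : nat -> R) (n : nat) :
  \sum_(n.+1 <= m < d.+1) F m = \sum_(m < d | (n <= m)%N) F m.+1.
Proof. by rewrite big_add1 /= big_geq_mkord. Qed.

Lemma prod_blocks (R : comPzSemiRingType) (m K r : nat) (G : nat -> R) :
  \prod_(l < m * (K + r)) G l =
  (\prod_(l < m) \prod_(j < K) G (l * (K + r) + j)%N) *
  \prod_(l < m) \prod_(k < r) G (l * (K + r) + (K + k))%N.
Proof.
rewrite -big_split /=; elim: m => [|m IH]; first by rewrite !big_ord0.
by rewrite big_ord_recr /= -IH mulSnr !big_split_ord.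
Qed.

Lemma multiples_bounded_le0 (R : realFieldType) (x c : R) :
  (forall q, 0 < q -> q * x <= c) -> x <= 0.
Proof.
move=> bounded; rewrite leNgt; apply/negP => x0.
have := bounded ((`|c| + 1) / x); rewrite divr_gt0 ?ltr_wpDl // divfK ?gt_eqF // => /(_ isT).
by have := ler_norm c; lra.
Qed.

Section NaturalApproximation.
Variable R : archiRealFieldType.

Lemma sum_trunc_bounds (I : finType) (Q : pred I) (v G : I -> R) (K : R) :
  0 <= K -> (forall o, 0 <= v o) -> (forall o, 0 <= G o <= K) ->
  \sum_(o | Q o) v o * G o - #|I|%:R * K <= \sum_(o | Q o) (Num.truncn (v o))%:R * G o
  <= \sum_(o | Q o) v o * G o.
Proof.
move=> K0 v0 GK; apply/andP; split; last first.
  by apply: ler_sum => o _; have /andP[G0 _] := GK o; rewrite ler_wpM2r // truncn_le.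
rewrite lerBlDl -lerBlDr -sumrB; apply: (@le_trans _ _ (#|Q|%:R * K)).
  apply: ler_sum_card => o _; have /andP[G0 GK'] := GK o; rewrite -mulrBl.
  by apply: le_trans GK'; rewrite ler_piMl // lerBlDr addrC natr1 ltW // truncnS_gt.
by rewrite ler_wpM2r // ler_nat max_card.
Qed.

Lemma nat_ceil_approx (v : R) : 0 <= v -> exists n : nat, v <= n%:R <= v + 1.
Proof.
move=> v0; exists (Num.truncn v).+1.
by rewrite (ltW (truncnS_gt v)) /= -natr1 lerD2r truncn_le.
Qed.

Lemma nat_quotient_approx (D L s : R) : 0 < D -> 0 <= L -> D + L <= s ->
  exists r : nat, [/\ (0 < r)%N, r%:R * D <= s - L, s - L < (r%:R + 1) * D &
    `|r%:R - s / D| <= 1 + L / D].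
Proof.
move=> D0 L0 sDL; have q1 : 1 <= (s - L) / D by rewrite ler_pdivlMr // mul1r lerBrDr.
have /andP[r1] := truncn_itv (le_trans ler01 q1); rewrite -natr1 => r2.
exists (Num.truncn ((s - L) / D)); split.
- by rewrite truncn_gt0.
- by rewrite -ler_pdivlMr.
- by rewrite -ltr_pdivrMr.
- have LD0 : 0 <= L / D by rewrite divr_ge0 // ltW.
  by move: r1 r2; rewrite mulrBl ler_norml; lra.
Qed.
End NaturalApproximation.

Section LogarithmsAndPowers.
Variable R : realType.

Lemma expRN_in01 (s : R) : 0 < s -> 0 < expR (- s) < 1.
Proof. by move=> s0; rewrite expR_gt0 expR_lt1 oppr_lt0. Qed.

Lemma powR_expR (m q : R) : 0 < m -> m `^ q = expR (q * ln m).
Proof. by move=> m0; rewrite /powR gt_eqF. Qed.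

Lemma ln_prod (I : Type) (r : seq I) (Q : pred I) (F : I -> R) :
  (forall i, 0 < F i) -> ln (\prod_(i <- r | Q i) F i) = \sum_(i <- r | Q i) ln (F i).
Proof.
move=> F0; elim: r => [|i r IH]; first by rewrite !big_nil ln1.
rewrite !big_cons; case: ifP => // _; rewrite lnM ?posrE ?IH //.
exact: prodr_gt0.
Qed.

Lemma prod_powR (I : finType) (m : I -> R) (q : R) : (forall i, 0 <= m i) ->
  \prod_i (m i `^ q) = (\prod_i m i) `^ q.
Proof.
move=> m0; have [//] : \prod_i (m i `^ q) = (\prod_i m i) `^ q /\ 0 <= \prod_i m i.
elim/big_rec2 : _ => [|i x y _ [-> y0]]; first by rewrite powR1.
by rewrite powRM // mulr_ge0.
Qed.

Lemma le0_ler_powR (q x y : R) : q <= 0 -> 0 < x -> x <= y -> y `^ q <= x `^ q.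
Proof.
move=> q0 x0 xy; have y0 := lt_le_trans x0 xy.
have : x `^ (- q) <= y `^ (- q) by apply: ge0_ler_powR; rewrite ?nnegrE ?oppr_ge0 // ltW.
by rewrite !powRN lef_pV2 ?posrE ?powR_gt0.
Qed.

Lemma powR_sum_le (I : finType) (V : pred I) (m : I -> R) (q : R) (i0 : I) :
  V i0 -> (forall i, 0 <= m i) -> 0 <= q ->
  (\sum_(i | V i) m i) `^ q <= #|V|%:R `^ q * \sum_(i | V i) m i `^ q.
Proof.
move=> Vi0 m0 q0; case: (@arg_maxP _ _ _ i0 V m Vi0) => i1 Vi1 max1.
apply: (@le_trans _ _ ((#|V|%:R * m i1) `^ q)).
  by apply: ge0_ler_powR; rewrite ?nnegrE ?mulr_ge0 ?sumr_ge0 //; exact: ler_sum_card.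
rewrite powRM // ler_wpM2l ?powR_ge0 // (bigD1 i1) //= lerDl sumr_ge0 // => i _.
exact: powR_ge0.
Qed.

End LogarithmsAndPowers.

Section FiniteExtrema.
Variable R : realType.

Lemma inf_image_attained (I : finType) (Q : pred I) (f : I -> R) : (exists i, Q i) ->
  exists2 i, Q i & inf [set f i | i in [set i | Q i]] = f i /\ forall j, Q j -> f i <= f j.
Proof.
move=> [i0 Qi0]; case: (@arg_minP _ _ _ i0 Q f Qi0) => i Qi imin; exists i => //.
split=> //; apply: le_anti; apply/andP; split.
- by apply: ge_inf; [exists (f i) => _ [j Qj <-]; exact: imin | exists i].
- by apply: lb_le_inf; [exists (f i), i | move=> _ [j Qj <-]; exact: imin].
Qed.

Lemma sup_image_attained (I : finType) (Q : pred I) (f : I -> R) : (exists i, Q i) ->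
  exists2 i, Q i & sup [set f i | i in [set i | Q i]] = f i /\ forall j, Q j -> f j <= f i.
Proof.
move=> [i0 Qi0]; case: (@arg_maxP _ _ _ i0 Q f Qi0) => i Qi imax; exists i => //.
split=> //; apply: le_anti; apply/andP; split.
- by apply: ge_sup; [exists (f i), i | move=> _ [j Qj <-]; exact: imax].
- by apply: ub_le_sup; [exists (f i) => _ [j Qj <-]; exact: imax | exists i].
Qed.
End FiniteExtrema.

Section IteratedExtrema.
Variables (R : realType) (I J : Type) (A : set I) (B : I -> set J) (f : I -> J -> R).
Let values : set R := \bigcup_(i in A) [set f i j | j in B i].

Lemma ereal_inf_iterated : values !=set0 -> has_lbound values ->
  ereal_inf [set ereal_inf [set (f i j)%:E | j in B i] | i in A] = (inf values)%:E.
Proof.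
move=> v0 vlb; rewrite -ereal_inf_EFin //; apply/eqP; rewrite eq_le; apply/andP; split.
- apply: le_ereal_inf_tmp => _ [_ [i Ai [j Bj <-]] <-].
  apply: ge_ereal_inf; exists (ereal_inf [set (f i j)%:E | j in B i]); first by exists i.
  by apply: ereal_inf_lbound; exists j.
- apply: le_ereal_inf_tmp => _ [i Ai <-]; apply: le_ereal_inf_tmp => _ [j Bj <-].
  by apply: ereal_inf_lbound; exists (f i j) => //; exists i => //; exists j.
Qed.

Lemma ereal_sup_iterated : values !=set0 -> has_ubound values ->
  ereal_sup [set ereal_sup [set (f i j)%:E | j in B i] | i in A] = (sup values)%:E.
Proof.
move=> v0 vub; rewrite -ereal_sup_EFin //; apply/eqP; rewrite eq_le; apply/andP; split.
- apply: ge_ereal_sup => _ [i Ai <-]; apply: ge_ereal_sup => _ [j Bj <-].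
  by apply: ereal_sup_ubound; exists (f i j) => //; exists i => //; exists j.
- apply: ge_ereal_sup => _ [_ [i Ai [j Bj <-]] <-].
  apply: (@le_trans _ _ (ereal_sup [set (f i j)%:E | j in B i])).
    by apply: ereal_sup_ubound; exists j.
  by apply: ereal_sup_ubound; exists i.
Qed.
End IteratedExtrema.

(** * Euclidean distance *)

Section EuclideanDistance.
Variables (R : realType) (d : nat).
Implicit Types x y : 'I_d -> R.

Lemma coord_le_eucl_dist x y c : `|x c - y c| <= eucl_dist x y.
Proof.
rewrite /eucl_dist -sqrtr_sqr ler_sqrt; last by apply: sumr_ge0 => i _; exact: sqr_ge0.
by rewrite (bigD1 c) //= lerDl sumr_ge0 // => i _; exact: sqr_ge0.
Qed.

Lemma eucl_dist_le_sum x y : eucl_dist x y <= \sum_c `|x c - y c|.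
Proof.
have s0 : 0 <= \sum_c `|x c - y c| by apply: sumr_ge0.
rewrite /eucl_dist -[leRHS](ger0_norm s0) -sqrtr_sqr ler_sqrt ?sqr_ge0 //.
rewrite expr2 mulr_suml ler_sum // => c _.
by rewrite -real_normK ?num_real // expr2 ler_wpM2l // (bigD1 c) //= lerDl sumr_ge0.
Qed.

Lemma eucl_dist_le x y r : (0 < d)%N -> (forall c, `|x c - y c| <= r / d%:R) ->
  eucl_dist x y <= r.
Proof.
move=> d0 xy; apply: (le_trans (eucl_dist_le_sum x y)).
apply: le_trans (ler_sum_card (V := predT) (fun c _ => xy c)) _.
by rewrite card_ord mulrC divfK // pnatr_eq0 -lt0n.
Qed.

Lemma eucl_distxx x : eucl_dist x x = 0.
Proof. by rewrite /eucl_dist big1 ?sqrtr0 // => c _; rewrite subrr expr0n. Qed.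
End EuclideanDistance.

(* Rounding the points to a grid of mesh [eta] is injective. *)
Lemma separated_card_le (R : archiRealFieldType) (d : nat) (I : finType) (A : pred I)
    (p : I -> 'I_d -> R) (z : 'I_d -> R) (eta rho : R) : 0 < eta ->
  (forall i c, A i -> `|p i c - z c| <= rho) ->
  (forall i j, A i -> A j -> i != j -> exists c, eta <= `|p i c - p j c|) ->
  (#|A| <= (Num.truncn (2 * rho / eta)).+1 ^ d)%N.
Proof.
move=> eta0 near sep; set K := Num.truncn _.
pose g i c := Num.truncn ((p i c - z c + rho) / eta).
have g0 i c : A i -> 0 <= (p i c - z c + rho) / eta.
  by move=> Ai; rewrite divr_ge0 ?(ltW eta0) //; have := near i c Ai; rewrite ler_norml; lra.
have gK i c : A i -> (g i c < K.+1)%N.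
  move=> Ai; rewrite ltnS le_truncn // ler_pM2r ?invr_gt0 //.
  by have := near i c Ai; rewrite ler_norml; lra.
pose f i : {ffun 'I_d -> 'I_K.+1} := [ffun c => inord (g i c)].
have finj : {in A &, injective f}.
  move=> i j Ai Aj fij; apply/eqP; apply: contraT => ij.
  have [c] := sep i j Ai Aj ij.
  have : g i c = g j c.
    have := congr1 (fun g' : {ffun 'I_d -> 'I_K.+1} => val (g' c)) fij.
    by rewrite /= !ffunE !inordK // gK.
  rewrite /g => e; have := truncn_itv (g0 i c Ai); have := truncn_itv (g0 j c Aj).
  rewrite -e -natr1; set n := (Num.truncn _)%:R => /andP[gj gj1] /andP[gi gi1].
  rewrite leNgt => /negP[]; rewrite ltr_norml; move: gj gj1 gi gi1.
  by rewrite !ler_pdivlMr // !ltr_pdivrMr // => *; nra.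
by rewrite -(card_in_image finj) (leq_trans (max_card _)) // card_ffun !card_ord.
Qed.

(** * Linear growth of real functions *)

Section GrowthRate.
Variable R : realType.
Implicit Types (g : R -> R) (tau : R).

Definition growth_rate g tau := g s / s @[s --> +oo] --> tau.

Lemma cvg_div_pinfty (c : R) : c / s @[s --> +oo] --> 0.
Proof.
rewrite -[X in _ --> X](mulr0 c); apply: cvgM; first exact: cvg_cst.
by apply/gtr0_cvgV0 => //; exact: nbhs_pinfty_gt.
Qed.

Lemma ln_le_sqrt (s : R) : 0 < s -> ln s <= 2 * Num.sqrt s.
Proof.
move=> s0; have r0 : 0 < Num.sqrt s by rewrite sqrtr_gt0.
rewrite -{1}(sqr_sqrtr (ltW s0)) lnXn // -[_ *+ 2]mulr_natl ler_pM2l //.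
exact/ltW/ln_sublinear.
Qed.

Lemma cvg_ln_div_pinfty : ln s / s @[s --> +oo] --> (0 : R).
Proof.
apply/cvgr0Pnorm_le => e e0; near=> s.
have s1 : 1 <= s by near: s; apply: nbhs_pinfty_ge; exact: num_real.
have s0 : 0 < s by exact: lt_le_trans s1.
rewrite ger0_norm ?divr_ge0 ?ln_ge0 ?(ltW s0) // ler_pdivrMr //.
apply: (le_trans (ln_le_sqrt s0)); rewrite -[X in _ <= _ * X](sqr_sqrtr (ltW s0)) expr2 mulrA.
rewrite ler_wpM2r ?sqrtr_ge0 // mulrC -ler_pdivrMr //.
by rewrite -[leLHS]ger0_norm ?divr_ge0 ?(ltW e0) // -sqrtr_sqr ler_sqrt // ltW.
Unshelve. all: by end_near. Qed.

Lemma growth_rate_linear tau : growth_rate (fun s => tau * s) tau.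
Proof.
apply: cvg_near_cst; near=> s.
by rewrite mulfK // gt_eqF //; near: s; exact: nbhs_pinfty_gt.
Unshelve. all: by end_near. Qed.

Lemma growth_rateN g tau : growth_rate g tau -> growth_rate (fun s => - g s) (- tau).
Proof. by rewrite /growth_rate; under [in X in _ -> X]eq_fun do rewrite mulNr; exact: cvgN. Qed.

Lemma growth_rateB g1 g2 t1 t2 : growth_rate g1 t1 -> growth_rate g2 t2 ->
  growth_rate (fun s => g1 s - g2 s) (t1 - t2).
Proof.
by rewrite /growth_rate; under [in X in _ -> _ -> X]eq_fun do rewrite mulrBl; exact: cvgB.
Qed.

Lemma growth_rate_le_frequently g tau b c : growth_rate g tau ->
  (forall s1, exists2 s, s1 <= s & g s <= s * b + c) -> tau <= b.
Proof.
move=> gtau freq; rewrite leNgt; apply/negP => bt.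
have lim : (g s - c) / s @[s --> +oo] --> tau.
  rewrite -[tau]subr0; under eq_fun do rewrite mulrBl.
  by apply: cvgB => //; exact: cvg_div_pinfty.
have [s1 [_ far]] : \forall s \near +oo, 0 < s /\ b < (g s - c) / s.
  near=> s; split; first by near: s; exact: nbhs_pinfty_gt.
  by near: s; exact: (cvgr_gt tau).
have [s s1s] := freq (s1 + 1).
have /far[s0] : s1 < s by apply: lt_le_trans s1s; rewrite ltrDl.
by rewrite ltr_pdivlMr // ltrBrDr leNgt mulrC => ->.
Unshelve. all: by end_near. Qed.

Lemma growth_rate_le g tau b c : growth_rate g tau ->
  (\forall s \near +oo, g s <= s * b + c) -> tau <= b.
Proof.
move=> gtau [s1 [_ g_le]]; apply: (growth_rate_le_frequently (c := c) gtau) => s2.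
exists (Num.max s2 (s1 + 1)); first by rewrite le_max lexx.
by apply: g_le; rewrite lt_max ltrDl ltr01 orbT.
Qed.

Lemma growth_rate_ge g tau b c : growth_rate g tau ->
  (\forall s \near +oo, s * b - c <= g s) -> b <= tau.
Proof.
move=> /growth_rateN gtau g_ge; rewrite -lerN2.
apply: (growth_rate_le (c := c) gtau); apply: filterS g_ge => s.
by rewrite mulrN -lerN2 opprB addrC.
Qed.

(* Fekete's lemma: the limit is the supremum of [(g s - err s) / (s + C')]. *)
Lemma growth_rate_ex g (err : R -> R) (C C' : R) : 0 <= C -> 0 <= C' ->
  (forall s, 1 <= s -> 0 <= err s) -> err s / s @[s --> +oo] --> 0 ->
  (forall s1, 1 <= s1 -> exists c, \forall s \near +oo,
     s * ((g s1 - err s1) / (s1 + C')) - c <= g s) ->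
  (forall s, 1 <= s -> g s <= C * s) -> exists tau, growth_rate g tau.
Proof.
move=> C0 C'0 err0 err_lim low up.
pose B s := (g s - err s) / (s + C').
pose E := [set B s | s in [set s | 1 <= s]].
have Eub : ubound E C.
  move=> _ [s /= s1 <-]; have s0 : 0 < s by exact: lt_le_trans s1.
  rewrite /B ler_pdivrMr ?ltr_pwDl // mulrDr lerBlDr.
  by rewrite (le_trans (up s s1)) // -addrA lerDl addr_ge0 ?mulr_ge0 ?err0.
have Esup : has_sup E by split; [exists (B 1), 1 => /= | exists C].
exists (sup E); apply/cvgrPdist_le => e e0.
have [_ [s1 /= s11 <-] Bs1] := sup_adherent (divr_gt0 e0 (ltr0Sn R 1)) Esup.
have [c low1] := low s1 s11.
have lim : sup E + `|sup E| * C' / s + err s / s @[s --> +oo] --> sup E.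
  rewrite -[X in _ --> X]addr0 -[X in _ --> X + _]addr0.
  by apply: cvgD => //; apply: cvgD; [exact: cvg_cst | exact: cvg_div_pinfty].
near=> s.
have s_ge1 : 1 <= s by near: s; apply: nbhs_pinfty_ge; exact: num_real.
have s0 : 0 < s by exact: lt_le_trans s_ge1.
rewrite ler_distlC; apply/andP; split.
- have cs : c / s <= e / 2.
    by near: s; apply: (cvgr_le 0); [exact: cvg_div_pinfty | rewrite divr_gt0].
  have : s * B s1 - c <= g s by near: s.
  rewrite ler_pdivlMr // -/(B s1); rewrite ler_pdivrMr // in cs.
  by move: Bs1 cs s0; clear; nra.
- have gs : g s <= sup E * (s + C') + err s.
    by rewrite -lerBlDr -ler_pdivrMr ?ltr_pwDl //; apply: sup_upper_bound => //; exists s.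
  apply: (@le_trans _ _ (sup E + `|sup E| * C' / s + err s / s)); last first.
    by near: s; apply: (cvgr_le (sup E)) => //; rewrite ltrDl.
  rewrite ler_pdivrMr // 2!mulrDl !divfK ?gt_eqF // (le_trans gs) // mulrDr lerD2r lerD2l.
  by rewrite ler_wpM2r // ler_norm.
Unshelve. all: by end_near. Qed.

Lemma growth_rate_cvg_ln g tau : growth_rate g tau ->
  g (- ln x) / - ln x @[x --> 0^'+] --> tau.
Proof.
apply: cvg_comp; under eq_cvg do rewrite -[ln _]opprK.
by apply/cvgNry; under eq_cvg do rewrite opprK; exact: lnNy.
Qed.

Lemma cvg_slope_of_affine_bound (F : set_system R) {FF : Filter F} (f : R -> R) (v C : R) :
  (\forall q \near F, `|f q + q * v| <= C) -> `|q| @[q --> F] --> +oo ->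
  f q / - q @[q --> F] --> v.
Proof.
move=> bound qy; apply/cvgrPdist_le => e e0; near=> q.
have q0 : 0 < `|q| by near: q; by move/cvgryPgt: qy; exact.
have qC : C / e <= `|q| by near: q; by move/cvgryPge: qy; exact.
have -> : v - f q / - q = (f q + q * v) / q by field; rewrite -normr_gt0.
rewrite normrM normfV ler_pdivrMr //; rewrite ler_pdivrMr // mulrC in qC.
by apply: le_trans qC; near: q.
Unshelve. all: by end_near. Qed.
End GrowthRate.

(** * Limits and pigeonhole arguments *)

Lemma cvg_weighted_sum (R : realType) (T : Type) (F : set_system T) {FF : Filter F}
    (I J : finType) (W : T -> I -> J -> R) (w : I -> J -> R) (Q : pred I)
    (G : I -> J -> R) :
  (forall i j, W x i j @[x --> F] --> w i j) ->
  \sum_(i | Q i) \sum_j W x i j * G i j @[x --> F] --> \sum_(i | Q i) \sum_j w i j * G i j.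
Proof.
move=> Ww; apply: (cvg_big (op := +%R)) => [|i _]; first exact: add_continuous.
apply: (cvg_big (op := +%R)) => [|j _]; first exact: add_continuous.
by apply: cvgM => //; exact: cvg_cst.
Qed.

Lemma ultra_cvg_bounded (R : realType) (U : set_system nat) (UU : UltraFilter U)
    (I : Type) (u : nat -> I -> R) (b : R) :
  (forall n i, 0 <= u n i <= b) -> exists l : I -> R, forall i, u n i @[n --> U] --> l i.
Proof.
move=> ub; suff lim i : exists l : R, u n i @[n --> U] --> l.
  by have [l lP] := choice lim; exists l.
have [|l [_ cl]] := @segment_compact R 0 b (u n i @[n --> U]) _.
  change (U ((fun n => u n i) @^-1` `[0, b]%classic)); apply: filterE => n.
  by rewrite /= in_itv /= ub.
exists l => A nA; have [//|nUA] := in_ultra_setVsetC ((fun n => u n i) @^-1` A) UU.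
by have [z []] := cl (~` A) A nUA nA.
Qed.

Lemma frequently_pigeonhole (R : realType) (I : finType) (Q : I -> R -> Prop) :
  (forall s1, exists i s, s1 <= s /\ Q i s) ->
  exists i, forall s1, exists2 s, s1 <= s & Q i s.
Proof.
move=> freq; apply: contrapT => /forallNP none.
have {}none i : exists s1, forall s, s1 <= s -> ~ Q i s.
  have /existsNP[s1 ns1] := none i; exists s1 => s s1s Qs.
  by apply: ns1; exists s.
have [f fP] := choice none.
have [i [s [fs Qs]]] := freq (\big[Num.max/0]_i f i).
by apply: (fP i s) => //; apply: le_trans fs; exact: le_bigmax.
Qed.

(** * Geometry of the coding *)

Record sponge (R : realType) (d N : nat) := Sponge {
  linear_part : 'I_N -> 'I_d -> R;
  translation : 'I_N -> 'I_d -> R;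
  weight : 'I_N -> R;
  dim_gt0 : (0 < d)%N;
  maps_gt0 : (0 < N)%N;
  ratio_in01 : forall i c, 0 < `|linear_part i c| < 1;
  cube_stable : forall i x, cube x -> cube (ifsmap linear_part translation i x);
  face_avoided : exists r0 : R, 0 < r0 /\ forall (c : 'I_d) (u : R), (u = 0 \/ u = 1) ->
    exists k, forall x y, cube x -> x c = u -> (ifsmap linear_part translation k @` cube) y ->
      r0 <= eucl_dist x y;
  weight_gt0 : forall i, 0 < weight i;
  weight_sum : \sum_i weight i = 1;
  projections_separated : SPPC linear_part translation }.

Definition shift_code (N : nat) (k : nat) (x : Sigma N) : Sigma N := fun l => x (k + l)%N.

Section Constants.
Variables (R : realType) (d N : nat) (S : sponge R d N).
Local Notation lam := (lam (linear_part S)).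
Implicit Types (c : 'I_d) (i : 'I_N).

Definition first_coord : 'I_d := Ordinal (dim_gt0 S).
Definition first_map : 'I_N := Ordinal (maps_gt0 S).
Definition ratio_min : R := \big[Num.min/1]_(p : 'I_N * 'I_d) lam p.1 p.2.
Definition ratio_max : R := \big[Num.max/0]_(p : 'I_N * 'I_d) lam p.1 p.2.
Definition weight_min : R := \big[Num.min/1]_i weight S i.

Lemma ratio_gt0 i c : 0 < lam i c.
Proof. by have /andP[] := ratio_in01 S i c. Qed.

Lemma ratio_lt1 i c : lam i c < 1.
Proof. by have /andP[] := ratio_in01 S i c. Qed.

Lemma ratio_min_le i c : ratio_min <= lam i c.
Proof. exact: (bigmin_le _ (i, c)). Qed.

Lemma ratio_max_ge i c : lam i c <= ratio_max.
Proof. exact: (le_bigmax _ _ (i, c)). Qed.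

Lemma ratio_min_gt0 : 0 < ratio_min.
Proof. by apply: lt_bigmin => // p _; exact: ratio_gt0. Qed.

Lemma ratio_max_lt1 : ratio_max < 1.
Proof. by apply: bigmax_lt => // p _; exact: ratio_lt1. Qed.

Lemma ratio_max_gt0 : 0 < ratio_max.
Proof. exact: lt_le_trans (ratio_gt0 first_map first_coord) (ratio_max_ge _ _). Qed.

Lemma ratio_min_lt1 : ratio_min < 1.
Proof. exact: le_lt_trans (ratio_min_le first_map first_coord) (ratio_lt1 _ _). Qed.

Lemma weight_min_gt0 : 0 < weight_min.
Proof. by apply: lt_bigmin => // i _; exact: weight_gt0. Qed.

Lemma weight_min_le1 : weight_min <= 1.
Proof. exact: bigmin_le_id. Qed.

Lemma weight_min_le i : weight_min <= weight S i.
Proof. exact: bigmin_le. Qed.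

Lemma dim_ge1 : 1 <= d%:R :> R.
Proof. by rewrite ler1n (dim_gt0 S). Qed.

Lemma dimR_gt0 : 0 < d%:R :> R.
Proof. exact: lt_le_trans dim_ge1. Qed.

(* Bounds for the Lyapunov exponents and for the information of one letter. *)
Definition lyap_min : R := - ln ratio_max.
Definition lyap_max : R := - ln ratio_min.
Definition info_max : R := - ln weight_min.

Lemma lyap_min_gt0 : 0 < lyap_min.
Proof. by rewrite oppr_gt0 ln_lt0 // ratio_max_gt0 ratio_max_lt1. Qed.

Lemma lyap_max_gt0 : 0 < lyap_max.
Proof. by rewrite oppr_gt0 ln_lt0 // ratio_min_gt0 ratio_min_lt1. Qed.

Lemma info_max_ge0 : 0 <= info_max.
Proof. by rewrite oppr_ge0 ln_le0 // weight_min_le1. Qed.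

Lemma lyap_bounds i c : lyap_min <= - ln (lam i c) <= lyap_max.
Proof.
by rewrite !lerN2 !ler_ln ?posrE ?ratio_min_le ?ratio_max_ge ?ratio_gt0 ?ratio_max_gt0
  ?ratio_min_gt0.
Qed.

Lemma lyap_gt0 i c : 0 < - ln (lam i c).
Proof. by have /andP[+ _] := lyap_bounds i c; exact: lt_le_trans lyap_min_gt0. Qed.
End Constants.

Section Cylinders.
Variables (R : realType) (d N : nat) (S : sponge R d N).
Implicit Types (x y : Sigma N) (c : 'I_d) (i : 'I_N).
Local Notation a := (linear_part S).
Local Notation t := (translation S).

Fixpoint comp_map x k c (z : R) : R :=
  if k is k'.+1 then comp_map x k' c (a (x k') c * z + t (x k') c) else z.
Definition comp_lin x k c : R := \prod_(l < k) a (x l) c.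
Definition side x k c : R := \prod_(l < k) lam a (x l) c.

Lemma compoE x k v c : compo a t x k v c = comp_map x k c (v c).
Proof. by elim: k v => [|k IH] v //=; rewrite IH. Qed.

Lemma norm_comp_lin x k c : `|comp_lin x k c| = side x k c.
Proof. by rewrite /comp_lin normr_prod. Qed.

Lemma side_gt0 x k c : 0 < side x k c.
Proof. by apply: prodr_gt0 => l _; exact: ratio_gt0. Qed.

Lemma comp_lin_neq0 x k c : comp_lin x k c != 0.
Proof. by rewrite -normr_gt0 norm_comp_lin side_gt0. Qed.

Lemma sideS x k c : side x k.+1 c = side x k c * lam a (x k) c.
Proof. exact: big_ord_recr. Qed.

Lemma sideD x k m c : side x (k + m) c = side x k c * side (shift_code k x) m c.
Proof. exact: big_split_ord. Qed.

Lemma side_le x k c : side x k c <= ratio_max S ^+ k.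
Proof. by apply: prod_le_expn => l; rewrite (ltW (ratio_gt0 _ _ _)) ratio_max_ge. Qed.

Lemma side_ge x k c : ratio_min S ^+ k <= side x k c.
Proof. by apply: expn_le_prod => [|l]; [exact/ltW/ratio_min_gt0 | exact: ratio_min_le]. Qed.

Lemma side_le1 x k c : side x k c <= 1.
Proof. by apply: prodr_ile1 => l _; rewrite !ltW ?ratio_gt0 ?ratio_lt1. Qed.

Lemma side_lt x k k' c : (k < k')%N -> side x k' c < side x k c.
Proof.
move=> kk; rewrite -(subnKC kk) addSnnS sideD gtr_pMr ?side_gt0 //.
by rewrite sideS mulrC (le_lt_trans (ler_piMr _ (side_le1 _ _ _))) ?ratio_lt1 // ltW ?ratio_gt0.
Qed.

Lemma side_nonincreasing x k k' c : (k <= k')%N -> side x k' c <= side x k c.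
Proof. by rewrite leq_eqVlt => /predU1P[->//|/side_lt/ltW]. Qed.

Lemma comp_map_sub x k c z z' :
  comp_map x k c z - comp_map x k c z' = comp_lin x k c * (z - z').
Proof.
elim: k z z' => [|k IH] z z'; first by rewrite /comp_lin big_ord0 mul1r.
by rewrite /= IH /comp_lin big_ord_recr /=; ring.
Qed.

Lemma comp_map_dist x k c z z' :
  `|comp_map x k c z - comp_map x k c z'| = side x k c * `|z - z'|.
Proof. by rewrite comp_map_sub normrM norm_comp_lin. Qed.

Lemma comp_mapE x k c z : comp_map x k c z = comp_map x k c 0 + comp_lin x k c * z.
Proof. by have := comp_map_sub x k c z 0; rewrite subr0 => <-; rewrite addrC subrK. Qed.

Lemma comp_map_inj x k c : injective (comp_map x k c).
Proof.
move=> z z' /eqP; rewrite -subr_eq0 comp_map_sub mulf_eq0 (negbTE (comp_lin_neq0 _ _ _)) /=.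
by rewrite subr_eq0 => /eqP.
Qed.

Lemma comp_map_surj x k c p : exists u, comp_map x k c u = p.
Proof.
exists ((p - comp_map x k c 0) / comp_lin x k c).
by rewrite comp_mapE mulrC divfK ?comp_lin_neq0 // addrC subrK.
Qed.

Lemma comp_mapD x k m c z :
  comp_map x (k + m) c z = comp_map x k c (comp_map (shift_code k x) m c z).
Proof. by elim: m z => [|m IH] z; [rewrite addn0 | rewrite addnS /= IH]. Qed.

Lemma comp_map_split x l k c z : (l < k)%N ->
  comp_map x k c z = comp_map x l.+1 c (comp_map (shift_code l.+1 x) (k - l.+1) c z).
Proof. by move=> lk; rewrite -comp_mapD subnKC. Qed.

Lemma map_unit i c z : 0 <= z <= 1 -> 0 <= a i c * z + t i c <= 1.
Proof. by move=> z01; exact: (@cube_stable _ _ _ S i (fun=> z) (fun=> z01) c). Qed.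

Lemma translation_unit i c : 0 <= t i c <= 1.
Proof. by have := @map_unit i c 0; rewrite mulr0 add0r; apply; rewrite lexx ler01. Qed.

Lemma comp_map_unit x k c z : 0 <= z <= 1 -> 0 <= comp_map x k c z <= 1.
Proof. by elim: k z => //= k IH z z01; apply: IH; exact: map_unit. Qed.

Lemma comp_map_endpoints x k c :
  (0 <= comp_map x k c 0 <= 1) && (0 <= comp_map x k c 0 + comp_lin x k c <= 1).
Proof.
by rewrite -[X in _ && (0 <= _ + X <= 1)]mulr1 -comp_mapE !comp_map_unit ?lexx ?ler01.
Qed.

Lemma comp_map_open x k c z : 0 < z < 1 -> 0 < comp_map x k c z < 1.
Proof.
move=> /andP[z0 z1]; rewrite comp_mapE.
have /andP[/andP[b0 b1] /andP[ba0 ba1]] := comp_map_endpoints x k c.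
by have := comp_lin_neq0 x k c; rewrite neq_lt => /orP[] A0; nra.
Qed.

Lemma comp_map_cvg x c : cvgn (fun k => comp_map x k c 0).
Proof.
pose u k := comp_lin x k c * t (x k) c.
have -> : (fun k => comp_map x k c 0) = series u.
  apply/funext => k; rewrite /series /=; elim: k => [|k IH]; first by rewrite big_nil.
  by rewrite big_nat_recr //= -IH mulr0 add0r comp_mapE.
apply: normed_cvg.
apply: (@series_le_cvg R (fun k => `|u k|) (geometric 1 (ratio_max S))) => [//|k|k|] /=.
- by rewrite mul1r exprn_ge0 // ltW // ratio_max_gt0.
- rewrite mul1r normrM norm_comp_lin; have /andP[t0 t1] := translation_unit (x k) c.
  by rewrite (ger0_norm t0) (le_trans _ (side_le x k c)) // ler_piMr // ltW ?side_gt0.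
- by apply: is_cvg_geometric_series; rewrite ger0_norm ?ratio_max_lt1 // ltW // ratio_max_gt0.
Qed.

Lemma coding_lim x c : coding a t x c = limn (fun k => comp_map x k c 0).
Proof. by congr (limn _); apply/funext => k; rewrite compoE. Qed.

Lemma comp_map_cvg_coding x c : comp_map x k c 0 @[k --> \oo] --> coding a t x c.
Proof. by rewrite coding_lim; exact: comp_map_cvg. Qed.

Lemma coding_unit x c : 0 <= coding a t x c <= 1.
Proof.
have bounds k : 0 <= comp_map x k c 0 <= 1 by apply: comp_map_unit; rewrite lexx ler01.
rewrite coding_lim.
apply/andP; split; [apply: limr_ge | apply: limr_le]; try exact: comp_map_cvg.
- by apply: nearW => k; have /andP[] := bounds k.
- by apply: nearW => k; have /andP[] := bounds k.
Qed.

Lemma coding_shift x k c : coding a t x c = comp_map x k c (coding a t (shift_code k x) c).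
Proof.
apply: (@cvg_unique _ _ (comp_map x (k + m) c 0 @[m --> \oo])); first exact: norm_hausdorff.
  by have := @comp_map_cvg_coding x c; rewrite -(cvg_shiftn k); under eq_fun do rewrite addnC.
rewrite /=; under eq_fun do rewrite comp_mapD comp_mapE; rewrite comp_mapE.
apply: cvgD; first exact: cvg_cst.
by apply: cvgM; [exact: cvg_cst | exact: comp_map_cvg_coding].
Qed.

Lemma eq_comp_lin x y k c :
  (forall l, (l < k)%N -> a (x l) c = a (y l) c) -> comp_lin x k c = comp_lin y k c.
Proof. by move=> xy; apply: eq_bigr => l _; exact: xy. Qed.

Lemma eq_comp_map x y k c :
  (forall l, (l < k)%N -> a (x l) c = a (y l) c /\ t (x l) c = t (y l) c) ->
  comp_map x k c =1 comp_map y k c.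
Proof.
elim: k => [//|k IH] xy z /=; have [-> ->] := xy k (ltnSn k).
by apply: IH => l lk; apply: xy; exact: ltnW.
Qed.
End Cylinders.

(** * Generalized approximate cubes *)

(* A family of cutoffs [M] prescribes the [l]-th letter only on the coordinates in [active M l];
   for [M = L_delta(x, -)], [acube M x] is the approximate cube of size [delta]. *)
Section ApproximateCubes.
Variables (R : realType) (d N : nat) (S : sponge R d N).
Implicit Types (x y : Sigma N) (c : 'I_d) (i j : 'I_N) (J : {set 'I_d}) (M : 'I_d -> nat).
Local Notation a := (linear_part S).
Local Notation t := (translation S).
Local Notation mu := (weight S).

Definition agree J i j : bool := [forall c in J, (a i c == a j c) && (t i c == t j c)].
Definition class_weight J i : R := \sum_(j | agree J i j) mu j.
Definition active M l : {set 'I_d} := [set c | (l < M c)%N].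
Definition acube M x : set (Sigma N) := [set y | forall l, agree (active M l) (x l) (y l)].
Definition acube_mass M x : R := \prod_(l < \max_c M c) class_weight (active M l) (x l).

Lemma agreeP J i j :
  reflect (forall c, c \in J -> a i c = a j c /\ t i c = t j c) (agree J i j).
Proof.
apply: (iffP 'forall_implyP) => ij c /ij.
- by move=> /andP[/eqP -> /eqP ->].
- by move=> [-> ->]; rewrite !eqxx.
Qed.

Lemma agree_refl J i : agree J i i.
Proof. by apply/agreeP. Qed.

Lemma agree_sym J i j : agree J i j = agree J j i.
Proof. by apply/agreeP/agreeP => ij c /ij[-> ->]. Qed.

Lemma agree_trans J i j k : agree J i j -> agree J j k -> agree J i k.
Proof.
by move=> /agreeP ij /agreeP jk; apply/agreeP => c cJ; have [-> ->] := ij c cJ; exact: jk.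
Qed.

Lemma agree_left J i j k : agree J i j -> agree J i k = agree J j k.
Proof.
move=> ij; apply/idP/idP; last exact: agree_trans ij.
by rewrite agree_sym in ij; exact: agree_trans ij.
Qed.

Lemma agree_sub J J' i j : J \subset J' -> agree J' i j -> agree J i j.
Proof. by move=> /fintype.subsetP JJ /agreeP ij; apply/agreeP => c /JJ/ij. Qed.

Lemma agree0 i j : agree finset.set0 i j.
Proof. by apply/agreeP => c; rewrite inE. Qed.

Lemma eq_class_weight J i j : agree J i j -> class_weight J i = class_weight J j.
Proof. by move=> ij; apply: eq_bigl => k; exact: agree_left. Qed.

Lemma weight_min_le_class J i : weight_min S <= class_weight J i.
Proof.
rewrite (le_trans (weight_min_le S i)) // /class_weight (bigD1 i) ?agree_refl //= lerDl.
by apply: sumr_ge0 => j _; exact/ltW/weight_gt0.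
Qed.

Lemma class_weight_gt0 J i : 0 < class_weight J i.
Proof. exact: lt_le_trans (weight_min_gt0 S) (weight_min_le_class J i). Qed.

Lemma class_weight_antimono J J' i : J \subset J' -> class_weight J' i <= class_weight J i.
Proof.
move=> JJ; rewrite /class_weight [leLHS]big_mkcond [leRHS]big_mkcond; apply: ler_sum => j _.
case: ifP => [/(agree_sub JJ) -> //|_].
by case: ifP => // _; exact/ltW/weight_gt0.
Qed.

Lemma class_weight0 i : class_weight finset.set0 i = 1.
Proof. by rewrite -(weight_sum S); apply: eq_bigl => j; exact: agree0. Qed.

Lemma class_weight_le1 J i : class_weight J i <= 1.
Proof. by rewrite -(class_weight0 i) class_weight_antimono // finset.sub0set. Qed.

Lemma info_bounds J i : 0 <= - ln (class_weight J i) <= info_max S.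
Proof.
rewrite oppr_ge0 ln_le0 ?class_weight_le1 //= lerN2 ler_ln ?posrE ?class_weight_gt0 //.
- exact: weight_min_le_class.
- exact: weight_min_gt0.
Qed.

Lemma active0 M l : (forall c, M c <= l)%N -> active M l = finset.set0.
Proof. by move=> Ml; apply/setP => c; rewrite !inE ltnNge Ml. Qed.

Lemma acube_refl M x : acube M x x.
Proof. by move=> l; exact: agree_refl. Qed.

Lemma acube_sym M x y : acube M x y -> acube M y x.
Proof. by move=> xy l; rewrite agree_sym. Qed.

Lemma acube_trans M x y z : acube M x y -> acube M y z -> acube M x z.
Proof. by move=> xy yz l; exact: agree_trans (xy l) (yz l). Qed.

Lemma acube_massE M x H : (forall c, M c <= H)%N ->
  acube_mass M x = \prod_(l < H) class_weight (active M l) (x l).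
Proof.
move=> MH; have maxH : (\max_c M c <= H)%N by apply/bigmax_leqP => c _.
rewrite -(subnKC maxH) big_split_ord /= [X in _ * X]big1 ?mulr1 // => l _.
rewrite active0 ?class_weight0 // => c.
by rewrite (leq_trans (leq_bigmax c)) ?leq_addr.
Qed.

Lemma acube_mass_gt0 M x : 0 < acube_mass M x.
Proof. by apply: prodr_gt0 => l _; exact: class_weight_gt0. Qed.

Lemma acube_mass_le1 M x : acube_mass M x <= 1.
Proof. by apply: prodr_ile1 => l _; rewrite (ltW (class_weight_gt0 _ _)) class_weight_le1. Qed.

Lemma acube_mass_ge M x H : (forall c, M c <= H)%N -> weight_min S ^+ H <= acube_mass M x.
Proof.
move=> /acube_massE ->; apply: expn_le_prod => [|l]; first exact/ltW/weight_min_gt0.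
exact: weight_min_le_class.
Qed.

Lemma eq_acube_mass M x y : acube M x y -> acube_mass M x = acube_mass M y.
Proof. by move=> xy; apply: eq_bigr => l _; exact: eq_class_weight. Qed.

Section CutoffExtension.
Variables (M M' : 'I_d -> nat) (E : nat).
Hypothesis M'_bounds : forall c, (M c <= M' c <= M c + E)%N.

Let cutoffs_crossed (l : nat) : nat := (\sum_(c < d) (M c <= l < M' c))%N.

Lemma active_mono l : active M l \subset active M' l.
Proof.
apply/fintype.subsetP => c; rewrite !inE => /leq_trans; apply.
by have /andP[] := M'_bounds c.
Qed.

Lemma class_weight_extended_ge l i :
  weight_min S ^+ cutoffs_crossed l * class_weight (active M l) i
  <= class_weight (active M' l) i.
Proof.
have m0 := weight_min_gt0 S.
have [|/set0Pn[c]] := eqVneq (active M' l :\: active M l)%SET finset.set0.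
  move=> /eqP; rewrite finset.setD_eq0 => M'M.
  have -> : active M' l = active M l by apply/eqP; rewrite finset.eqEsubset M'M active_mono.
  by rewrite ler_piMl ?(ltW (class_weight_gt0 _ _)) // exprn_ile1 ?weight_min_le1 // ltW.
rewrite !inE -leqNgt => cl; apply: le_trans (weight_min_le_class _ _).
rewrite -[leRHS]mulr1 ler_pM ?exprn_ge0 ?class_weight_le1 ?(ltW m0) //.
  exact/ltW/class_weight_gt0.
rewrite -[leRHS]expr1 ler_wiXn2l ?weight_min_le1 ?(ltW m0) //.
by rewrite /cutoffs_crossed (bigD1 c) //= cl.
Qed.

Lemma sum_cutoffs_crossed H : (forall c, M' c <= H)%N ->
  (\sum_(l < H) cutoffs_crossed l <= d * E)%N.
Proof.
move=> M'H; rewrite exchange_big /= -[X in (_ <= X * _)%N]card_ord -sum_nat_const.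
apply: leq_sum => c _; rewrite sum_itv_indicator // leq_subLR.
by have /andP[] := M'_bounds c.
Qed.

Lemma acube_mass_ext x :
  weight_min S ^+ (d * E) * acube_mass M x <= acube_mass M' x <= acube_mass M x.
Proof.
have M'H c : (M' c <= \max_c M' c)%N by exact: leq_bigmax.
have MH c : (M c <= \max_c M' c)%N by rewrite (leq_trans _ (M'H c)) //; have /andP[] := M'_bounds c.
rewrite (acube_massE x MH) (acube_massE x M'H); apply/andP; split; last first.
  apply: ler_prod => l _; rewrite (ltW (class_weight_gt0 _ _)).
  by rewrite class_weight_antimono ?active_mono.
have m0 := ltW (weight_min_gt0 S).
apply: (@le_trans _ _ (\prod_(l < \max_c M' c) (weight_min S ^+ cutoffs_crossed l *
    class_weight (active M l) (x l)))).
  rewrite big_split /= ler_wpM2r ?prodr_ge0 // => [l _|]; first exact/ltW/class_weight_gt0.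
  by rewrite prodrXr ler_wiXn2l ?weight_min_le1 ?sum_cutoffs_crossed.
apply: ler_prod => l _; rewrite class_weight_extended_ge andbT.
by rewrite mulr_ge0 ?exprn_ge0 // ltW ?class_weight_gt0.
Qed.
End CutoffExtension.

Lemma acube_letters M x y c l : acube M x y -> (l < M c)%N ->
  a (x l) c = a (y l) c /\ t (x l) c = t (y l) c.
Proof. by move=> xy lM; have /agreeP := xy l; apply; rewrite inE. Qed.

Lemma acube_side M x y c k : acube M x y -> (k <= M c)%N -> side S x k c = side S y k c.
Proof.
move=> xy kM; rewrite -!norm_comp_lin; congr `|_|; apply: eq_comp_lin => l lk.
by have [] := acube_letters xy (leq_trans lk kM).
Qed.

Lemma acube_comp_map M x y c k : acube M x y -> (k <= M c)%N ->
  comp_map S x k c =1 comp_map S y k c.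
Proof. by move=> xy kM; apply: eq_comp_map => l lk; exact: acube_letters xy (leq_trans lk kM). Qed.

Lemma coding_acube M x y c : acube M x y ->
  exists2 z, 0 <= z <= 1 & coding a t y c = comp_map S x (M c) c z.
Proof.
move=> xy; exists (coding a t (shift_code (M c) y) c); first exact: coding_unit.
by rewrite (coding_shift S y (M c)) (acube_comp_map xy).
Qed.

Lemma acube_diameter M x y c : acube M x y ->
  `|coding a t x c - coding a t y c| <= side S x (M c) c.
Proof.
move=> xy; have [z /andP[z0 z1] ->] := coding_acube c xy.
have [z' /andP[z'0 z'1] ->] := coding_acube c (acube_refl M x).
by rewrite comp_map_dist ler_piMr ?(ltW (side_gt0 _ _ _ _)) // ler_norml; lra.
Qed.
End ApproximateCubes.

(** * Separation of cuboids *)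

Section Separation.
Variables (R : realType) (d N : nat) (S : sponge R d N).
Implicit Types (x y : Sigma N) (c : 'I_d) (i j : 'I_N) (J : {set 'I_d}) (M : 'I_d -> nat).
Local Notation a := (linear_part S).
Local Notation t := (translation S).

Definition initial_coords (s : {perm 'I_d}) (n : nat) : {set 'I_d} :=
  [set s k | k : 'I_d & (k < n)%N].

Lemma mem_initial_coords (s : {perm 'I_d}) n k : (s k \in initial_coords s n) = (k < n)%N.
Proof.
apply/imsetP/idP => [[j]|kn]; first by rewrite inE => jn /perm_inj ->.
by exists k; rewrite ?inE.
Qed.

Lemma initial_coordsE s n c :
  (c \in initial_coords s n) = [exists k : 'I_d, (k < n)%N && (s k == c)].
Proof.
rewrite -{1}(permKV s c) mem_initial_coords; apply/idP/existsP => [kn|[k /andP[kn /eqP <-]]].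
  by exists ((s^-1)%g c); rewrite kn permKV eqxx.
by rewrite permK.
Qed.

Lemma initial_coords0 s : initial_coords s 0 = finset.set0.
Proof. by apply/setP => c; rewrite -(permKV s c) mem_initial_coords inE. Qed.

Lemma overlapE s n i j : overlap a t s n i j <-> agree S (initial_coords s n) i j.
Proof.
split=> [ij|/agreeP ij x _].
- apply/agreeP => c cE.
  have at0 := congr1 (fun f => f c) (ij (fun=> 0) (fun=> ltac:(by rewrite lexx ler01))).
  have at1 := congr1 (fun f => f c) (ij (fun=> 1) (fun=> ltac:(by rewrite lexx ler01))).
  move: at0 at1; rewrite /projE -initial_coordsE cE /ifsmap !mulr0 !mulr1 !add0r => ->.
  by move=> /addIr.
- apply/funext => c; rewrite /projE -initial_coordsE; case: ifP => // /ij[ac tc].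
  by rewrite /ifsmap ac tc.
Qed.

Definition separated J := forall i j, agree S J i j \/ exists2 c, c \in J &
  forall u z, 0 < u < 1 -> 0 < z < 1 -> a i c * u + t i c <> a j c * z + t j c.

Lemma separated_initial_coords s n : Aset a s -> (n <= d)%N -> separated (initial_coords s n).
Proof.
move=> As nd i j; case: (posnP n) => [->|n0]; first by left; rewrite initial_coords0 agree0.
have [|/overlapE ->|disj] := @projections_separated _ _ _ S s As n _ i j; first by rewrite n0.
  by left.
right; apply: contrapT => meet.
have {}meet c : exists uz : R * R, [/\ 0 < uz.1 < 1, 0 < uz.2 < 1 &
    c \in initial_coords s n -> a i c * uz.1 + t i c = a j c * uz.2 + t j c].
  have [cE|_] := boolP (c \in initial_coords s n); last first.
    by exists (1 / 2, 1 / 2); split => //=; apply/andP; split; lra.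
  apply: contrapT => disjc; apply: meet; exists c => // u z u01 z01 e.
  by apply: disjc; exists (u, z).
have [g gP] := choice meet.
have : set0 (projE s n (ifsmap a t i (fun c => (g c).1))); last by [].
rewrite -disj; split.
  exists (ifsmap a t i (fun c => (g c).1)) => //.
  by exists (fun c => (g c).1) => // c; have [] := gP c.
exists (ifsmap a t j (fun c => (g c).2)).
  by exists (fun c => (g c).2) => // c; have [] := gP c.
apply/funext => c; rewrite /projE -initial_coordsE; case: ifP => // cE.
by rewrite /ifsmap; have [_ _ ->] := gP c.
Qed.

(* A common point with [z] on the boundary is perturbed into one with [z] in the open interval. *)
Lemma separated_closed J i j : separated J -> ~~ agree S J i j -> exists2 c, c \in J &
  forall u z, 0 < u < 1 -> 0 <= z <= 1 -> a i c * u + t i c <> a j c * z + t j c.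
Proof.
move=> sJ nij; have [|[c cJ disj]] := sJ i j; first by rewrite (negbTE nij).
exists c => // u z /andP[u0 u1] /andP[z0 z1] e.
have ai0 : a i c != 0 by rewrite -normr_gt0; exact: (ratio_gt0 S).
pose k := a j c * (1 / 2 - z) / a i c.
pose D := 1 + `|k|.
have D1 : 1 <= D by rewrite lerDl.
pose m := Num.min u (1 - u).
have m0 : 0 < m by rewrite lt_min u0 subr_gt0.
have mu : m <= u by rewrite ge_min lexx.
have mu1 : m <= 1 - u by rewrite ge_min lexx orbT.
pose eps := m / 2 / D.
have epsD : eps * D = m / 2 by rewrite mulfVK // gt_eqF // (lt_le_trans ltr01).
have eps0 : 0 < eps by rewrite !divr_gt0 // (lt_le_trans ltr01).
have epsk : `|eps * k| <= m / 2 by rewrite normrM (gtr0_norm eps0) -epsD /D; nra.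
apply: (disj (u + eps * k) (z + eps * (1 / 2 - z))).
- by move: epsk; rewrite ler_norml => /andP[]; lra.
- by nra.
- have -> : a j c * (z + eps * (1 / 2 - z)) + t j c =
      (a j c * z + t j c) + eps * (a j c * (1 / 2 - z)) by ring.
  by rewrite -e /k; field.
Qed.

Definition separated_cutoffs M := forall l, separated (active M l).

Lemma acube_separation M x y : separated_cutoffs M -> ~ acube S M x y ->
  exists c, exists2 l, (l < M c)%N /\ side S x l c = side S y l c &
    forall u z, 0 < u < 1 -> 0 <= z <= 1 -> comp_map S x l.+1 c u <> comp_map S y l.+1 c z.
Proof.
move=> sM /existsNP ne.
have {}ne : exists l, ~~ agree S (active M l) (x l) (y l) by have [l /negP] := ne; exists l.
case: (ex_minnP ne) => l nl lmin.
have [c] := separated_closed (sM l) nl; rewrite inE => lM disj.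
have same_letters m : (m < l)%N -> a (x m) c = a (y m) c /\ t (x m) c = t (y m) c.
  move=> ml; have : agree S (active M m) (x m) (y m).
    by apply: contraTT ml => /lmin; rewrite -leqNgt.
  by move=> /agreeP; apply; rewrite inE (ltn_trans ml).
exists c, l; first split=> //.
  rewrite -!norm_comp_lin; congr `|_|; apply: eq_comp_lin => m ml.
  by have [] := same_letters m ml.
by move=> u z u01 z01 /=; rewrite (eq_comp_map same_letters) => /comp_map_inj; exact: disj.
Qed.

Lemma cuboids_disjoint M x y p : separated_cutoffs M -> ~ acube S M x y ->
  (forall c, exists2 u, 0 < u < 1 & p c = comp_map S x (M c) c u) ->
  (forall c, exists2 z, 0 <= z <= 1 & p c = comp_map S y (M c) c z) -> False.
Proof.
move=> sM nxy px py; have [c [l [lM _] disj]] := acube_separation sM nxy.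
have [u u01] := px c; have [z z01 ->] := py c.
rewrite !(comp_map_split _ _ _ _ lM) => /esym; apply: disj.
- exact: comp_map_open.
- exact: comp_map_unit.
Qed.
End Separation.

(** * A word whose cylinder avoids the faces of the cube *)

Section InteriorWord.
Variables (R : realType) (d N : nat) (S : sponge R d N).
Implicit Types (x y : Sigma N) (c : 'I_d).
Local Notation a := (linear_part S).
Local Notation t := (translation S).

Lemma face_escape : exists2 r0 : R, 0 < r0 & forall c u, u = 0 \/ u = 1 ->
  exists k, forall z, 0 <= z <= 1 -> r0 <= `|a k c * z + t k c - u|.
Proof.
have [r0 [r00 avoid]] := face_avoided S; exists r0 => // c u u01.
have [k avoidk] := avoid c u u01; exists k => z z01.
pose y := ifsmap a t k (fun=> z).
have ycube : cube y by apply: cube_stable => n.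
pose x n := if n == c then u else y n.
have xcube : cube x.
  by move=> n; rewrite /x; case: eqP => // _; case: u01 => ->; rewrite ?lexx ?ler01.
have := avoidk x y xcube; rewrite /x eqxx => /(_ erefl) dist.
apply: le_trans (dist _) _; first by exists (fun=> z).
apply: le_trans (eucl_dist_le_sum _ _) _.
rewrite (bigD1 c) //= eqxx big1 ?addr0 => [|n /negbTE ->]; first by rewrite distrC.
by rewrite subrr normr0.
Qed.

Lemma face_pullback x k c (b : bool) : exists2 u : R, u = 0 \/ u = 1 &
  forall z, 0 <= z <= 1 -> side S x k c * `|z - u| <= `|comp_map S x k c z - b%:R|.
Proof.
have /andP[/andP[B0 B1] /andP[BA0 BA1]] := comp_map_endpoints S x k c.
have A0 := comp_lin_neq0 S x k c.
exists (if 0 < comp_lin S x k c then b else ~~ b)%:R.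
  by case: (if _ then _ else _); [right|left].
move=> z z01; have := comp_map_unit S x k c z01; move: z01.
rewrite comp_mapE -norm_comp_lin -normrM; move: A0 B0 B1 BA0 BA1.
set A := comp_lin _ _ _ _; set B := comp_map _ _ _ _ 0.
rewrite neq_lt => /orP[] A0 B0 B1 BA0 BA1 /andP[z0 z1] /andP[m0 m1];
  rewrite ?A0 ?(lt_gtF A0); case: b => /=; rewrite ?subr0.
- by rewrite (ler0_norm (_ : A * z <= 0)) ?(ler0_norm (_ : B + A * z - 1 <= 0)); nra.
- by rewrite (ger0_norm (_ : 0 <= A * (z - 1))) ?(ger0_norm (_ : 0 <= B + A * z)); nra.
- by rewrite (ler0_norm (_ : A * (z - 1) <= 0)) ?(ler0_norm (_ : B + A * z - 1 <= 0)); nra.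
- by rewrite (ger0_norm (_ : 0 <= A * z)) ?(ger0_norm (_ : 0 <= B + A * z)); nra.
Qed.

(* The face to be avoided next is pulled back through the word built so far. *)
Lemma word_avoiding_faces (faces : seq ('I_d * bool)) :
  exists (K : nat) (W : Sigma N) (rho : R),
  0 < rho /\ forall y, (forall l, (l < K)%N -> y l = W l) ->
    forall f, f \in faces -> rho <= `|coding a t y f.1 - f.2%:R|.
Proof.
elim: faces => [|[c b] faces [K [W [rho [rho0 IH]]]]].
  by exists 0%N, (fun=> first_map S), 1; split.
have [r0 r00 escape] := face_escape.
have [u u01 pull] := face_pullback W K c b.
have [k hk] := escape c u u01.
exists K.+1, (fun l => if (l < K)%N then W l else k), (Num.min rho (side S W K c * r0)).
split; first by rewrite lt_min rho0 mulr_gt0 // side_gt0.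
move=> y yW f; have yW' l : (l < K)%N -> y l = W l by move=> lK; rewrite yW ?lK // ltnW.
rewrite inE => /orP[/eqP -> /=|ff]; last by rewrite ge_min IH.
rewrite ge_min (coding_shift S y K) (@eq_comp_map _ _ _ S y W); last by move=> l /yW' ->.
apply/orP; right; apply: le_trans (pull _ (coding_unit _ _ _)).
rewrite ler_pM2l ?side_gt0 // (coding_shift S (shift_code K y) 1) /=.
have -> : shift_code K y 0 = k by rewrite /shift_code addn0 yW // ltnn.
by apply: hk; exact: coding_unit.
Qed.

Lemma interior_word : exists (K : nat) (W : Sigma N) (rho : R),
  0 < rho /\ forall y, (forall l, (l < K)%N -> y l = W l) ->
    forall c, rho <= coding a t y c <= 1 - rho.
Proof.
have [K [W [rho [rho0 far]]]] := word_avoiding_faces (enum {: 'I_d * bool}).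
exists K, W, rho; split=> // y yW c.
have := far y yW (c, false) (mem_enum _ _); have := far y yW (c, true) (mem_enum _ _).
have /andP[c0 c1] := coding_unit S y c.
by rewrite /= subr0 (ger0_norm c0) ler0_norm; lra.
Qed.
End InteriorWord.

(** * Measure of approximate cubes and balls *)

Definition iid_law (R : realType) (N : nat) (mu : 'I_N -> R) (dm : measure_display)
  (T : measurableType dm) (P : probability T R) (X : T -> Sigma N) : Prop :=
  forall k (w : 'I_k -> 'I_N), measurable (X @^-1` cyl w) /\
    P (X @^-1` cyl w) = (\prod_(j < k) mu (w j))%:E.

Section Words.
Variables (R : realType) (d N : nat) (S : sponge R d N).
Implicit Types (x : Sigma N) (H : nat).

Definition prefix H x : {ffun 'I_H -> 'I_N} := [ffun l : 'I_H => x l].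

Definition code_of_word H (v : {ffun 'I_H -> 'I_N}) : Sigma N :=
  fun l => if insub l is Some k then v k else first_map S.

Lemma code_of_wordE H (v : {ffun 'I_H -> 'I_N}) l (lH : (l < H)%N) :
  code_of_word v l = v (Ordinal lH).
Proof. by rewrite /code_of_word insubT. Qed.

Lemma comp_map_prefix x k c : comp_map S x k c =1 comp_map S (code_of_word (prefix k x)) k c.
Proof. by apply: eq_comp_map => l lk; rewrite (code_of_wordE _ lk) ffunE. Qed.
End Words.

Section SpongeMeasure.
Variables (R : realType) (d N : nat) (S : sponge R d N).
Variables (dm : measure_display) (T : measurableType dm) (P : probability T R).
Variables (X : T -> Sigma N).
Hypothesis XP : iid_law (weight S) P X.
Local Notation a := (linear_part S).
Local Notation t := (translation S).
Local Notation mu := (weight S).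
Implicit Types (x y : Sigma N) (c : 'I_d) (M : 'I_d -> nat) (r : R).

Definition sponge_measure (A : set ('I_d -> R)) : \bar R := P ((coding a t \o X) @^-1` A).
Definition ball_mass z r : R := fine (sponge_measure (cballE z r)).

Lemma prefix_event H (Q : pred {ffun 'I_H -> 'I_N}) :
  measurable [set w | Q (prefix H (X w))] /\
  P [set w | Q (prefix H (X w))] = (\sum_(v | Q v) \prod_l mu (v l))%:E.
Proof.
have -> : [set w | Q (prefix H (X w))] =
    \bigcup_(v in [set` Q]) (X @^-1` cyl (v : 'I_H -> 'I_N)).
  apply/seteqP; split=> [w /= Qw|w [v /= Qv] Xv].
  - by exists (prefix H (X w)) => // l; rewrite ffunE.
  - by rewrite (_ : prefix H (X w) = v) //; apply/ffunP => l; rewrite ffunE Xv.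
have mcyl v : [set` Q] v -> measurable (X @^-1` cyl (v : 'I_H -> 'I_N)).
  by move=> _; have [] := XP (v : 'I_H -> 'I_N).
split; first exact: fin_bigcup_measurable.
rewrite measure_fin_bigcup //; last first.
  by move=> v v' _ _ [w [/= vw v'w]]; apply/ffunP => l; rewrite -vw -v'w.
rewrite -(@bigfs _ _ _ _ (index_enum {ffun 'I_H -> 'I_N})) ?index_enum_uniq //; last first.
  by move=> v _; rewrite mem_index_enum.
rewrite -sumEFin; apply: eq_bigr => v _.
by have [_] := XP (v : 'I_H -> 'I_N).
Qed.

Lemma acube_event M x :
  measurable (X @^-1` acube S M x) /\ P (X @^-1` acube S M x) = (acube_mass S M x)%:E.
Proof.
pose H := (\max_c M c)%N; pose Q (l : 'I_H) j := agree S (active M l) (x l) j.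
have -> : X @^-1` acube S M x = [set w | prefix H (X w) \in family Q].
  apply/seteqP; split=> [w /= xw|w /= /familyP xw l].
  - by apply/familyP => l; rewrite unfold_in /Q ffunE; exact: xw.
  - have [lH|Hl] := ltnP l H; first by have := xw (Ordinal lH); rewrite unfold_in /Q ffunE.
    by rewrite active0 ?agree0 // => c; exact: leq_trans (leq_bigmax c) Hl.
have [m ->] := prefix_event (mem (family Q)); split=> //; congr _%:E.
by rewrite /acube_mass /class_weight (bigA_distr_big_dep Q (fun _ j => mu j)); apply: eq_bigl.
Qed.

Lemma prefix_measurable H (f : {ffun 'I_H -> 'I_N} -> R) :
  measurable_fun setT (fun w => f (prefix H (X w))).
Proof.
move=> _ Y mY; rewrite setTI.
have [m _] := prefix_event (fun v => f v \in Y).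
rewrite (_ : _ @^-1` _ = [set w | f (prefix H (X w)) \in Y]) //.
by apply/seteqP; split=> w /=; rewrite inE.
Qed.

Lemma sqr_dist_measurable z :
  measurable_fun setT (fun w => \sum_(c < d) (z c - coding a t (X w) c) ^+ 2).
Proof.
pose sqr_dist y k : R := \sum_(c < d) (z c - comp_map S y k c 0) ^+ 2.
apply: (@measurable_fun_cvg _ _ _ _ (fun k w => sqr_dist (X w) k)) => [k|w _].
  rewrite (_ : (fun w => _) = fun w => sqr_dist (code_of_word S (prefix k (X w))) k).
    exact: (prefix_measurable (fun v => sqr_dist (code_of_word S v) k)).
  by apply/funext => w; apply: eq_bigr => c _; rewrite comp_map_prefix.
apply: (cvg_big (op := +%R) (P := xpredT)) => [|c _]; first exact: add_continuous.
by rewrite expr2; under eq_fun do rewrite expr2; apply: cvgM;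
  apply: cvgB; first [exact: cvg_cst | exact: comp_map_cvg_coding].
Qed.

Lemma ball_measurable z r : measurable ((coding a t \o X) @^-1` cballE z r).
Proof.
have [r0|r0] := ltP r 0.
  rewrite (_ : _ @^-1` _ = set0) //; apply/seteqP; split=> // w /=.
  by rewrite /cballE /= leNgt (lt_le_trans r0) // sqrtr_ge0.
have := sqr_dist_measurable z measurableT (measurable_itv `]-oo, r ^+ 2]%R).
rewrite setTI; congr measurable; apply/seteqP.
split=> w /=; rewrite in_itv /= /cballE /= /eucl_dist.
- by move=> sq_le; rewrite -[leRHS](ger0_norm r0) -sqrtr_sqr ler_sqrt ?sqr_ge0.
- set sq := \sum_c _; have sq0 : 0 <= sq by apply: sumr_ge0 => c _; exact: sqr_ge0.
  by move=> dist_le; rewrite -(sqr_sqrtr sq0) ler_sqr // nnegrE sqrtr_ge0.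
Qed.

Lemma ball_massE z r : sponge_measure (cballE z r) = (ball_mass z r)%:E.
Proof.
rewrite /ball_mass fineK // ge0_fin_numE //.
by rewrite (le_lt_trans (probability_le1 P (ball_measurable z r))) // ltry.
Qed.

Lemma ball_mass_ge0 z r : 0 <= ball_mass z r.
Proof. exact: fine_ge0. Qed.

Lemma ball_mass_le1 z r : ball_mass z r <= 1.
Proof. by rewrite -lee_fin -ball_massE probability_le1 //; exact: ball_measurable. Qed.

Lemma acube_mass_le_ball M x z r :
  (forall y, acube S M x y -> cballE z r (coding a t y)) -> acube_mass S M x <= ball_mass z r.
Proof.
move=> sub; rewrite -lee_fin -ball_massE; have [m <-] := acube_event M x.
by apply: le_measure; rewrite ?inE //; [exact: ball_measurable | move=> w; exact: sub].
Qed.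

Lemma ball_mass_le_acube M x z r :
  (forall y, cballE z r (coding a t y) -> acube S M x y) -> ball_mass z r <= acube_mass S M x.
Proof.
move=> sub; rewrite -lee_fin -ball_massE; have [m <-] := acube_event M x.
by apply: le_measure; rewrite ?inE //; [exact: ball_measurable | move=> w; exact: sub].
Qed.

Lemma ball_mass_le_sum (I : finType) (Q : pred I) (M : I -> 'I_d -> nat) (x : I -> Sigma N) z r :
  (forall y, cballE z r (coding a t y) -> exists2 i, Q i & acube S (M i) (x i) y) ->
  ball_mass z r <= \sum_(i | Q i) acube_mass S (M i) (x i).
Proof.
move=> cover; rewrite -lee_fin -ball_massE -sumEFin.
pose F i := X @^-1` acube S (M i) (x i).
have FE i : measurable (F i) /\ P (F i) = (acube_mass S (M i) (x i))%:E by exact: acube_event.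
rewrite (eq_bigr (fun i => P (F i))) => [|i _]; last by have [_ ->] := FE i.
rewrite (@bigfs _ _ _ _ (index_enum I)) ?index_enum_uniq //; last first.
  by move=> i _; rewrite mem_index_enum.
apply: content_sub_fsum => [//|i _||w /cover[i Qi xi]]; [by have [] := FE i| |by exists i].
exact: ball_measurable.
Qed.

Lemma ball_mass_mono z r r' : r <= r' -> ball_mass z r <= ball_mass z r'.
Proof.
move=> rr; rewrite -lee_fin -!ball_massE.
apply: le_measure; rewrite ?inE; try exact: ball_measurable.
by move=> w /= /le_trans; apply.
Qed.

Lemma msupp_ball_mass_gt0 z r : msupp sponge_measure z -> 0 < r -> 0 < ball_mass z r.
Proof. by move=> zs r0; rewrite -lte_fin -ball_massE; exact: zs. Qed.

Lemma msupp_near_coding z r : msupp sponge_measure z -> 0 < r ->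
  exists y, cballE z r (coding a t y).
Proof.
move=> zs r0; apply: contrapT => /forallNP far.
have := zs r r0; rewrite /sponge_measure (_ : _ @^-1` _ = set0) ?measure0 ?ltxx //.
by apply/seteqP; split=> // w /far.
Qed.
End SpongeMeasure.

(** * Approximate cubes of a given size *)

Section DescendingOrders.
Variable d : nat.
Implicit Types (f : 'I_d -> nat) (s : {perm 'I_d}).

Definition descending f s := forall k1 k2 : 'I_d, (k2 : nat) = k1.+1 ->
  (f (s k2) <= f (s k1))%N /\ (f (s k2) = f (s k1) -> (s k1 < s k2)%N).

Definition antitone_along s f := forall k1 k2 : 'I_d, (k1 <= k2)%N -> (f (s k2) <= f (s k1))%N.

Lemma descending_ex f : exists s, descending f s.
Proof.
pose r (c c' : 'I_d) := (f c' < f c)%N || ((f c == f c') && (c <= c')%N).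
have r_total : total r.
  by move=> c c'; rewrite /r; case: (ltngtP (f c) (f c')) => //= _; exact: leq_total.
have r_trans : transitive r.
  move=> y x z; rewrite /r => /orP[yx|/andP[/eqP fxy xy]] /orP[zy|/andP[/eqP fyz yz]].
  - by rewrite (ltn_trans zy yx).
  - by rewrite -fyz yx.
  - by rewrite fxy zy.
  - by rewrite fxy fyz eqxx (leq_trans xy yz) orbT.
pose q := sort r (enum 'I_d).
have szq : size q = d by rewrite size_sort size_enum_ord.
pose g (k : 'I_d) : 'I_d := nth k q k.
have g_inj : injective g.
  move=> k k' /eqP; rewrite /g (set_nth_default k') ?szq //.
  by rewrite nth_uniq ?szq // ?sort_uniq ?enum_uniq // => /eqP/val_inj.
exists (perm g_inj) => k1 k2 k12; rewrite !permE.
have : r (g k1) (g k2).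
  rewrite /g (set_nth_default k1 k2) ?szq // k12.
  by apply: (sorted_ltn_nth r_trans k1 (sort_sorted r_total _)); rewrite ?inE ?szq // -k12.
rewrite /r => /orP[flt|/andP[/eqP feq gle]].
  by split; [exact: ltnW | move=> feq; move: flt; rewrite feq ltnn].
split=> [|_]; first by rewrite feq.
move: gle; rewrite leq_eqVlt => /predU1P[/val_inj/g_inj keq|//].
by move: k12; rewrite keq => /n_Sn.
Qed.

Lemma antitone_along_adjacent f s :
  (forall k1 k2 : 'I_d, (k2 : nat) = k1.+1 -> (f (s k2) <= f (s k1))%N) -> antitone_along s f.
Proof.
move=> adj k1 [m md] /=; elim: m md => [|m IH] md.
  by rewrite leqn0 => /eqP e; rewrite (_ : Ordinal md = k1) //; exact/val_inj.
rewrite leq_eqVlt => /predU1P[e|km]; first by rewrite (_ : Ordinal md = k1) //; exact/val_inj.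
by apply: leq_trans (IH (ltnW md) km); exact: adj.
Qed.

Lemma descending_antitone f s : descending f s -> antitone_along s f.
Proof. by move=> fs; apply: antitone_along_adjacent => k1 k2 /fs[]. Qed.

Lemma active_antitone f s l : antitone_along s f ->
  exists2 n, (n <= d)%N & active f l = initial_coords s n.
Proof.
move=> fs; pose Q (k : 'I_d) := (l < f (s k))%N.
exists (\max_(k | Q k) k.+1)%N; first by apply/bigmax_leqP => k _; exact: ltn_ord.
apply/setP => c; rewrite -(permKV s c) mem_initial_coords inE; set k := (s^-1)%g c.
apply/idP/idP => [Qk|]; first exact: (@leq_bigmax_cond _ Q (fun k => k.+1)).
have [k0 Qk0|Q0] := pickP Q; last by rewrite big_pred0.
have [|k' Qk' ->] := @eq_bigmax_cond _ Q (fun k : 'I_d => k.+1).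
  by apply/card_gt0P; exists k0.
by rewrite ltnS => /fs; exact: leq_trans Qk'.
Qed.
End DescendingOrders.

Section Cutoffs.
Variables (R : realType) (d N : nat) (S : sponge R d N).
Local Notation a := (linear_part S).
Local Notation t := (translation S).
Implicit Types (x y : Sigma N) (c : 'I_d) (i j : 'I_N) (J : {set 'I_d}) (delta : R).

Definition cutoff_bound delta : nat := (Num.truncn (ln delta / ln (ratio_max S))).+1.

Lemma ln_ratio_max_lt0 : ln (ratio_max S) < 0.
Proof. by rewrite ln_lt0 // ratio_max_gt0 ratio_max_lt1. Qed.

Lemma ratio_max_cutoff_bound delta : 0 < delta -> ratio_max S ^+ cutoff_bound delta <= delta.
Proof.
move=> d0; rewrite -ler_ln ?posrE ?exprn_gt0 ?ratio_max_gt0 // lnXn ?ratio_max_gt0 //.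
rewrite -mulr_natr mulrC -ler_ndivrMr ?ln_ratio_max_lt0 //.
exact/ltW/truncnS_gt.
Qed.

Lemma Lprop_ex x delta c : 0 < delta < 1 -> exists L, Lprop a x delta c L.
Proof.
move=> /andP[d0 d1].
have ex : exists k, side S x k c <= delta.
  by exists (cutoff_bound delta); rewrite (le_trans (side_le _ _ _ _)) ?ratio_max_cutoff_bound.
case: (ex_minnP ex) => L Ld Lmin; exists L.
have L0 : (0 < L)%N by case: L Ld {Lmin} => //; rewrite /side big_ord0 leNgt d1.
split=> //; apply/andP; split=> //.
by rewrite ltNge; apply/negP => /Lmin; rewrite leqNgt ltn_predL L0.
Qed.

Lemma Lprop_uniq x delta c L L' : Lprop a x delta c L -> Lprop a x delta c L' -> L = L'.
Proof.
suff Lprop_le n m : Lprop a x delta c n -> Lprop a x delta c m -> (n <= m)%N.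
  by move=> LP LP'; apply/eqP; rewrite eqn_leq !Lprop_le.
move=> [n0 /andP[_ above]] [m0 /andP[below _]]; rewrite leqNgt; apply/negP => mn.
have := le_lt_trans below above; rewrite ltNge => /negP; apply.
by apply: side_nonincreasing; rewrite -ltnS prednK.
Qed.

(* [L_delta(x, c)]. *)
Definition cutoff delta x c : nat := xget 0%N [set L | Lprop a x delta c L].

Definition cube_mass delta x : R := acube_mass S (cutoff delta x) x.

Definition cube_center delta x c : R := comp_map S x (cutoff delta x c) c (1 / 2).

Definition class_rep J i : 'I_N := [arg min_(k < i | agree S J i k) (k : nat)].

Lemma class_repP J i :
  agree S J i (class_rep J i) /\ forall k, agree S J i k -> (class_rep J i <= k)%N.
Proof. by rewrite /class_rep; case: arg_minnP; rewrite ?agree_refl. Qed.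

Lemma agree_class_rep J i : agree S J i (class_rep J i).
Proof. by have [] := class_repP J i. Qed.

Lemma eq_class_rep J i j : agree S J i j -> class_rep J i = class_rep J j.
Proof.
move=> ij; have [ii mini] := class_repP J i; have [jj minj] := class_repP J j.
apply/val_inj/eqP; rewrite eqn_leq /= mini ?minj //; first by rewrite -(agree_left _ ij).
by rewrite (agree_left _ ij).
Qed.

Definition canonical_word delta x : {ffun 'I_(cutoff_bound delta) -> 'I_N} :=
  [ffun l : 'I_(cutoff_bound delta) => class_rep (active (cutoff delta x) l) (x l)].

Definition is_canonical delta v := canonical_word delta (code_of_word S v) == v.

Lemma cube_mass_gt0 delta x : 0 < cube_mass delta x.
Proof. exact: acube_mass_gt0. Qed.

Lemma cube_mass_le1 delta x : cube_mass delta x <= 1.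
Proof. exact: acube_mass_le1. Qed.

Section FixedSize.
Variable delta : R.
Hypothesis delta_in01 : 0 < delta < 1.

Lemma cutoffP x c : Lprop a x delta c (cutoff delta x c).
Proof. by have [L LP] := Lprop_ex x c delta_in01; rewrite /cutoff; case: xgetP => // /(_ L). Qed.

Lemma side_cutoff x c : ratio_min S * delta <= side S x (cutoff delta x c) c <= delta.
Proof.
have [L0 /andP[below above]] := cutoffP x c; have /andP[d0 _] := delta_in01.
rewrite below andbT -(prednK L0) sideS mulrC.
by rewrite ler_pM ?ratio_min_le ?(ltW (ratio_min_gt0 S)) ?(ltW above) // ltW.
Qed.

Lemma lt_cutoff x c l : (l < cutoff delta x c)%N = (delta < side S x l c).
Proof.
have [L0 /andP[below above]] := cutoffP x c; apply/idP/idP => [lL|]; last first.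
  by apply: contraTT; rewrite -leqNgt -leNgt => /(side_nonincreasing S x c)/le_trans; apply.
by apply: (lt_le_trans above); apply: side_nonincreasing; rewrite -ltnS prednK.
Qed.

Lemma cutoff_le_bound x c : (cutoff delta x c <= cutoff_bound delta)%N.
Proof.
have /andP[d0 _] := delta_in01; rewrite leqNgt lt_cutoff -leNgt.
by rewrite (le_trans (side_le _ _ _ _)) ?ratio_max_cutoff_bound.
Qed.

Lemma acube_cutoff x y : acube S (cutoff delta x) x y -> cutoff delta y = cutoff delta x.
Proof.
move=> xy; apply/funext => c; apply: (@Lprop_uniq y delta c); first exact: cutoffP.
have [L0 sides] := cutoffP x c; split=> //; move: sides.
by rewrite -!/(side S _ _ _) !(acube_side xy) // leq_pred.
Qed.

Lemma Aset_cutoff x : exists2 s, Aset a s & descending (cutoff delta x) s.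
Proof.
have [s sP] := descending_ex (cutoff delta x); exists s => //.
by exists x, delta; split=> //; exists (cutoff delta x); split=> // c; exact: cutoffP.
Qed.

Lemma separated_cutoff x : separated_cutoffs S (cutoff delta x).
Proof.
move=> l; have [s As /descending_antitone sP] := Aset_cutoff x.
by have [n nd ->] := active_antitone l sP; exact: separated_initial_coords.
Qed.

Lemma canonical_word_acube x :
  acube S (cutoff delta x) x (code_of_word S (canonical_word delta x)).
Proof.
move=> l; have [lH|Hl] := ltnP l (cutoff_bound delta).
  by rewrite (code_of_wordE _ _ lH) ffunE; exact: agree_class_rep.
by rewrite active0 ?agree0 // => c; exact: leq_trans (cutoff_le_bound x c) Hl.
Qed.

Lemma cutoff_canonical x :
  cutoff delta (code_of_word S (canonical_word delta x)) = cutoff delta x.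
Proof. exact/acube_cutoff/canonical_word_acube. Qed.

Lemma acube_of_canonical x :
  acube S (cutoff delta (code_of_word S (canonical_word delta x)))
    (code_of_word S (canonical_word delta x)) x.
Proof. by rewrite cutoff_canonical; apply: acube_sym; exact: canonical_word_acube. Qed.

Lemma eq_canonical_word x y :
  acube S (cutoff delta x) x y -> canonical_word delta x = canonical_word delta y.
Proof.
by move=> xy; apply/ffunP => l; rewrite !ffunE (acube_cutoff xy); exact: eq_class_rep.
Qed.

Lemma canonical_word_is_canonical x : is_canonical (canonical_word delta x).
Proof. by rewrite /is_canonical -(eq_canonical_word (canonical_word_acube x)). Qed.

Lemma cube_mass_canonical x :
  cube_mass delta (code_of_word S (canonical_word delta x)) = cube_mass delta x.
Proof. by rewrite /cube_mass cutoff_canonical -(eq_acube_mass (canonical_word_acube x)). Qed.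

Lemma canonical_words_disjoint v v' :
  is_canonical (delta := delta) v -> is_canonical (delta := delta) v' -> v != v' ->
  ~ acube S (cutoff delta (code_of_word S v)) (code_of_word S v) (code_of_word S v').
Proof.
move=> /eqP cv /eqP cv' vv /eq_canonical_word e.
by move: vv; rewrite -cv -cv' e eqxx.
Qed.

Lemma cube_center_near x y c : acube S (cutoff delta x) x y ->
  `|coding a t y c - cube_center delta x c| <= delta.
Proof.
move=> xy; have [z /andP[z0 z1] ->] := coding_acube c xy.
have /andP[_ side_le] := side_cutoff x c.
rewrite comp_map_dist (le_trans _ side_le) // ler_piMr ?(ltW (side_gt0 _ _ _ _)) //.
by rewrite ler_norml; lra.
Qed.

Lemma cube_center_separated x y : ~ acube S (cutoff delta x) x y ->
  exists c, ratio_min S * delta / 2 <= `|cube_center delta x c - cube_center delta y c|.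
Proof.
move=> nxy; have [c [l [lx sides] disj]] := acube_separation (separated_cutoff x) nxy.
have ly : (l < cutoff delta y c)%N by rewrite lt_cutoff -sides -lt_cutoff.
exists c; rewrite leNgt; apply/negP => close.
have [u uP] := comp_map_surj S x (cutoff delta x c) c (cube_center delta y c).
have u01 : 0 < u < 1.
  have : `|1 / 2 - u| < 1 / 2.
    rewrite -(ltr_pM2l (side_gt0 S x (cutoff delta x c) c)) -comp_map_dist uP.
    by apply: (lt_le_trans close); have /andP[side_ge _] := side_cutoff x c; lra.
  by rewrite ltr_norml; lra.
move: uP; rewrite /cube_center (comp_map_split _ _ _ _ lx) (comp_map_split _ _ _ _ ly).
apply: disj; first exact: comp_map_open.
by apply: comp_map_unit; apply/andP; split; lra.
Qed.
End FixedSize.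

Definition cube_moment delta (q : R) : R :=
  \sum_(v | is_canonical (delta := delta) v) cube_mass delta (code_of_word S v) `^ q.

Lemma cube_moment_ge0 delta q : 0 <= cube_moment delta q.
Proof. by apply: sumr_ge0 => v _; exact: powR_ge0. Qed.
End Cutoffs.

(** * Moment sums over balls and over approximate cubes *)

Section MomentUpperBound.
Variables (R : realType) (d N : nat) (S : sponge R d N).
Variables (dm : measure_display) (T : measurableType dm) (P : probability T R).
Variables (X : T -> Sigma N).
Hypothesis XP : iid_law (weight S) P X.
Local Notation a := (linear_part S).
Local Notation t := (translation S).
Local Notation nu := (sponge_measure S P X).
Local Notation ball_mass := (ball_mass S P X).
Local Notation code := (code_of_word S).
Implicit Types (x y : Sigma N) (c : 'I_d) (delta q : R).

Definition disjoint_balls delta k (xs : 'I_k -> 'I_d -> R) : Prop :=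
  (forall j, msupp nu (xs j)) /\
  (forall j1 j2, j1 != j2 -> cballE (xs j1) delta `&` cballE (xs j2) delta = set0).

(* Bounds from [separated_card_le]: how many approximate cubes of size [fine_scale delta] meet a
   ball of radius [delta], and how many disjoint balls of radius [delta] meet such a cube. *)
Definition cubes_per_ball : nat := ((Num.truncn (16 * d%:R / ratio_min S)).+1 ^ d)%N.
Definition balls_per_cube : nat := ((Num.truncn (4 * d%:R : R)).+1 ^ d)%N.
Definition moment_const q : R := cubes_per_ball%:R `^ q * balls_per_cube%:R + 1.
Definition fine_scale delta : R := delta / (2 * d%:R).

Lemma moment_const_ge1 q : 1 <= moment_const q.
Proof. by rewrite lerDr mulr_ge0 ?powR_ge0. Qed.

Lemma Tdelta_le delta q B :
  (forall k (xs : 'I_k -> 'I_d -> R), disjoint_balls delta xs ->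
    \sum_j ball_mass (xs j) delta `^ q <= B) ->
  Tdelta nu q delta <= B.
Proof.
move=> bound; apply: ge_sup => [|_ [k [xs [supp [disj ->]]]]]; last exact: bound.
exists (\sum_(j < 0) 0), 0%N, (fun _ _ => 0).
by split=> [[]//|]; split=> [[]//|]; rewrite !big_ord0.
Qed.

Section FixedRadius.
Variable delta : R.
Hypothesis delta_in01 : 0 < delta < 1.
Let eps := fine_scale delta.

Lemma fine_scale_in01 : 0 < eps < 1.
Proof.
have d1 := dim_ge1 S; have d0 := dimR_gt0 S; have /andP[d_gt0 d_lt1] := delta_in01.
by rewrite divr_gt0 ?mulr_gt0 //= ltr_pdivrMr ?mulr_gt0 //; lra.
Qed.

Lemma fine_scaleE : 2 * eps = delta / d%:R.
Proof. by rewrite /eps /fine_scale; field; rewrite gt_eqF // (dimR_gt0 S). Qed.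

Lemma fine_scale_le : 2 * eps <= delta.
Proof.
have /andP[d_gt0 _] := delta_in01.
by rewrite fine_scaleE ler_pdivrMr ?(dimR_gt0 S) // ler_peMr ?(dim_ge1 S) // ltW.
Qed.

Definition cube_meets_ball z (v : {ffun 'I_(cutoff_bound S eps) -> 'I_N}) : bool :=
  is_canonical (delta := eps) v && `[< exists2 y, cballE z delta (coding a t y) &
    acube S (cutoff S eps (code v)) (code v) y >].

Lemma canonical_word_meets_ball z y : cballE z delta (coding a t y) ->
  cube_meets_ball z (canonical_word S eps y).
Proof.
move=> yz; rewrite /cube_meets_ball canonical_word_is_canonical ?fine_scale_in01 //=.
by apply/asboolP; exists y => //; apply: acube_of_canonical; exact: fine_scale_in01.
Qed.

Lemma cube_meeting_ball_near z v c : cube_meets_ball z v ->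
  `|cube_center S eps (code v) c - z c| <= 2 * delta.
Proof.
move=> /andP[_ /asboolP[y yz vy]].
have := cube_center_near fine_scale_in01 c vy; have := fine_scale_le.
have := le_trans (coord_le_eucl_dist z (coding a t y) c) yz.
by rewrite !ler_norml; lra.
Qed.

Lemma card_cubes_meeting_ball z : (#|cube_meets_ball z| <= cubes_per_ball)%N.
Proof.
have /andP[d_gt0 _] := delta_in01; have /andP[eps0 _] := fine_scale_in01.
have r0 := ratio_min_gt0 S; have dR0 := dimR_gt0 S.
have -> : cubes_per_ball = ((Num.truncn (2 * (2 * delta) / (ratio_min S * eps / 2))).+1 ^ d)%N.
  by congr ((Num.truncn _).+1 ^ d)%N; rewrite /eps /fine_scale; field; rewrite !gt_eqF.
apply: (separated_card_le (p := fun v => cube_center S eps (code v)) (z := z)).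
- by rewrite divr_gt0 // mulr_gt0.
- by move=> v c; exact: cube_meeting_ball_near.
- move=> v v' /andP[cv _] /andP[cv' _] vv'; apply: (cube_center_separated fine_scale_in01).
  exact: (canonical_words_disjoint fine_scale_in01).
Qed.

Lemma card_balls_meeting_cube k (xs : 'I_k -> 'I_d -> R) v : disjoint_balls delta xs ->
  (#|[pred j | cube_meets_ball (xs j) v]| <= balls_per_cube)%N.
Proof.
move=> [_ disj]; have /andP[d_gt0 _] := delta_in01; have dR0 := dimR_gt0 S.
have -> : balls_per_cube = ((Num.truncn (2 * (2 * delta) / (delta / d%:R))).+1 ^ d)%N.
  by congr ((Num.truncn _).+1 ^ d)%N; field; rewrite !gt_eqF.
apply: (separated_card_le (p := xs) (z := cube_center S eps (code v))).
- exact: divr_gt0.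
- by move=> j c /= meets; rewrite distrC; exact: cube_meeting_ball_near.
- move=> j j' _ _ jj'; apply: contrapT => /forallNP near.
  suff : (cballE (xs j) delta `&` cballE (xs j') delta) (xs j') by rewrite disj.
  split; last by rewrite /cballE /= eucl_distxx ltW.
  by apply: eucl_dist_le (dim_gt0 S) _ => c; rewrite leNgt; apply/negP => /ltW/near.
Qed.

Lemma ball_mass_powR_le z q : 0 <= q -> msupp nu z ->
  ball_mass z delta `^ q <=
  cubes_per_ball%:R `^ q * \sum_(v | cube_meets_ball z v) cube_mass S eps (code v) `^ q.
Proof.
move=> q0 zs; have /andP[d_gt0 _] := delta_in01.
have cube_mass_ge0 v : 0 <= cube_mass S eps (@code_of_word _ _ _ S (cutoff_bound S eps) v).
  exact/ltW/cube_mass_gt0.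
have [y yz] := msupp_near_coding zs d_gt0.
apply: (@le_trans _ _ ((\sum_(v | cube_meets_ball z v) cube_mass S eps (code v)) `^ q)).
  have masses_ge0 : 0 <= \sum_(v | cube_meets_ball z v) cube_mass S eps (code v).
    by apply: sumr_ge0 => v _; exact: cube_mass_ge0.
  apply: ge0_ler_powR; rewrite ?nnegrE ?ball_mass_ge0 //.
  apply: ball_mass_le_sum => // y' y'z; exists (canonical_word S eps y').
    exact: canonical_word_meets_ball.
  by apply: acube_of_canonical; exact: fine_scale_in01.
apply: (le_trans (powR_sum_le (canonical_word_meets_ball yz) cube_mass_ge0 q0)).
rewrite ler_wpM2r ?sumr_ge0 // => [v _|]; first exact: powR_ge0.
by rewrite ge0_ler_powR ?nnegrE ?ler0n // ler_nat card_cubes_meeting_ball.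
Qed.

Lemma ball_moment_le_of_ge0 k (xs : 'I_k -> 'I_d -> R) q : 0 <= q -> disjoint_balls delta xs ->
  \sum_j ball_mass (xs j) delta `^ q <=
  cubes_per_ball%:R `^ q * balls_per_cube%:R * cube_moment S eps q.
Proof.
move=> q0 balls; have [supp _] := balls.
apply: (@le_trans _ _ (\sum_j cubes_per_ball%:R `^ q *
    \sum_(v | cube_meets_ball (xs j) v) cube_mass S eps (code v) `^ q)).
  by apply: ler_sum => j _; exact: ball_mass_powR_le.
rewrite -mulr_sumr -mulrA ler_wpM2l ?powR_ge0 //.
rewrite (exchange_big_dep (is_canonical (S := S) (delta := eps))) /=; last by move=> j v _ /andP[].
rewrite mulr_sumr; apply: ler_sum => v _.
apply: (le_trans (ler_sum_card (fun _ _ => lexx _))).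
by rewrite ler_wpM2r ?powR_ge0 // ler_nat card_balls_meeting_cube.
Qed.

Lemma fine_cube_in_ball z y y' : cballE z eps (coding a t y) ->
  acube S (cutoff S eps y) y y' -> cballE z delta (coding a t y').
Proof.
move=> yz yy'; apply: eucl_dist_le (dim_gt0 S) _ => c; rewrite -fine_scaleE.
have /andP[_ side_small] := side_cutoff S fine_scale_in01 y c.
have := le_trans (coord_le_eucl_dist z (coding a t y) c) yz.
by have := le_trans (acube_diameter c yy') side_small; rewrite !ler_norml; lra.
Qed.

Lemma ball_moment_le_of_le0 k (xs : 'I_k -> 'I_d -> R) q : q <= 0 -> disjoint_balls delta xs ->
  \sum_j ball_mass (xs j) delta `^ q <= cube_moment S eps q.
Proof.
move=> q0 [supp disj]; have eps01 := fine_scale_in01; have /andP[eps0 _] := eps01.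
have [y yP] := choice (fun j => msupp_near_coding (supp j) eps0).
pose v j := canonical_word S eps (y j).
have v_inj : injective v.
  move=> j j' vv; apply/eqP; apply: contraT => jj'.
  suff : (cballE (xs j) delta `&` cballE (xs j') delta) (coding a t (y j')) by rewrite disj.
  split; last exact: fine_cube_in_ball (yP j') (acube_refl _ _ _).
  apply: (fine_cube_in_ball (yP j)).
  apply: acube_trans (canonical_word_acube S eps01 (y j)) _.
  by rewrite -(cutoff_canonical S eps01 (y j)) -/(v j) vv; exact: acube_of_canonical.
apply: (@le_trans _ _ (\sum_j cube_mass S eps (code (v j)) `^ q)).
  apply: ler_sum => j _; apply: le0_ler_powR => //; first exact: cube_mass_gt0.
  by rewrite cube_mass_canonical //; apply: acube_mass_le_ball => // y'; exact: fine_cube_in_ball.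
apply: sum_inj_le v_inj _ _ => [j|w]; first exact: canonical_word_is_canonical.
exact: powR_ge0.
Qed.

Lemma ball_moment_le k (xs : 'I_k -> 'I_d -> R) q : disjoint_balls delta xs ->
  \sum_j ball_mass (xs j) delta `^ q <= moment_const q * cube_moment S eps q.
Proof.
move=> balls; have Z0 := cube_moment_ge0 S eps q.
have [q0|q0] := leP 0 q.
  by apply: le_trans (ball_moment_le_of_ge0 q0 balls) _; rewrite ler_wpM2r // lerDl.
by apply: le_trans (ball_moment_le_of_le0 (ltW q0) balls) _; rewrite ler_peMl ?moment_const_ge1.
Qed.

Lemma Tdelta_le_cube_moment q : Tdelta nu q delta <= moment_const q * cube_moment S eps q.
Proof. by apply: Tdelta_le => k xs; exact: ball_moment_le. Qed.

Lemma ball_moment_le_Tdelta q (I : finType) (A : pred I) (p : I -> 'I_d -> R) :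
  (forall i, A i -> msupp nu (p i)) ->
  (forall i j, A i -> A j -> i != j -> cballE (p i) delta `&` cballE (p j) delta = set0) ->
  \sum_(i | A i) ball_mass (p i) delta `^ q <= Tdelta nu q delta.
Proof.
move=> supp disj.
have -> : \sum_(i | A i) ball_mass (p i) delta `^ q =
    \sum_(j < #|A|) ball_mass (p (enum_val j)) delta `^ q.
  by rewrite -(@big_enum_val _ _ _ _ A (fun i => ball_mass (p i) delta `^ q)); exact: eq_bigl.
apply: ub_le_sup; first exists (moment_const q * cube_moment S eps q).
  by move=> _ [k [xs [supp' [disj' ->]]]]; exact: ball_moment_le.
exists #|A|, (fun j => p (enum_val j)); split=> [j|]; first by apply: supp; exact: (enum_valP j).
split=> // j1 j2 j12; apply: disj; try exact: enum_valP.
by apply: contra_neq j12; exact: enum_val_inj.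
Qed.

Lemma ball_mass_powR_le_Tdelta z q : msupp nu z -> ball_mass z delta `^ q <= Tdelta nu q delta.
Proof.
move=> zs; have := @ball_moment_le_Tdelta q unit predT (fun=> z) (fun _ _ => zs).
by rewrite big_const card_unit /= addr0; apply => [] [] [].
Qed.
End FixedRadius.

Lemma coding_msupp x : msupp nu (coding a t x).
Proof.
move=> r r0; rewrite ball_massE // lte_fin.
pose eps := Num.min (r / d%:R) (1 / 2).
have eps01 : 0 < eps < 1.
  by rewrite lt_min gt_min divr_gt0 ?(dimR_gt0 S) //= (_ : 1 / 2 < 1 :> R) ?orbT ?andbT; lra.
apply: lt_le_trans (cube_mass_gt0 S eps x) _; apply: acube_mass_le_ball => // y xy.
apply: eucl_dist_le (dim_gt0 S) _ => c; apply: le_trans (acube_diameter c xy) _.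
have /andP[_ side_small] := side_cutoff S eps01 x c.
by rewrite (le_trans side_small) // ge_min lexx.
Qed.

Lemma Tdelta_gt0 q delta : 0 < delta < 1 -> 0 < Tdelta nu q delta.
Proof.
move=> delta01; have supp := coding_msupp (fun=> first_map S).
apply: lt_le_trans (ball_mass_powR_le_Tdelta delta01 q supp).
by apply: powR_gt0; apply: msupp_ball_mass_gt0 => //; have /andP[] := delta01.
Qed.
End MomentUpperBound.

(** * Interleaving words *)

Definition disjoint_cubes (R : realType) (d N : nat) (S : sponge R d N) (delta : R)
    (M : 'I_d -> nat) (I : finType) (U : pred I) (u : I -> Sigma N) : Prop :=
  (forall i, U i -> cutoff S delta (u i) = M) /\
  (forall i j, U i -> U j -> i != j -> ~ acube S M (u i) (u j)).

Section Interleaving.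
Variables (R : realType) (d N : nat) (S : sponge R d N).
Local Notation a := (linear_part S).
Local Notation t := (translation S).
Variables (K : nat) (W : Sigma N).
Variables (delta0 : R) (M : 'I_d -> nat) (I : finType) (U : pred I) (u : I -> Sigma N).
Hypothesis delta0_in01 : 0 < delta0 < 1.
Hypothesis u_cubes : disjoint_cubes S delta0 M U u.
Variable r : nat.
Hypothesis r_gt0 : (0 < r)%N.
Local Notation h := (K + r)%N.
Local Notation H := (\max_c M c)%N.
Implicit Types (c : 'I_d) (V : {ffun 'I_r -> I}).

(* Block number [l], of length [K + r], is the prefix of [W] followed by the [l]-th letters of the
   [r] words. With all cutoffs multiplied by [K + r], every cutoff is followed by that prefix, so
   that the coded point lies deep inside its cuboid, and the levels of the [r] words are aligned. *)
Definition interleave V : Sigma N := fun l =>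
  if (l %% h < K)%N then W (l %% h)%N else
  if insub (l %% h - K)%N is Some k then u (V k) (l %/ h)%N else first_map S.

Definition block_cutoff c : nat := (M c * h)%N.

Lemma block_gt0 : (0 < h)%N.
Proof. by rewrite addn_gt0 r_gt0 orbT. Qed.

Lemma interleave_prefix V l j : (j < K)%N -> interleave V (l * h + j)%N = W j.
Proof. by move=> jK; rewrite /interleave modnMDl modn_small ?jK // ltn_addr. Qed.

Lemma interleave_letter V l (k : 'I_r) : interleave V (l * h + (K + k))%N = u (V k) l.
Proof.
have kh : (K + k < h)%N by rewrite ltn_add2l.
rewrite /interleave modnMDl modn_small // ltnNge leq_addr /= addKn valK.
by rewrite divnMDl ?block_gt0 // divn_small // addn0.
Qed.

Lemma active_block_cutoff l : active block_cutoff l = active M (l %/ h)%N.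
Proof. by apply/setP => c; rewrite !inE ltn_divLR // block_gt0. Qed.

Lemma active_in_block l j : (j < h)%N -> active block_cutoff (l * h + j)%N = active M l.
Proof. by move=> jh; rewrite active_block_cutoff divnMDl ?block_gt0 // divn_small // addn0. Qed.

Lemma side_interleave V c : side S (interleave V) (block_cutoff c) c =
  side S W K c ^+ M c * \prod_k side S (u (V k)) (M c) c.
Proof.
rewrite /side (prod_blocks (M c) K r (fun l => lam a (interleave V l) c)); congr (_ * _).
  rewrite -[X in _ ^+ X]card_ord -prodr_const; apply: eq_bigr => l _.
  by apply: eq_bigr => j _; rewrite interleave_prefix.
by rewrite exchange_big; apply: eq_bigr => k _; apply: eq_bigr => l _; rewrite interleave_letter.
Qed.

Lemma acube_mass_interleave V : acube_mass S block_cutoff (interleave V) =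
  (\prod_(l < H) \prod_(j < K) class_weight S (active M l) (W j)) *
  \prod_k acube_mass S M (u (V k)).
Proof.
rewrite (@acube_massE _ _ _ S _ _ (H * h)) => [|c]; last by rewrite leq_mul2r leq_bigmax orbT.
rewrite (prod_blocks H K r (fun l => class_weight S (active block_cutoff l) (interleave V l))).
congr (_ * _).
  apply: eq_bigr => l _; apply: eq_bigr => j _.
  by rewrite interleave_prefix // active_in_block // ltn_addr.
rewrite exchange_big; apply: eq_bigr => k _; apply: eq_bigr => l _.
by rewrite interleave_letter active_in_block // ltn_add2l.
Qed.

Lemma acube_mass_interleave_bounds V :
  weight_min S ^+ (K * H) * \prod_k acube_mass S M (u (V k))
  <= acube_mass S block_cutoff (interleave V) <= \prod_k acube_mass S M (u (V k)).
Proof.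
have m0 := ltW (weight_min_gt0 S).
have masses0 : 0 <= \prod_k acube_mass S M (u (V k)).
  by apply: prodr_ge0 => k _; exact/ltW/acube_mass_gt0.
rewrite acube_mass_interleave; apply/andP; split.
- rewrite ler_wpM2r // exprM; apply: expn_le_prod => [|l]; first exact: exprn_ge0.
  by apply: expn_le_prod => // j; exact: weight_min_le_class.
- rewrite ler_piMl //; apply: prodr_ile1 => l _.
  rewrite prodr_ge0 /= => [|j _]; last exact/ltW/class_weight_gt0.
  by apply: prodr_ile1 => j _; rewrite class_weight_le1 (ltW (class_weight_gt0 _ _ _)).
Qed.

Lemma separated_block_cutoff V : V \in ffun_on U -> separated_cutoffs S block_cutoff.
Proof.
move=> /ffun_onP/(_ (Ordinal r_gt0)) UV l.
by rewrite active_block_cutoff -(u_cubes.1 _ UV); exact: separated_cutoff.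
Qed.

Lemma interleave_disjoint V V' : V \in ffun_on U -> V' \in ffun_on U -> V != V' ->
  ~ acube S block_cutoff (interleave V) (interleave V').
Proof.
move=> /ffun_onP UV /ffun_onP UV' VV' same.
have [k Vk] : exists k, V k != V' k.
  apply/existsP; apply: contraT; rewrite negb_exists => /forallP eqV; case/negP: VV'.
  by apply/eqP/ffunP => k; apply/eqP; rewrite -[_ == _]negbK.
apply: (u_cubes.2 _ _ (UV k) (UV' k) Vk) => l.
by have := same (l * h + (K + k))%N; rewrite !interleave_letter active_in_block // ltn_add2l.
Qed.

Lemma side_interleave_bounds V c : V \in ffun_on U ->
  ratio_min S ^+ (K * H) * (ratio_min S * delta0) ^+ r
  <= side S (interleave V) (block_cutoff c) c <= delta0 ^+ r.
Proof.
move=> /ffun_onP UV; have /andP[d0 _] := delta0_in01.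
have r0 := ltW (ratio_min_gt0 S); have r1 := ltW (ratio_min_lt1 S).
have sides k : ratio_min S * delta0 <= side S (u (V k)) (M c) c <= delta0.
  by rewrite -(u_cubes.1 _ (UV k)); exact: side_cutoff.
have prod0 : 0 <= \prod_k side S (u (V k)) (M c) c.
  by apply: prodr_ge0 => k _; exact/ltW/side_gt0.
rewrite side_interleave; apply/andP; split.
- apply: ler_pM; rewrite ?exprn_ge0 ?mulr_ge0 ?(ltW d0) //.
  + rewrite exprM; apply: (@le_trans _ _ ((ratio_min S ^+ K) ^+ M c)).
      by rewrite ler_wiXn2l ?exprn_ge0 ?exprn_ile1 ?leq_bigmax.
    by rewrite lerXn2r ?nnegrE ?exprn_ge0 ?(ltW (side_gt0 _ _ _ _)) ?side_ge.
  + by apply: expn_le_prod => [|k]; [rewrite mulr_ge0 // ltW | have /andP[] := sides k].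
- apply: (@le_trans _ _ (\prod_k side S (u (V k)) (M c) c)).
    by rewrite ler_piMl // exprn_ile1 ?side_le1 ?(ltW (side_gt0 _ _ _ _)).
  by apply: prod_le_expn => k; rewrite (ltW (side_gt0 _ _ _ _)); have /andP[] := sides k.
Qed.

Section Balls.
Variables (rho delta : R).
Hypothesis rho_gt0 : 0 < rho.
Hypothesis W_interior : forall y, (forall l, (l < K)%N -> y l = W l) ->
  forall c, rho <= coding a t y c <= 1 - rho.
Hypothesis delta_small : delta < rho * (ratio_min S ^+ (K * H) * (ratio_min S * delta0) ^+ r).

Lemma ball_in_cuboid V p : V \in ffun_on U -> cballE (coding a t (interleave V)) delta p ->
  forall c, exists2 z, 0 < z < 1 & p c = comp_map S (interleave V) (block_cutoff c) c z.
Proof.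
move=> UV near c; set x := interleave V; set k := block_cutoff c.
have [z zP] := comp_map_surj S x k c (p c); exists z => //.
have /andP[side_ge _] := side_interleave_bounds c UV.
have /andP[w0 w1] : rho <= coding a t (shift_code k x) c <= 1 - rho.
  by apply: W_interior => l lK; rewrite /shift_code /x /k interleave_prefix.
have : `|coding a t (shift_code k x) c - z| < rho.
  rewrite -(ltr_pM2l (side_gt0 S x k c)) -comp_map_dist -coding_shift zP.
  apply: (le_lt_trans (coord_le_eucl_dist _ _ _)); apply: (le_lt_trans near).
  by rewrite (lt_le_trans delta_small) // mulrC ler_pM2r.
by rewrite ltr_norml; lra.
Qed.

Variables (dm : measure_display) (T : measurableType dm) (P : probability T R).
Variables (X : T -> Sigma N).
Hypothesis XP : iid_law (weight S) P X.
Hypothesis delta_in01 : 0 < delta < 1.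
Local Notation nu := (sponge_measure S P X).
Local Notation ball_mass := (ball_mass S P X).

Lemma balls_interleave_disjoint V V' : V \in ffun_on U -> V' \in ffun_on U -> V != V' ->
  cballE (coding a t (interleave V)) delta `&` cballE (coding a t (interleave V')) delta = set0.
Proof.
move=> UV UV' VV'; apply/seteqP; split=> // p [pV pV'].
apply: (cuboids_disjoint (separated_block_cutoff UV) (interleave_disjoint UV UV' VV')
  (ball_in_cuboid UV pV)) => c.
by have [z /andP[z0 z1] ->] := ball_in_cuboid UV' pV' c; exists z => //; rewrite !ltW.
Qed.

Lemma ball_mass_interleave_le V : V \in ffun_on U ->
  ball_mass (coding a t (interleave V)) delta <= \prod_k acube_mass S M (u (V k)).
Proof.
move=> UV; have /andP[_ mass_le] := acube_mass_interleave_bounds V; apply: le_trans mass_le.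
apply: ball_mass_le_acube => // y yb; apply: contrapT => ny.
apply: (cuboids_disjoint (separated_block_cutoff UV) ny (ball_in_cuboid UV yb)) => c.
exact: coding_acube (acube_refl _ _ _).
Qed.

Lemma ball_mass_interleave_ge V E : V \in ffun_on U ->
  ratio_max S ^+ E * delta0 ^+ r <= delta / d%:R ->
  weight_min S ^+ (d * E + K * H) * \prod_k acube_mass S M (u (V k))
  <= ball_mass (coding a t (interleave V)) delta.
Proof.
move=> UV fits; have /andP[mass_ge _] := acube_mass_interleave_bounds V.
pose M' c := (block_cutoff c + E)%N.
have /andP[ext_ge _] := @acube_mass_ext _ _ _ S block_cutoff M' E
  (fun c => ltac:(by rewrite leq_addr leqnn)) (interleave V).
rewrite exprD -mulrA; apply: (@le_trans _ _ (acube_mass S M' (interleave V))).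
  by apply: le_trans ext_ge; rewrite ler_wpM2l // exprn_ge0 // ltW ?weight_min_gt0.
apply: acube_mass_le_ball => // y xy; apply: eucl_dist_le (dim_gt0 S) _ => c.
apply: (le_trans (acube_diameter c xy)); apply: le_trans fits.
rewrite sideD mulrC ler_pM ?(ltW (side_gt0 _ _ _ _)) ?side_le //.
by have /andP[] := side_interleave_bounds c UV.
Qed.

Lemma Tdelta_ge_interleave q E : ratio_max S ^+ E * delta0 ^+ r <= delta / d%:R ->
  (weight_min S ^+ (d * E + K * H)) `^ `|q| * (\sum_(i | U i) acube_mass S M (u i) `^ q) ^+ r
  <= Tdelta nu q delta.
Proof.
move=> fits; have /andP[d0 _] := delta_in01.
apply: (@le_trans _ _ (\sum_(V in ffun_on U) ball_mass (coding a t (interleave V)) delta `^ q)).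
  have -> : (\sum_(i | U i) acube_mass S M (u i) `^ q) ^+ r =
      \sum_(V in ffun_on U) \prod_(k < r) (acube_mass S M (u (V k)) `^ q).
    by rewrite -[X in _ ^+ X](card_ord r) -prodr_const bigA_distr_big /=; exact: eq_bigl.
  rewrite mulr_sumr; apply: ler_sum => V UV.
  rewrite prod_powR => [|k]; last exact/ltW/acube_mass_gt0.
  have masses0 : 0 < \prod_k acube_mass S M (u (V k)).
    by apply: prodr_gt0 => k _; exact: acube_mass_gt0.
  have w0 := weight_min_gt0 S.
  have [q0|/ltW q0] := leP 0 q.
    rewrite ger0_norm // -powRM ?exprn_ge0 ?(ltW w0) ?(ltW masses0) //.
    apply: ge0_ler_powR; rewrite ?nnegrE ?ball_mass_ge0 ?ball_mass_interleave_ge //.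
    by rewrite mulr_ge0 ?exprn_ge0 // ltW.
  apply: (@le_trans _ _ ((\prod_k acube_mass S M (u (V k))) `^ q)).
    rewrite ler_piMl ?powR_ge0 // -[leRHS](powRr0 (weight_min S ^+ (d * E + K * H))).
    by apply: ger_powR => //; rewrite exprn_gt0 // exprn_ile1 ?weight_min_le1 // ltW.
  apply: le0_ler_powR => //; last exact: ball_mass_interleave_le.
  by apply: msupp_ball_mass_gt0 => //; exact: coding_msupp.
apply: ball_moment_le_Tdelta => // [V _|V V']; first exact: coding_msupp.
exact: balls_interleave_disjoint.
Qed.
End Balls.
End Interleaving.

(** * Existence of the [L^q] spectrum *)

Section LogMoments.
Variables (R : realType) (d N : nat) (S : sponge R d N).
Variables (dm : measure_display) (T : measurableType dm) (P : probability T R).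
Variables (X : T -> Sigma N).
Hypothesis XP : iid_law (weight S) P X.
Local Notation nu := (sponge_measure S P X).
Local Notation code := (code_of_word S).
Implicit Types (x y : Sigma N) (c : 'I_d) (q s : R).

Definition log_moment q s : R := ln (Tdelta nu q (expR (- s))).
Definition log_fine : R := ln (2 * d%:R).

(* Growth, per interleaved word, of the information lost by rounding the size of the final cube. *)
Definition interleaving_loss : R := info_max S * lyap_max S / lyap_min S * d%:R.

Lemma log_fine_ge0 : 0 <= log_fine.
Proof. by apply: ln_ge0; have := dim_ge1 S; lra. Qed.

Lemma fine_scale_expR s : fine_scale d (expR (- s)) = expR (- (s + log_fine)).
Proof.
rewrite /fine_scale opprD expRD [expR (- log_fine)]expRN /log_fine lnK // posrE.
by rewrite mulr_gt0 ?(dimR_gt0 S).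
Qed.

Lemma interleaving_loss_ge0 : 0 <= interleaving_loss.
Proof.
have kmin0 := ltW (lyap_min_gt0 S); have kmax0 := ltW (lyap_max_gt0 S).
by rewrite !mulr_ge0 ?invr_ge0 ?info_max_ge0.
Qed.

Section CubeFamily.
Variables (delta0 : R) (M : 'I_d -> nat) (I : finType) (U : pred I) (u : I -> Sigma N).
Hypothesis delta0_in01 : 0 < delta0 < 1.
Hypothesis u_cubes : disjoint_cubes S delta0 M U u.
Hypothesis U_neq0 : exists i, U i.
Variable q : R.
Let Z : R := \sum_(i | U i) acube_mass S M (u i) `^ q.

Lemma cube_family_moment_gt0 : 0 < Z.
Proof.
have [i Ui] := U_neq0; rewrite /Z (bigD1 i) //= ltr_pwDl ?powR_gt0 ?acube_mass_gt0 //.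
by apply: sumr_ge0 => j _; exact: powR_ge0.
Qed.

Section InteriorPrefix.
Variables (K : nat) (W : Sigma N) (rho : R).
Hypothesis rho_gt0 : 0 < rho.
Hypothesis W_interior : forall y, (forall l, (l < K)%N -> y l = W l) ->
  forall c, rho <= coding (linear_part S) (translation S) y c <= 1 - rho.
Local Notation H := (\max_c M c)%N.

Lemma log_moment_ge_interleave (r E : nat) s : (0 < r)%N -> 0 < s ->
  r%:R * (- ln delta0 + lyap_max S) <= s - ((K * H)%:R * lyap_max S - ln rho + 1) ->
  s + ln d%:R <= E%:R * lyap_min S + r%:R * - ln delta0 ->
  r%:R * ln Z - `|q| * (info_max S * (d%:R * E%:R + (K * H)%:R)) <= log_moment q s.
Proof.
move=> r0 s0 inside fits; have s01 := expRN_in01 s0; have /andP[d0 _] := delta0_in01.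
have rmin0 := ratio_min_gt0 S; have rmax0 := ratio_max_gt0 S; have w0 := weight_min_gt0 S.
have small : expR (- s) < rho * (ratio_min S ^+ (K * H) * (ratio_min S * delta0) ^+ r).
  rewrite -ltr_ln ?posrE ?expR_gt0 ?mulr_gt0 ?exprn_gt0 ?mulr_gt0 // expRK.
  rewrite 2?lnM ?posrE ?mulr_gt0 ?exprn_gt0 ?mulr_gt0 // !lnXn ?mulr_gt0 // lnM ?posrE //.
  rewrite -[_ *+ (K * H)]mulr_natl -[_ *+ r]mulr_natl.
  by move: inside; rewrite /lyap_max; lra.
have diam : ratio_max S ^+ E * delta0 ^+ r <= expR (- s) / d%:R.
  have dR0 := dimR_gt0 S.
  rewrite -ler_ln ?posrE ?divr_gt0 ?mulr_gt0 ?exprn_gt0 ?expR_gt0 //.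
  rewrite lnM ?posrE ?exprn_gt0 // ln_div ?posrE ?expR_gt0 // expRK !lnXn //.
  rewrite -[_ *+ E]mulr_natl -[_ *+ r]mulr_natl.
  by move: fits; rewrite /lyap_min; lra.
have := Tdelta_ge_interleave delta0_in01 u_cubes r0 rho_gt0 W_interior small XP s01 q diam.
rewrite -/Z; have Z0 := cube_family_moment_gt0.
have T0 := Tdelta_gt0 XP q s01.
rewrite -ler_ln ?posrE ?mulr_gt0 ?powR_gt0 ?exprn_gt0 //; apply: le_trans.
rewrite lnM ?posrE ?powR_gt0 ?exprn_gt0 // ln_powR !lnXn // -[_ *+ r]mulr_natl.
rewrite -[_ *+ (d * E + K * H)]mulr_natl natrD natrM /info_max.
by rewrite le_eqVlt; apply/orP; left; apply/eqP; ring.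
Qed.

Lemma log_moment_growth_interior : exists C, \forall s \near +oo,
  s * ((ln Z - `|q| * interleaving_loss) / (- ln delta0 + lyap_max S)) - C <= log_moment q s.
Proof.
have kmin0 := lyap_min_gt0 S; have kmax0 := lyap_max_gt0 S.
pose D := - ln delta0 + lyap_max S; pose L := (K * H)%:R * lyap_max S - ln rho + 1.
pose G := ln Z - `|q| * interleaving_loss.
have ld0 : 0 < - ln delta0 by rewrite oppr_gt0 ln_lt0.
have D0 : 0 < D by rewrite addr_gt0.
have rho1 : rho < 1.
  by have /andP[] := W_interior (fun l _ => erefl) (first_coord S); have := rho_gt0; lra.
have lrho : 0 < - ln rho by rewrite oppr_gt0 ln_lt0 // rho_gt0.
have L0 : 0 <= L by rewrite /L !addr_ge0 ?mulr_ge0 ?(ltW kmax0) ?(ltW lrho).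
have lnd0 : 0 <= ln d%:R :> R by apply: ln_ge0; exact: (dim_ge1 S).
pose rounding := `|q| * (info_max S * (d%:R * ((D + L + ln d%:R) / lyap_min S + 1) + (K * H)%:R)).
exists (rounding + `|G| * (1 + L / D)); near=> s.
have s_DL : D + L <= s by near: s; apply: nbhs_pinfty_ge; exact: num_real.
have s0 : 0 < s by apply: lt_le_trans s_DL; rewrite ltr_pwDl.
have [r [r0 rD sr rsD]] := nat_quotient_approx D0 L0 s_DL.
have [|E /andP[vE Ev]] := @nat_ceil_approx R ((r%:R * lyap_max S + (D + L + ln d%:R)) / lyap_min S).
  by rewrite divr_ge0 ?(ltW kmin0) // !addr_ge0 ?mulr_ge0 // ltW.
have fits : s + ln d%:R <= E%:R * lyap_min S + r%:R * - ln delta0.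
  by move: vE sr; rewrite ler_pdivrMr // /D mulrDl mul1r mulrDr; lra.
apply: le_trans (log_moment_ge_interleave r0 s0 rD fits).
have lossE : `|q| * (info_max S * (d%:R * E%:R + (K * H)%:R)) <=
    rounding + r%:R * (`|q| * interleaving_loss).
  have i0 := info_max_ge0 S.
  apply: (@le_trans _ _ (`|q| * (info_max S * (d%:R * ((r%:R * lyap_max S + (D + L + ln d%:R)) /
      lyap_min S + 1) + (K * H)%:R)))); first by rewrite !ler_wpM2l // lerD2r ler_wpM2l.
  rewrite le_eqVlt; apply/orP; left; apply/eqP.
  by rewrite /rounding /interleaving_loss; field; rewrite gt_eqF.
have Gr : - (`|G| * (1 + L / D)) <= G * (r%:R - s / D).
  have : `|G * (r%:R - s / D)| <= `|G| * (1 + L / D) by rewrite normrM ler_wpM2l.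
  by rewrite ler_norml => /andP[].
rewrite -/G -/D mulrCA; rewrite mulrBr in Gr.
have -> : r%:R * ln Z = G * r%:R + r%:R * (`|q| * interleaving_loss) by rewrite /G; ring.
by move: lossE Gr; lra.
Unshelve. all: by end_near. Qed.
End InteriorPrefix.

Lemma log_moment_growth : exists C, \forall s \near +oo,
  s * ((ln Z - `|q| * interleaving_loss) / (- ln delta0 + lyap_max S)) - C <= log_moment q s.
Proof.
by have [K [W [rho [rho0 WP]]]] := interior_word S; exact: log_moment_growth_interior rho0 WP.
Qed.
End CubeFamily.

Lemma cube_moment_pigeonhole delta q : 0 < delta < 1 ->
  exists (M : 'I_d -> nat) (U : pred {ffun 'I_(cutoff_bound S delta) -> 'I_N}),
  [/\ disjoint_cubes S delta M U (fun v => code v), exists v, U v &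
    cube_moment S delta q <=
    (cutoff_bound S delta).+1%:R ^+ d * \sum_(v | U v) acube_mass S M (code v) `^ q].
Proof.
move=> delta01; set H := cutoff_bound S delta.
pose cutoffs (v : {ffun 'I_H -> 'I_N}) : {ffun 'I_d -> 'I_H.+1} :=
  [ffun c => inord (cutoff S delta (code v) c)].
have cutoffsE v c : cutoffs v c = cutoff S delta (code v) c :> nat.
  by rewrite ffunE inordK // ltnS cutoff_le_bound.
pose U M v := is_canonical (S := S) (delta := delta) v && (cutoffs v == M).
pose Z M := \sum_(v | U M v) cube_mass S delta (code v) `^ q.
have cutoffU M v : U M v -> cutoff S delta (code v) = (fun c => M c : nat).
  by move=> /andP[_ /eqP <-]; apply/funext => c; rewrite cutoffsE.
pose v0 := canonical_word S delta (fun=> first_map S).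
case: (@arg_maxP _ _ _ (cutoffs v0) xpredT Z isT) => M _ Mmax.
exists (fun c => M c : nat), (U M); split.
- split=> [v|v v' Uv Uv' vv]; first exact: cutoffU.
  rewrite -(cutoffU M v Uv); case/andP: Uv => cv _; case/andP: Uv' => cv' _.
  exact: canonical_words_disjoint.
- apply: contrapT => /forallNP U0.
  have Uv0 : U (cutoffs v0) v0 by rewrite /U canonical_word_is_canonical /=.
  have : 0 < Z (cutoffs v0).
    rewrite /Z (bigD1 v0) //= ltr_pwDl ?powR_gt0 ?cube_mass_gt0 ?sumr_ge0 // => v _.
    exact: powR_ge0.
  have : Z (cutoffs v0) <= Z M := Mmax (cutoffs v0) isT.
  by rewrite {2}/Z big1 => [|v /U0//]; rewrite leNgt => /negP.
- rewrite (eq_bigr (fun v => cube_mass S delta (code v) `^ q)) => [|v /cutoffU {1}<-//].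
  rewrite /cube_moment (partition_big cutoffs xpredT) //=.
  apply: (le_trans (ler_sum_card (fun M' _ => Mmax M' isT))).
  by rewrite card_ffun !card_ord natrX.
Qed.

Lemma cube_moment_le delta q B : (forall x, q * ln (cube_mass S delta x) <= B) ->
  cube_moment S delta q <= N%:R ^+ cutoff_bound S delta * expR B.
Proof.
move=> mass_le; apply: (@le_trans _ _ (\sum_(v : {ffun 'I_(cutoff_bound S delta) -> 'I_N}) expR B)).
  rewrite /cube_moment big_mkcond; apply: ler_sum => v _.
  by case: ifP => _; rewrite ?expR_ge0 // powR_expR ?cube_mass_gt0 // ler_expR.
by apply: (le_trans (ler_sum_card (fun _ _ => lexx _))); rewrite card_ffun !card_ord natrX.
Qed.

Lemma maps_ge1 : 1 <= N%:R :> R.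
Proof. by rewrite ler1n (maps_gt0 S). Qed.

Lemma ln_maps_ge0 : 0 <= ln N%:R :> R.
Proof. exact: ln_ge0 maps_ge1. Qed.

Lemma ln_moment_const_ge0 q : 0 <= ln (moment_const S q).
Proof. by apply: ln_ge0; exact: moment_const_ge1. Qed.

Lemma log_moment_le_cube_moment q s : 0 < s -> 0 < cube_moment S (expR (- (s + log_fine))) q /\
  log_moment q s <= ln (moment_const S q) + ln (cube_moment S (expR (- (s + log_fine))) q).
Proof.
move=> s0; have s01 := expRN_in01 s0; have T0 := Tdelta_gt0 XP q s01.
have C0 : 0 < moment_const S q by exact: lt_le_trans (moment_const_ge1 S q).
have := Tdelta_le_cube_moment XP s01 q; rewrite fine_scale_expR => Tdelta_le.
have Z0 : 0 < cube_moment S (expR (- (s + log_fine))) q.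
  by rewrite -(pmulr_rgt0 _ C0) (lt_le_trans T0).
by split=> //; rewrite -lnM ?posrE // ler_ln ?posrE ?mulr_gt0.
Qed.

Lemma log_moment_le_cubes q s B : 0 < s ->
  (forall x, q * ln (cube_mass S (expR (- (s + log_fine))) x) <= B) ->
  log_moment q s <=
  ln (moment_const S q) + (cutoff_bound S (expR (- (s + log_fine))))%:R * ln N%:R + B.
Proof.
move=> s0 mass_le; have [Z0 moment_le] := log_moment_le_cube_moment q s0.
have N0 : 0 < N%:R :> R by exact: lt_le_trans maps_ge1.
have := cube_moment_le mass_le.
rewrite -ler_ln ?posrE ?mulr_gt0 ?exprn_gt0 ?expR_gt0 // lnM ?posrE ?exprn_gt0 ?expR_gt0 //.
by rewrite expRK lnXn // -[_ *+ _]mulr_natl; lra.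
Qed.

Lemma cutoff_bound_le s : 0 < s -> (cutoff_bound S (expR (- s)))%:R <= s / lyap_min S + 1.
Proof.
move=> s0; rewrite /cutoff_bound expRK -natr1 lerD2r.
have -> : - s / ln (ratio_max S) = s / lyap_min S by rewrite /lyap_min invrN mulrN mulNr.
by rewrite truncn_le divr_ge0 // ltW // lyap_min_gt0.
Qed.

Definition cutoff_slope : R := (1 + log_fine) / lyap_min S + 2.

Lemma cutoff_slope_ge1 : 1 <= cutoff_slope.
Proof.
have : 0 <= (1 + log_fine) / lyap_min S.
  by rewrite divr_ge0 ?addr_ge0 ?log_fine_ge0 // ltW // lyap_min_gt0.
by rewrite /cutoff_slope; lra.
Qed.

Lemma fine_cutoff_le s : 1 <= s -> (s + log_fine) / lyap_min S + 2 <= cutoff_slope * s.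
Proof.
move=> s1; have k0 := lyap_min_gt0 S; have l0 := log_fine_ge0.
have : (s + log_fine) / lyap_min S <= (1 + log_fine) / lyap_min S * s.
  by rewrite mulrAC ler_pM2r ?invr_gt0 // mulrDl mul1r lerD2l ler_peMr.
by rewrite /cutoff_slope mulrDl; lra.
Qed.

Lemma fine_cutoff_bound_le s : 1 <= s ->
  (cutoff_bound S (expR (- (s + log_fine)))).+1%:R <= cutoff_slope * s.
Proof.
move=> s1; have s0 : 0 < s + log_fine by rewrite ltr_pwDl ?log_fine_ge0 // (lt_le_trans ltr01).
apply: le_trans (fine_cutoff_le s1); rewrite -natr1.
by have := cutoff_bound_le s0; lra.
Qed.

Lemma cube_info_le s x : 0 < s ->
  - ln (cube_mass S (expR (- s)) x) <= info_max S * (s / lyap_min S + 1).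
Proof.
move=> s0; have w0 := weight_min_gt0 S.
have := acube_mass_ge S x (cutoff_le_bound S (expRN_in01 s0) x).
rewrite -ler_ln ?posrE ?exprn_gt0 ?acube_mass_gt0 // lnXn // -[_ *+ _]mulr_natl => mass_ge.
apply: (@le_trans _ _ (info_max S * (cutoff_bound S (expR (- s)))%:R)).
  by rewrite mulrC mulrN lerN2.
by rewrite ler_wpM2l ?info_max_ge0 // cutoff_bound_le.
Qed.

Definition moment_error q s : R :=
  ln (moment_const S q) + d%:R * ln cutoff_slope + `|q| * interleaving_loss + d%:R * ln s.

Lemma moment_error_ge0 q s : 1 <= s -> 0 <= moment_error q s.
Proof.
move=> s1; have slope0 := ln_ge0 cutoff_slope_ge1; have s0 := ln_ge0 s1.
have loss0 : 0 <= `|q| * interleaving_loss by rewrite mulr_ge0 // interleaving_loss_ge0.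
by rewrite !addr_ge0 ?ln_moment_const_ge0 // mulr_ge0.
Qed.

Lemma moment_error_sublinear q : moment_error q s / s @[s --> +oo] --> 0.
Proof.
rewrite -[X in _ --> X]addr0; under eq_fun do rewrite mulrDl -[_ * ln _ / _]mulrA.
apply: cvgD; first exact: cvg_div_pinfty.
by rewrite -[X in _ --> X](mulr0 d%:R); apply: cvgM; [exact: cvg_cst | exact: cvg_ln_div_pinfty].
Qed.

Lemma log_moment_superadditive q s1 : 1 <= s1 -> exists C, \forall s \near +oo,
  s * ((log_moment q s1 - moment_error q s1) / (s1 + (log_fine + lyap_max S))) - C
  <= log_moment q s.
Proof.
move=> s1_ge1; have s1_gt0 : 0 < s1 by exact: lt_le_trans s1_ge1.
have fine0 : 0 < s1 + log_fine by rewrite ltr_pwDl ?log_fine_ge0.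
have [M [U [cubes U0 Zle]]] := cube_moment_pigeonhole q (expRN_in01 fine0).
have [C growth] := log_moment_growth (expRN_in01 fine0) cubes U0 q.
have F0 := cube_family_moment_gt0 M (fun v => code v) U0 q.
have [Z0 moment_le] := log_moment_le_cube_moment q s1_gt0.
have step : log_moment q s1 - moment_error q s1 <=
    ln (\sum_(v | U v) acube_mass S M (code v) `^ q) - `|q| * interleaving_loss.
  have slope0 : 0 < cutoff_slope by exact: lt_le_trans cutoff_slope_ge1.
  set H := cutoff_bound S _ in Zle.
  have lnH : d%:R * ln H.+1%:R <= d%:R * (ln cutoff_slope + ln s1).
    by rewrite ler_wpM2l // -lnM ?posrE // ler_ln ?posrE ?mulr_gt0 // fine_cutoff_bound_le.
  move: Zle; rewrite -ler_ln ?posrE ?mulr_gt0 ?exprn_gt0 // lnM ?posrE ?exprn_gt0 //.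
  by rewrite lnXn // -[_ *+ d]mulr_natl /moment_error; move: moment_le lnH; rewrite mulrDr; lra.
exists C; apply: filterS2 growth (nbhs_pinfty_ge (num_real 0)) => s growth s0.
apply: le_trans growth; rewrite expRK opprK addrA lerD2r ler_wpM2l //.
by rewrite ler_pM2r // invr_gt0 addr_gt0 ?lyap_max_gt0.
Qed.

Lemma log_moment_linear q : exists2 C, 0 <= C & forall s, 1 <= s -> log_moment q s <= C * s.
Proof.
have c1 := cutoff_slope_ge1; have lN := ln_maps_ge0; have i0 := info_max_ge0 S.
have lC := ln_moment_const_ge0 q; have l0 := log_fine_ge0.
exists (ln (moment_const S q) + cutoff_slope * ln N%:R + `|q| * (info_max S * cutoff_slope)).
  by rewrite !addr_ge0 ?mulr_ge0 // (le_trans ler01).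
move=> s s1; have s0 : 0 < s by exact: lt_le_trans s1.
have fine0 : 0 < s + log_fine by rewrite ltr_pwDl.
apply: (@le_trans _ _ (ln (moment_const S q) +
    (cutoff_bound S (expR (- (s + log_fine))))%:R * ln N%:R +
    `|q| * (info_max S * (cutoff_slope * s)))).
  apply: log_moment_le_cubes => // x.
  have m0 : ln (cube_mass S (expR (- (s + log_fine))) x) <= 0 by apply/ln_le0/cube_mass_le1.
  apply: (@le_trans _ _ (`|q| * - ln (cube_mass S (expR (- (s + log_fine))) x))).
    by rewrite mulrN -mulNr ler_wnM2r // lerNl -normrN ler_norm.
  rewrite ler_wpM2l // (le_trans (cube_info_le x fine0)) // ler_wpM2l //.
  by have := fine_cutoff_le s1; lra.
rewrite [leRHS](_ : _ = ln (moment_const S q) * s + cutoff_slope * s * ln N%:R +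
  `|q| * (info_max S * (cutoff_slope * s))); last by ring.
rewrite lerD2r; apply: lerD; first by rewrite ler_peMr.
by rewrite ler_wpM2r // (le_trans _ (fine_cutoff_bound_le s1)) // ler_nat.
Qed.

Lemma growth_rate_log_moment q : exists tau, growth_rate (log_moment q) tau.
Proof.
have [C C0 lin] := log_moment_linear q.
apply: (growth_rate_ex (err := moment_error q) C0 (C' := log_fine + lyap_max S) _ _ _ _ lin).
- by rewrite addr_ge0 ?log_fine_ge0 // ltW // lyap_max_gt0.
- exact: moment_error_ge0.
- exact: moment_error_sublinear.
- exact: log_moment_superadditive.
Qed.

Lemma spectrum_ge_cube q tau delta0 x : growth_rate (log_moment q) tau -> 0 < delta0 < 1 ->
  (q * ln (cube_mass S delta0 x) - `|q| * interleaving_loss) / (- ln delta0 + lyap_max S) <= tau.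
Proof.
move=> rate delta01.
have cubes : disjoint_cubes S delta0 (cutoff S delta0 x) predT (fun _ : unit => x).
  by split=> // [[] []].
have [C] := log_moment_growth delta01 cubes (ex_intro _ tt isT) q.
by rewrite big_const card_unit /= addr0 ln_powR; exact: growth_rate_ge.
Qed.

Definition counting_rate : R := ln N%:R / lyap_min S.

Lemma spectrum_le_cubes q tau b : growth_rate (log_moment q) tau ->
  (\forall s \near +oo, forall x, q * ln (cube_mass S (expR (- s)) x) <= s * b) ->
  tau <= counting_rate + b.
Proof.
move=> rate [s1 [_ mass_le]]; have k0 := lyap_min_gt0 S; have l0 := log_fine_ge0.
apply: (growth_rate_le rate
  (c := ln (moment_const S q) + (log_fine / lyap_min S + 1) * ln N%:R + log_fine * b)); near=> s.
have s0 : 0 < s by near: s; exact: nbhs_pinfty_gt.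
have s_s1 : s1 < s by near: s; apply: nbhs_pinfty_gt; exact: num_real.
have fine0 : 0 < s + log_fine by rewrite ltr_pwDl.
have cubes x : q * ln (cube_mass S (expR (- (s + log_fine))) x) <= (s + log_fine) * b.
  by apply: mass_le; rewrite ltr_wpDr.
apply: (le_trans (log_moment_le_cubes s0 cubes)).
have : (cutoff_bound S (expR (- (s + log_fine))))%:R * ln N%:R <=
    ((s + log_fine) / lyap_min S + 1) * ln N%:R.
  by rewrite ler_wpM2r ?ln_maps_ge0 // cutoff_bound_le.
have -> : ((s + log_fine) / lyap_min S + 1) * ln N%:R =
    s * counting_rate + (log_fine / lyap_min S + 1) * ln N%:R.
  by rewrite /counting_rate; field; rewrite gt_eqF.
by rewrite mulrDr [(s + log_fine) * b]mulrDl; lra.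
Unshelve. all: by end_near. Qed.
End LogMoments.

(** * The variational problem as a linear program *)

Section SortedLetters.
Variables (d N : nat) (count_of : 'I_d * 'I_N -> nat) (p0 : 'I_d * 'I_N).
Implicit Types (p q : 'I_d * 'I_N) (B : seq ('I_d * 'I_N)).

Definition level_ge p q : bool := (q.1 <= p.1)%N.
Definition level_above (k : nat) p : bool := (k <= p.1)%N.

Definition sorted_letters : seq ('I_d * 'I_N) :=
  sort level_ge (flatten [seq nseq (count_of p) p | p <- enum {: 'I_d * 'I_N}]).

Definition level_count (k : nat) : nat := count (level_above k) sorted_letters.

Lemma sorted_lettersP : sorted level_ge sorted_letters.
Proof. by apply: sort_sorted => p q; exact: leq_total. Qed.

Lemma sum_sorted_letters (R : realType) (Q : pred ('I_d * 'I_N)) (F : 'I_d * 'I_N -> R) :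
  \sum_(p <- sorted_letters | Q p) F p = \sum_(p | Q p) (count_of p)%:R * F p.
Proof.
rewrite (perm_big _ (permEl (perm_sort _ _))) /= big_flatten big_map /= [RHS]big_mkcond /=.
rewrite -[RHS]big_enum /=; apply: eq_bigr => p _.
by rewrite big_nseq_cond; case: ifP => // _; rewrite iter_addr_0 mulr_natl.
Qed.

Lemma lt_count_level_above B k l : sorted level_ge B -> (l < size B)%N ->
  (l < count (level_above k) B)%N = level_above k (nth p0 B l).
Proof.
have ge_trans : transitive level_ge by move=> q p r pq qr; exact: leq_trans qr pq.
elim: B l => [//|p B IH] l sB lB.
have [kp|pk] := leqP k p.1.
  case: l lB => [|l] lB /=; rewrite /level_above kp //= add1n ltnS.
  by apply: IH lB; exact: path_sorted sB.
have below : all (fun r : 'I_d * 'I_N => r.1 < k)%N (p :: B).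
  rewrite /= pk /=; apply: sub_all (order_path_min ge_trans sB) => r rp.
  exact: leq_ltn_trans rp pk.
have -> : count (level_above k) (p :: B) = 0%N.
  apply/eqP; rewrite -leqn0 leqNgt -has_count -all_predC.
  by apply: sub_all below => r /=; rewrite /level_above -ltnNge.
by rewrite ltn0 /level_above leqNgt (allP below) ?mem_nth.
Qed.

Lemma sum_level_count (R : realType) (k : nat) (F : 'I_d * 'I_N -> R) :
  \sum_(l < level_count k) F (nth p0 sorted_letters l) =
  \sum_(p | level_above k p) (count_of p)%:R * F p.
Proof.
rewrite -sum_sorted_letters (big_nth p0) -(big_mkord xpredT (fun l => F (nth p0 sorted_letters l))).
rewrite (big_nat_widen _ _ (size sorted_letters)) ?count_size //.
rewrite [LHS]big_nat_cond [RHS]big_nat_cond /=.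
apply: eq_bigl => l; case lB: (l < size sorted_letters)%N => //=.
exact: lt_count_level_above sorted_lettersP lB.
Qed.
End SortedLetters.

Section Weights.
Variables (R : realType) (d N : nat) (S : sponge R d N).
Local Notation a := (linear_part S).
Local Notation t := (translation S).
Implicit Types (x : Sigma N) (c k m : 'I_d) (i : 'I_N) (w : 'I_d -> 'I_N -> R).
Implicit Types (s : {perm 'I_d}) (M : 'I_d -> nat) (n H E : nat).

(* [w k i] stands for [C_{k+1} p_{sigma_{k+1}}(i)]: this turns [Q^sigma] into a polytope with one
   linear constraint per coordinate, and [S_sigma] into a linear functional. *)
Definition weighted_entropy s w : R :=
  \sum_k \sum_i w k i * - ln (class_weight S (initial_coords s k.+1) i).
Definition weighted_exponent s w k : R :=
  \sum_(m : 'I_d | (k <= m)%N) \sum_i w m i * - ln (lam a i (s k)).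
Definition feasible s w : Prop :=
  (forall k i, 0 <= w k i) /\ (forall k, weighted_exponent s w k = 1).
Definition class_supported s w : Prop := forall k i, ~~ Iset a t s k.+1 i -> w k i = 0.

Lemma log_side x n c : - ln (side S x n c) = \sum_(l < n) - ln (lam a (x l) c).
Proof. by rewrite /side ln_prod ?sumrN // => l; exact: ratio_gt0. Qed.

Lemma log_acube_mass M x H : (forall c, M c <= H)%N ->
  - ln (acube_mass S M x) = \sum_(l < H) - ln (class_weight S (active M l) (x l)).
Proof.
by move=> /acube_massE ->; rewrite ln_prod ?sumrN // => l; exact: class_weight_gt0.
Qed.

Lemma weighted_entropy_ge0 s w : feasible s w -> 0 <= weighted_entropy s w.
Proof.
move=> [w0 _]; apply: sumr_ge0 => k _; apply: sumr_ge0 => i _; apply: mulr_ge0 => //.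
by have /andP[] := info_bounds S (initial_coords s k.+1) i.
Qed.

Section SortedCode.
Variables (s : {perm 'I_d}) (count_of : 'I_d * 'I_N -> nat).
Let p0 : 'I_d * 'I_N := (first_coord S, first_map S).
Local Notation letters := (sorted_letters count_of).

Definition sorted_code : Sigma N := fun l => (nth p0 letters l).2.
Definition sorted_cutoff c : nat := level_count count_of ((s^-1)%g c).

Lemma sorted_cutoff_perm k : sorted_cutoff (s k) = level_count count_of k.
Proof. by rewrite /sorted_cutoff permK. Qed.

Lemma log_side_sorted_code k : - ln (side S sorted_code (sorted_cutoff (s k)) (s k)) =
  \sum_(p | level_above k p) (count_of p)%:R * - ln (lam a p.2 (s k)).
Proof.
by rewrite log_side sorted_cutoff_perm (sum_level_count _ p0 _ (fun p => - ln (lam a p.2 (s k)))).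
Qed.

Lemma active_sorted_cutoff l : (l < size letters)%N ->
  active sorted_cutoff l = initial_coords s (nth p0 letters l).1.+1.
Proof.
move=> lB; apply/setP => c; rewrite -(permKV s c) mem_initial_coords inE sorted_cutoff_perm ltnS.
exact: lt_count_level_above (sorted_lettersP _) lB.
Qed.

Lemma log_mass_sorted_code : - ln (acube_mass S sorted_cutoff sorted_code) =
  \sum_p (count_of p)%:R * - ln (class_weight S (initial_coords s p.1.+1) p.2).
Proof.
rewrite (@log_acube_mass _ _ (size letters)) => [|c]; last exact: count_size.
rewrite -(sum_sorted_letters _ xpredT
  (fun p => - ln (class_weight S (initial_coords s p.1.+1) p.2))).
by rewrite (big_nth p0) big_mkord; apply: eq_bigr => l _; rewrite active_sorted_cutoff.
Qed.
End SortedCode.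

Lemma cutoff_near (s0 B : R) x n c : 0 < s0 -> 0 <= B -> s0 - B <= - ln (side S x n c) <= s0 ->
  (n <= cutoff S (expR (- s0)) x c <= n + Num.truncn ((B + lyap_max S) / lyap_min S))%N.
Proof.
move=> s00 B0 /andP[side_lb side_ub]; have e01 := expRN_in01 s00; set L := cutoff _ _ _ _.
have kmin0 := lyap_min_gt0 S; have kmax0 := lyap_max_gt0 S.
have nL : (n <= L)%N.
  case: n side_lb side_ub => [//|n] side_lb side_ub; rewrite lt_cutoff //.
  rewrite -ltr_ln ?posrE ?expR_gt0 ?side_gt0 // expRK.
  rewrite ltrNl (lt_le_trans _ side_ub) // ltrN2.
  by rewrite ltr_ln ?posrE ?side_gt0 // side_lt.
rewrite nL /=; set E := (L - n)%N; have LE : L = (n + E)%N by rewrite subnKC.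
rewrite LE leq_add2l truncn_ge_nat ?divr_ge0 ?addr_ge0 ?(ltW kmin0) ?(ltW kmax0) //.
rewrite ler_pdivlMr //.
have : ratio_min S * expR (- s0) <= side S x n c * ratio_max S ^+ E.
  have /andP[cutoff_side _] := side_cutoff S e01 x c; apply: (le_trans cutoff_side).
  by rewrite -/L LE sideD ler_wpM2l ?(ltW (side_gt0 _ _ _ _)) // side_le.
have r0 := ratio_min_gt0 S; have R0 := ratio_max_gt0 S; have side0 := side_gt0 S x n c.
rewrite -ler_ln ?posrE ?mulr_gt0 ?expR_gt0 ?exprn_gt0 //.
rewrite !lnM ?posrE ?expR_gt0 ?exprn_gt0 // expRK lnXn // -[_ *+ E]mulr_natl.
by move: side_lb; rewrite /lyap_max /lyap_min; lra.
Qed.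

Lemma log_cube_mass_near (delta : R) x M E :
  (forall c, M c <= cutoff S delta x c <= M c + E)%N ->
  - ln (acube_mass S M x) <= - ln (cube_mass S delta x)
  <= - ln (acube_mass S M x) + (d * E)%:R * info_max S.
Proof.
move=> /(acube_mass_ext S)/(_ x)/andP[mass_ge mass_le]; have w0 := weight_min_gt0 S.
have M0 := acube_mass_gt0 S M x; have m0 := cube_mass_gt0 S delta x.
rewrite lerN2 ler_ln ?posrE // mass_le /=.
move: mass_ge; rewrite -ler_ln ?posrE ?mulr_gt0 ?exprn_gt0 // lnM ?posrE ?exprn_gt0 // lnXn //.
by rewrite -[_ *+ (d * E)]mulr_natl /info_max; lra.
Qed.

(* A word with [w k i * s0] letters [i] at level [k], the levels decreasing, has cutoffs at bounded
   distance from [L_delta]. The permutation need not belong to [Aset]. *)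
Lemma feasible_realized s w : feasible s w -> exists C : R, forall s0 : R, 0 < s0 ->
  exists x, `|ln (cube_mass S (expR (- s0)) x) + s0 * weighted_entropy s w| <= C.
Proof.
move=> [w0 wc]; have kmax0 := ltW (lyap_max_gt0 S); have i0 := info_max_ge0 S.
pose B := #|{: 'I_d * 'I_N}|%:R * lyap_max S.
have B0 : 0 <= B by rewrite mulr_ge0.
pose E := Num.truncn ((B + lyap_max S) / lyap_min S).
exists (#|{: 'I_d * 'I_N}|%:R * info_max S + (d * E)%:R * info_max S) => s0 s00.
pose v (p : 'I_d * 'I_N) := w p.1 p.2 * s0.
have v0 p : 0 <= v p by rewrite mulr_ge0 // ltW.
pose count_of p := Num.truncn (v p); exists (sorted_code count_of); set x := sorted_code _.
have sides k : s0 - B <= - ln (side S x (sorted_cutoff s count_of (s k)) (s k)) <= s0.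
  rewrite log_side_sorted_code.
  have sumE : \sum_(p : 'I_d * 'I_N | level_above k p) v p * - ln (lam a p.2 (s k)) = s0.
    rewrite -[RHS]mulr1 -(wc k) /weighted_exponent pair_big /= mulr_sumr.
    by apply: eq_big => [p|p _]; [rewrite andbT | rewrite /v; ring].
  rewrite -{1 2}sumE; apply: sum_trunc_bounds => // p.
  by have /andP[_ ->] := lyap_bounds S p.2 (s k); rewrite ltW ?lyap_gt0.
have cutoffs c : (sorted_cutoff s count_of c <= cutoff S (expR (- s0)) x c <=
    sorted_cutoff s count_of c + E)%N.
  by apply: cutoff_near => //; rewrite -(permKV s c); exact: sides.
have := log_cube_mass_near cutoffs; rewrite log_mass_sorted_code.
have : s0 * weighted_entropy s w - #|{: 'I_d * 'I_N}|%:R * info_max S <=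
    \sum_p (count_of p)%:R * - ln (class_weight S (initial_coords s p.1.+1) p.2) <=
    s0 * weighted_entropy s w.
  have sumE : \sum_(p : 'I_d * 'I_N) v p * - ln (class_weight S (initial_coords s p.1.+1) p.2) =
      s0 * weighted_entropy s w.
    rewrite /weighted_entropy pair_big /= mulr_sumr.
    by apply: eq_bigr => p _; rewrite /v; ring.
  by rewrite -sumE; apply: sum_trunc_bounds => // p; exact: info_bounds.
by rewrite ler_norml; lra.
Qed.
End Weights.

(** * Letter frequencies of approximate cubes *)

Section EmpiricalWeights.
Variables (R : realType) (d N : nat) (S : sponge R d N).
Local Notation a := (linear_part S).
Local Notation t := (translation S).
Implicit Types (c k m : 'I_d) (i : 'I_N).

Lemma initial_coords_inj (s : {perm 'I_d}) k m :
  initial_coords s k.+1 = initial_coords s m.+1 -> k = m.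
Proof.
move=> e; apply/val_inj/eqP; rewrite eqn_leq /= -ltnS -(mem_initial_coords s) -e.
by rewrite mem_initial_coords ltnSn /= -ltnS -(mem_initial_coords s) e mem_initial_coords ltnSn.
Qed.

Lemma initial_coords_neq0 (s : {perm 'I_d}) k : initial_coords s k.+1 != finset.set0.
Proof. by apply/set0Pn; exists (s k); rewrite mem_initial_coords. Qed.

Lemma Iset_class_rep (s : {perm 'I_d}) n i :
  Iset a t s n (class_rep S (initial_coords s n) i).
Proof.
apply/asboolP => j /overlapE; have [ii mini] := class_repP S (initial_coords s n) i => ji.
by apply: mini; rewrite (agree_left _ ii) agree_sym.
Qed.

Variables (s : {perm 'I_d}) (s0 : R) (x : Sigma N).
Hypothesis s0_gt0 : 0 < s0.
Let delta := expR (- s0).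
Let L := cutoff S delta x.
Hypothesis L_antitone : antitone_along s L.
Let H := (\max_c L c)%N.

Definition empirical_weight k i : R :=
  (\sum_(l < H) ((active L l == initial_coords s k.+1) &&
                 (class_rep S (initial_coords s k.+1) (x l) == i))%:R) / s0.

Lemma empirical_weight_ge0 k i : 0 <= empirical_weight k i.
Proof. by rewrite divr_ge0 ?(ltW s0_gt0) // sumr_ge0. Qed.

Lemma empirical_weight_supported : class_supported S s empirical_weight.
Proof.
move=> k i nI; rewrite /empirical_weight big1 ?mul0r // => l _.
case: (boolP (_ && _)) => // /andP[_ /eqP e]; case/negP: nI.
by rewrite -e; exact: Iset_class_rep.
Qed.

Lemma sum_empirical_weight (F : {set 'I_d} -> 'I_N -> R) :
  \sum_k \sum_i empirical_weight k i * F (initial_coords s k.+1) i =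
  (\sum_(l < H) if active L l == finset.set0 then 0
                else F (active L l) (class_rep S (active L l) (x l))) / s0.
Proof.
have per_level k : \sum_i empirical_weight k i * F (initial_coords s k.+1) i =
    (\sum_(l < H) (active L l == initial_coords s k.+1)%:R *
      F (initial_coords s k.+1) (class_rep S (initial_coords s k.+1) (x l))) / s0.
  under eq_bigr do rewrite /empirical_weight mulrAC mulr_suml.
  rewrite -mulr_suml exchange_big /=; congr (_ / _); apply: eq_bigr => l _.
  set r := class_rep _ _ _; rewrite (bigD1 r) //= eqxx andbT big1 ?addr0 // => i /negbTE ir.
  by rewrite [r == i]eq_sym ir andbF mul0r.
under eq_bigr do rewrite per_level.
rewrite -mulr_suml exchange_big /=; congr (_ / _); apply: eq_bigr => l _.
have [[|n] nd ->] := active_antitone l L_antitone.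
  rewrite initial_coords0 eqxx big1 // => k _.
  by rewrite eq_sym (negbTE (initial_coords_neq0 s k)) mul0r.
pose k0 := Ordinal nd; rewrite -[n]/(k0 : nat) (negbTE (initial_coords_neq0 s k0)).
rewrite (bigD1 k0) //= eqxx mul1r big1 ?addr0 // => k kk0.
case: eqP => [/esym/(@initial_coords_inj s k k0) e|_]; last by rewrite mul0r.
by rewrite e eqxx in kk0.
Qed.

Lemma weighted_entropy_empirical :
  weighted_entropy S s empirical_weight = - ln (cube_mass S delta x) / s0.
Proof.
rewrite /weighted_entropy (sum_empirical_weight (fun J i => - ln (class_weight S J i))).
rewrite (@log_acube_mass _ _ _ _ _ _ H) => [|c]; last exact: leq_bigmax.
congr (_ / _); apply: eq_bigr => l _; case: eqP => [->|_].
  by rewrite class_weight0 ln1 oppr0.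
by rewrite -(eq_class_weight (agree_class_rep S (active L l) (x l))).
Qed.

Lemma weighted_exponent_empirical k :
  weighted_exponent S s empirical_weight k = - ln (side S x (L (s k)) (s k)) / s0.
Proof.
pose F (J : {set 'I_d}) i := if s k \in J then - ln (lam a i (s k)) else 0.
transitivity (\sum_m \sum_i empirical_weight m i * F (initial_coords s m.+1) i).
  rewrite /weighted_exponent big_mkcond; apply: eq_bigr => m _.
  rewrite /F mem_initial_coords ltnS; case: ifP => // _.
  by rewrite big1 // => i _; rewrite mulr0.
rewrite sum_empirical_weight log_side; congr (_ / _).
have LH : (L (s k) <= H)%N by exact: leq_bigmax.
rewrite (big_ord_widen H (fun l => - ln (lam a (x l) (s k))) LH) [RHS]big_mkcond /=.
apply: eq_bigr => l _; rewrite /F; have [J0|_] := eqVneq (active L l) finset.set0.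
  have : s k \notin active L l by rewrite J0 inE.
  by rewrite inE => /negbTE ->.
rewrite inE; case: ifP => // lL; rewrite /lam.
have /agreeP/(_ (s k)) := agree_class_rep S (active L l) (x l).
by rewrite inE => /(_ lL)[<-].
Qed.

Lemma weighted_exponent_empirical_bounds k :
  1 <= weighted_exponent S s empirical_weight k <= 1 + lyap_max S / s0.
Proof.
have /andP[side_ge side_le] := side_cutoff S (expRN_in01 s0_gt0) x (s k).
have r0 := ratio_min_gt0 S; have side0 := side_gt0 S x (L (s k)) (s k).
rewrite -ler_ln ?posrE ?expR_gt0 // expRK in side_le.
rewrite -ler_ln ?posrE ?mulr_gt0 ?expR_gt0 // lnM ?posrE ?expR_gt0 // expRK in side_ge.
rewrite weighted_exponent_empirical -[X in X + _](divff (lt0r_neq0 s0_gt0)) -mulrDl.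
by rewrite ler_pdivlMr // mul1r ler_pM2r ?invr_gt0 // /lyap_max; move: side_ge side_le; lra.
Qed.

Lemma empirical_weight_le k i : empirical_weight k i <= (1 + lyap_max S / s0) / lyap_min S.
Proof.
rewrite ler_pdivlMr ?lyap_min_gt0 //.
have /andP[_ exponent_le] := weighted_exponent_empirical_bounds k; apply: le_trans exponent_le.
have terms0 m j : 0 <= empirical_weight m j * - ln (lam a j (s k)).
  by rewrite mulr_ge0 ?empirical_weight_ge0 // ltW // lyap_gt0.
rewrite /weighted_exponent (bigD1 k) //= (bigD1 i) //= -addrA.
apply: (@le_trans _ _ (empirical_weight k i * - ln (lam a i (s k)))).
  by rewrite ler_wpM2l ?empirical_weight_ge0 //; have /andP[] := lyap_bounds S i (s k).
by rewrite lerDl addr_ge0 ?sumr_ge0 // => m _; apply: sumr_ge0.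
Qed.
End EmpiricalWeights.

Section LimitWeights.
Variables (R : realType) (d N : nat) (S : sponge R d N).
Local Notation a := (linear_part S).
Implicit Types (x : Sigma N) (w : 'I_d -> 'I_N -> R).

Lemma empirical_weights_limit (s : {perm 'I_d}) (f : nat -> R) (x : nat -> Sigma N) :
  (forall n, n.+1%:R <= f n) ->
  (forall n, antitone_along s (cutoff S (expR (- f n)) (x n))) ->
  exists w, [/\ feasible S s w, class_supported S s w & forall e b,
    (forall n, e * - ln (cube_mass S (expR (- f n)) (x n)) <= f n * b) ->
    e * weighted_entropy S s w <= b].
Proof.
move=> f_large anti; have kmax0 := lyap_max_gt0 S; have kmin0 := lyap_min_gt0 S.
have f1 n : 1 <= f n by apply: le_trans (f_large n); rewrite ler1n.
have f0 n : 0 < f n by exact: lt_le_trans (f1 n).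
have [U [UU ooU]] := ultraFilterLemma eventually_filter.
pose W n k i := empirical_weight S s (f n) (x n) k i.
have W_bounded n (p : 'I_d * 'I_N) : 0 <= W n p.1 p.2 <= (1 + lyap_max S) / lyap_min S.
  rewrite empirical_weight_ge0 //= (le_trans (empirical_weight_le (f0 n) (anti n) _ _)) //.
  by rewrite ler_pM2r ?invr_gt0 // lerD2l ler_pdivrMr // ler_peMr // ltW.
have [l lP] := ultra_cvg_bounded UU W_bounded; pose w k i := l (k, i).
have Ww k i : W n k i @[n --> U] --> w k i by exact: (lP (k, i)).
have exponent k : weighted_exponent S s w k = 1.
  have lim1 : 1 + lyap_max S * harmonic n @[n --> \oo] --> (1 : R).
    rewrite -[X in _ --> X]addr0 -[X in _ --> _ + X](mulr0 (lyap_max S)).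
    by apply: cvgD; [exact: cvg_cst | apply: cvgM; [exact: cvg_cst | exact: cvg_harmonic]].
  have limW : weighted_exponent S s (W n) k @[n --> \oo] --> (1 : R).
    apply: (@squeeze_cvgr _ _ _ _ (fun=> 1) _ _ _ _ _ lim1); last exact: cvg_cst.
    apply: nearW => n.
    have /andP[-> exponent_le] := weighted_exponent_empirical_bounds (f0 n) (anti n) k.
    by rewrite (le_trans exponent_le) // lerD2l ler_pM2l // lef_pV2 ?posrE.
  have limU : weighted_exponent S s (W n) k @[n --> U] --> weighted_exponent S s w k.
    exact: (cvg_weighted_sum (Q := fun m : 'I_d => (k <= m)%N)
      (G := fun _ i => - ln (lam a i (s k)))).
  by apply: (cvg_unique (@Rhausdorff R) limU) => A nA; apply: ooU; exact: limW.
exists w; split=> [|k i nI|e b mass_bound].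
- split=> // k i; apply: (cvgr_to_ge (Ww k i)).
  by apply: filterE => n; exact: empirical_weight_ge0.
- apply: (cvg_unique (@Rhausdorff R) (Ww k i)).
  rewrite (_ : (fun n => W n k i) = (fun=> 0)); first exact: cvg_cst.
  by apply/funext => n; exact: empirical_weight_supported.
- have lim : e * weighted_entropy S s (W n) @[n --> U] --> e * weighted_entropy S s w.
    by apply: cvgM; [exact: cvg_cst | exact: (cvg_weighted_sum (Q := xpredT) Ww)].
  apply: (cvgr_to_le lim); apply: filterE => n.
  by rewrite (weighted_entropy_empirical (anti n)) mulrA ler_pdivrMr // [b * _]mulrC.
Qed.

Lemma feasible_limit (e b : R) :
  (forall s1 : R, exists s0 x, s1 <= s0 /\ e * - ln (cube_mass S (expR (- s0)) x) <= s0 * b) ->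
  exists s w, [/\ Aset a s, feasible S s w, class_supported S s w &
    e * weighted_entropy S s w <= b].
Proof.
move=> freq.
pose Q (s : {perm 'I_d}) s0 := exists x, [/\ Aset a s, antitone_along s (cutoff S (expR (- s0)) x) &
  e * - ln (cube_mass S (expR (- s0)) x) <= s0 * b].
have [|s sP] := @frequently_pigeonhole R _ Q.
  move=> s1; have [s0 [x [+ mass_bound]]] := freq (Num.max 1 s1).
  rewrite ge_max => /andP[s0_ge1 s1_le].
  have [s As /descending_antitone anti] := Aset_cutoff S (expRN_in01 (lt_le_trans ltr01 s0_ge1)) x.
  by exists s, s0; split=> //; exists x.
have {}sP n : exists p : R * Sigma N, [/\ n.+1%:R <= p.1, Aset a s,
    antitone_along s (cutoff S (expR (- p.1)) p.2) &
    e * - ln (cube_mass S (expR (- p.1)) p.2) <= p.1 * b].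
  by have [s0 ns0 [x [As anti mass_bound]]] := sP n.+1%:R; exists (s0, x).
have [f fP] := choice sP; have [_ As _ _] := fP 0%N.
have [n|n|w [wW wI wS]] := @empirical_weights_limit s (fun n => (f n).1) (fun n => (f n).2).
- by have [] := fP n.
- by have [] := fP n.
- by exists s, w; split=> //; apply: wS => n; have [] := fP n.
Qed.
End LimitWeights.

(** * Duality *)

Section Variational.
Variables (R : realType) (d N : nat) (S : sponge R d N).
Local Notation a := (linear_part S).
Local Notation t := (translation S).
Local Notation mu := (weight S).
Implicit Types (k m : 'I_d) (i j : 'I_N) (w : 'I_d -> 'I_N -> R) (p : nat -> 'I_N -> R).
Implicit Types (y : 'I_d -> R) (e : R).
Variable s : {perm 'I_d}.

Lemma lamSE i k : lamS a s i k.+1 = lam a i (s k).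
Proof. by rewrite /lamS /sigc /= valK. Qed.

Lemma munE n i : Iset a t s n i -> mun a t mu s n i = class_weight S (initial_coords s n) i.
Proof.
move=> /asboolP Ii; apply: eq_bigl => j; rewrite /Prep.
case: arg_minnP => [|k /asboolP/overlapE kj kmin]; first exact/asboolP/overlapE/agree_refl.
apply/eqP/idP => [<- //|ij]; apply/val_inj/eqP.
rewrite eqn_leq kmin /=; last exact/asboolP/overlapE.
by apply/Ii/overlapE; apply: agree_trans kj _; rewrite agree_sym.
Qed.

Lemma sum_supported n p : (forall i, ~~ Iset a t s n i -> p n i = 0) ->
  \sum_(i | Iset a t s n i) p n i = \sum_i p n i.
Proof.
by move=> p0; rewrite big_mkcond; apply: eq_bigr => i _; case: ifP => // /negbT/p0.
Qed.

Definition level_vectors (v : 'I_d -> 'I_N -> R) (n : nat) i : R :=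
  if insub n.-1 is Some k then v k i else 0.

Lemma level_vectorsE v k i : level_vectors v k.+1 i = v k i.
Proof. by rewrite /level_vectors /= valK. Qed.

Lemma Pvalid_level_vectors v : (forall k i, 0 <= v k i) -> class_supported S s v ->
  (forall k, \sum_i v k i = 1) -> Pvalid a t s (level_vectors v).
Proof.
move=> v0 vI v1 n /ord_of_pos[k ->].
have supp i : ~~ Iset a t s k.+1 i -> level_vectors v k.+1 i = 0.
  by rewrite level_vectorsE; exact: vI.
split=> [i|]; first by rewrite level_vectorsE.
split=> //; rewrite sum_supported // -(v1 k); apply: eq_bigr => i _; exact: level_vectorsE.
Qed.

Section ExponentCoefficients.
Variable p : nat -> 'I_N -> R.
Hypothesis p_valid : Pvalid a t s p.

Lemma Pvalid_level k : [/\ forall i, 0 <= p k.+1 i,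
  forall i, ~~ Iset a t s k.+1 i -> p k.+1 i = 0 & \sum_i p k.+1 i = 1].
Proof.
have [pos [supp sum1]] := p_valid (ltn_ord k : (1 <= k.+1 <= d)%N).
by split=> //; rewrite -sum_supported.
Qed.

Lemma chiE k m : chi a t s p k.+1 m.+1 = \sum_i p m.+1 i * - ln (lam a i (s k)).
Proof.
have [_ supp _] := Pvalid_level m; rewrite /chi big_mkcond /= -sumrN; apply: eq_bigr => i _.
by case: ifP => [_|/negbT /supp ->]; [rewrite lamSE mulrN | rewrite mul0r oppr0].
Qed.

Lemma chi_gt0 k : 0 < chi a t s p k.+1 k.+1.
Proof.
have [pos _ sum1] := Pvalid_level k.
apply: (lt_le_trans (lyap_min_gt0 S)); rewrite chiE -[leLHS]mul1r -sum1 mulr_suml.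
apply: ler_sum => i _; rewrite ler_wpM2l //.
by have /andP[] := lyap_bounds S i (s k).
Qed.

Lemma Caux_fuel f f' n : (n <= d)%N -> (d < n + f)%N -> (d < n + f')%N ->
  Caux a t s p f n = Caux a t s p f' n.
Proof.
elim: f f' n => [|f IH] f' n nd; first by rewrite addn0 ltnNge nd.
case: f' => [_|f']; first by rewrite addn0 ltnNge nd.
move=> nf nf' /=; congr ((1 - _) / _); apply: eq_big_nat => m /andP[nm md].
by congr (_ * _); apply: IH; rewrite ?ltnS // in md *; lia.
Qed.

Lemma CnE k : Cn a t s p k.+1 =
  (1 - \sum_(m < d | (k < m)%N) Cn a t s p m.+1 * chi a t s p k.+1 m.+1) / chi a t s p k.+1 k.+1.
Proof.
rewrite {1}/Cn -(sum_nat_ord_geq d (fun m : nat => Cn a t s p m * chi a t s p k.+1 m)) /=.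
congr ((1 - _) / _); apply: eq_big_nat => m /andP[km md]; congr (_ * _).
by apply: Caux_fuel; rewrite ?ltnS // in md *; lia.
Qed.

Lemma Cn_sum k : \sum_(m < d | (k <= m)%N) Cn a t s p m.+1 * chi a t s p k.+1 m.+1 = 1.
Proof. by rewrite sum_ord_geq_recl CnE divfK ?subrK // gt_eqF // chi_gt0. Qed.

Lemma Cn_unique (u : 'I_d -> R) :
  (forall k, \sum_(m < d | (k <= m)%N) u m * chi a t s p k.+1 m.+1 = 1) ->
  forall k, Cn a t s p k.+1 = u k.
Proof.
move=> sum1; apply: ord_downward_ind => k IH.
have := sum1 k; rewrite sum_ord_geq_recl CnE => e.
rewrite (eq_bigr (fun m => u m * chi a t s p k.+1 m.+1)) => [|m km]; last by rewrite IH.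
by rewrite -e addrK mulfK // gt_eqF // chi_gt0.
Qed.

Lemma weighted_exponent_probability (u : 'I_d -> R) k :
  weighted_exponent S s (fun m i => u m * p m.+1 i) k =
  \sum_(m < d | (k <= m)%N) u m * chi a t s p k.+1 m.+1.
Proof.
apply: eq_bigr => m _; rewrite chiE mulr_sumr.
by apply: eq_bigr => i _; rewrite mulrA.
Qed.

Lemma SsigE : Ssig a t mu s p = weighted_entropy S s (fun m i => Cn a t s p m.+1 * p m.+1 i).
Proof.
rewrite /Ssig sum_nat_ord_geq -sumrN; apply: eq_bigr => k _.
have [_ supp _] := Pvalid_level k.
rewrite big_mkcond mulr_sumr -sumrN; apply: eq_bigr => i _; case: ifP => [Ii|/negbT /supp ->].
  by rewrite munE // mulrA mulrN.
by rewrite !mulr0 mul0r oppr0.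
Qed.

Lemma feasible_coefficients : (forall k, 0 <= Cn a t s p k.+1) ->
  feasible S s (fun k i => Cn a t s p k.+1 * p k.+1 i).
Proof.
move=> C0; split=> [k i|k]; last by rewrite weighted_exponent_probability Cn_sum.
by have [pos _ _] := Pvalid_level k; rewrite mulr_ge0.
Qed.
End ExponentCoefficients.

Lemma feasible_of_Qset p : Qset a t s p ->
  exists2 w, feasible S s w & weighted_entropy S s w = Ssig a t mu s p.
Proof.
move=> [pv C0]; exists (fun k i => Cn a t s p k.+1 * p k.+1 i); last by rewrite SsigE.
by apply: feasible_coefficients => // k; apply: C0; exact: ltn_ord.
Qed.

Section Normalization.
Variable w : 'I_d -> 'I_N -> R.
Hypotheses (w_feasible : feasible S s w) (w_supported : class_supported S s w).

Definition level_weight k : R := \sum_i w k i.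

Definition normalized k i : R :=
  if level_weight k == 0 then (i == class_rep S (initial_coords s k.+1) (first_map S))%:R
  else w k i / level_weight k.

Lemma normalizedE k i : w k i = level_weight k * normalized k i.
Proof.
rewrite /normalized; case: eqP => [w0|/eqP w0]; last by rewrite mulrC divfK.
rewrite w0 mul0r; move/eqP: w0; rewrite psumr_eq0 => [|j _]; last exact: w_feasible.1.
by move=> /allP/(_ i); rewrite mem_index_enum => /(_ isT)/eqP.
Qed.

Lemma normalized_valid : Pvalid a t s (level_vectors normalized).
Proof.
apply: Pvalid_level_vectors => [k i|k i nI|k].
- rewrite /normalized; case: ifP => // _; rewrite divr_ge0 ?sumr_ge0 ?(w_feasible.1 k) // => j _.
  exact: w_feasible.1.
- rewrite /normalized w_supported // mul0r; case: ifP => // _; case: eqP => // ir.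
  by rewrite ir Iset_class_rep in nI.
- under eq_bigr do rewrite /normalized.
  case: eqP => [_|/eqP w0]; last by rewrite -mulr_suml divff.
  set r := class_rep _ _ _; rewrite (bigD1 r) //= eqxx big1 ?addr0 // => i /negbTE ->.
  by [].
Qed.

Lemma Cn_normalized k : Cn a t s (level_vectors normalized) k.+1 = level_weight k.
Proof.
apply: (Cn_unique normalized_valid) => m.
rewrite -(weighted_exponent_probability normalized_valid) -(w_feasible.2 m) /weighted_exponent.
apply: eq_bigr => n _; apply: eq_bigr => i _.
by rewrite level_vectorsE -normalizedE.
Qed.

Lemma Qset_of_feasible : exists2 p, Qset a t s p & Ssig a t mu s p = weighted_entropy S s w.
Proof.
exists (level_vectors normalized).
  split=> [|n /ord_of_pos[k ->]]; first exact: normalized_valid.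
  by rewrite Cn_normalized sumr_ge0 // => i _; exact: w_feasible.1.
rewrite SsigE; last exact: normalized_valid.
apply: eq_bigr => k _; apply: eq_bigr => i _.
by rewrite Cn_normalized level_vectorsE -normalizedE.
Qed.
End Normalization.

(* Feasibility for the dual program; [e = 1] for the minimum, [e = -1] for the maximum. *)
Definition dual_feasible e y : Prop := forall k i,
  e * (\sum_(m < d | (m <= k)%N) y m * - ln (lam a i (s m))) <=
  e * - ln (class_weight S (initial_coords s k.+1) i).

Lemma dual_exchange w y :
  \sum_k \sum_i w k i * (\sum_(m < d | (m <= k)%N) y m * - ln (lam a i (s m))) =
  \sum_m y m * weighted_exponent S s w m.
Proof.
rewrite /weighted_exponent; under [RHS]eq_bigr do rewrite mulr_sumr.
rewrite [RHS](exchange_big_dep xpredT) //=; apply: eq_bigr => k _.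
under [RHS]eq_bigr do rewrite mulr_sumr.
rewrite exchange_big /=; apply: eq_bigr => i _; rewrite mulr_sumr.
by apply: eq_bigr => m _; ring.
Qed.

Lemma weak_duality e w y : (forall k i, 0 <= w k i) -> dual_feasible e y ->
  e * \sum_m y m * weighted_exponent S s w m <= e * weighted_entropy S s w.
Proof.
move=> w0 dual; rewrite -dual_exchange /weighted_entropy !mulr_sumr; apply: ler_sum => k _.
rewrite !mulr_sumr; apply: ler_sum => i _.
by rewrite mulrCA [leRHS]mulrCA ler_wpM2l.
Qed.

Lemma complementary_slackness w y : (forall k i, w k i != 0 ->
    \sum_(m < d | (m <= k)%N) y m * - ln (lam a i (s m)) =
    - ln (class_weight S (initial_coords s k.+1) i)) ->
  \sum_m y m * weighted_exponent S s w m = weighted_entropy S s w.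
Proof.
move=> tight; rewrite -dual_exchange; apply: eq_bigr => k _; apply: eq_bigr => i _.
by have [->|/tight ->] := eqVneq (w k i) 0; rewrite ?mul0r.
Qed.

Lemma feasible_duality e w y : feasible S s w -> dual_feasible e y ->
  e * \sum_m y m <= e * weighted_entropy S s w.
Proof.
move=> [w0 w1] dual; rewrite (eq_bigr (fun m => y m * weighted_exponent S s w m)) => [|m _].
  exact: weak_duality.
by rewrite w1 mulr1.
Qed.

Section ExtremalSteps.
Variable ext : set R -> R.
Let Sn n := Saux a t mu ext s n n.

Lemma Saux_fuel f f' n : (n <= f)%N -> (n <= f')%N ->
  Saux a t mu ext s f n = Saux a t mu ext s f' n.
Proof.
have [b] := ubnP n; elim: b n f f' => // b IH [|n] [|f] [|f'] //; rewrite !ltnS => nb nf nf' /=.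
rewrite (IH n f f') //; congr (_ + ext _).
congr (image _ _); apply/funext => i; congr (_ * (_ + _)).
apply: eq_big_nat => m /andP[m1 mn]; rewrite ltnS in mn.
by rewrite (IH m.-1 f f') ?(IH m f f') //; lia.
Qed.

Definition extremal_step (k : nat) : R := Sn k.+1 - Sn k.
Definition step_ratio (k : nat) i : R := (ln (lamS a s i k.+1))^-1 *
  (ln (mun a t mu s k.+1 i) + \sum_(m < k) - extremal_step m * ln (lamS a s i m.+1)).

Lemma extremal_stepE (k : nat) :
  extremal_step k = ext [set step_ratio k i | i in [set i | Iset a t s k.+1 i]].
Proof.
rewrite /extremal_step {1}/Sn /= [X in X - _]addrC addrK; congr ext.
congr (image _ _); apply/funext => i; congr (_ * (_ + _)).
rewrite big_add1 /= big_mkord; apply: eq_bigr => m _.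
by rewrite opprB /Sn; congr ((_ - _) * _); apply: Saux_fuel => //; exact: ltnW.
Qed.

Lemma sum_extremal_step : \sum_(k < d) extremal_step k = Saux a t mu ext s d d.
Proof. by rewrite -(big_mkord xpredT extremal_step) telescope_sumr // subr0. Qed.

Lemma dual_sum_step_ratio k i : Iset a t s k.+1 i ->
  \sum_(m < d | (m <= k)%N) extremal_step m * - ln (lam a i (s m)) =
  - ln (class_weight S (initial_coords s k.+1) i) +
  (extremal_step k - step_ratio k i) * - ln (lam a i (s k)).
Proof.
move=> Ii; have ln0 : ln (lam a i (s k)) != 0.
  by rewrite -oppr_eq0 gt_eqF // (lyap_gt0 S).
rewrite (bigD1 k) //= /step_ratio lamSE munE //.
have <- : \sum_(m < k) - extremal_step m * ln (lamS a s i m.+1) =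
    \sum_(m < d | (m <= k)%N && (m != k)) extremal_step m * - ln (lam a i (s m)).
  have kd := ltnW (ltn_ord k).
  rewrite (big_ord_widen d (fun m : nat => - extremal_step m * ln (lamS a s i m.+1)) kd).
  apply: eq_big => [m|m _]; last by rewrite lamSE mulrN mulNr.
  by rewrite andbC -ltn_neqAle.
by field.
Qed.

Lemma step_tight k i : Iset a t s k.+1 i -> extremal_step k = step_ratio k i ->
  \sum_(m < d | (m <= k)%N) extremal_step m * - ln (lam a i (s m)) =
  - ln (class_weight S (initial_coords s k.+1) i).
Proof. by move=> /dual_sum_step_ratio -> ->; rewrite subrr mul0r addr0. Qed.

Lemma extremal_step_dual_feasible e :
  (forall k i, Iset a t s k.+1 i -> e * extremal_step k <= e * step_ratio k i) ->
  dual_feasible e (fun k => extremal_step k).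
Proof.
move=> opt k i; pose r := class_rep S (initial_coords s k.+1) i.
have ir := agree_class_rep S (initial_coords s k.+1) i.
rewrite (eq_class_weight ir) (eq_bigr (fun m => extremal_step m * - ln (lam a r (s m)))) => [|m mk].
  rewrite dual_sum_step_ratio ?Iset_class_rep // mulrDr gerDl mulrA mulrBr.
  by rewrite mulr_le0_ge0 ?subr_le0 ?opt ?Iset_class_rep // ltW // lyap_gt0.
by move/agreeP: ir => /(_ (s m)); rewrite /lam mem_initial_coords => /(_ mk)[->].
Qed.
End ExtremalSteps.

Lemma inf_step_attained k : exists2 i, Iset a t s k.+1 i &
  extremal_step inf k = step_ratio inf k i /\
  forall j, Iset a t s k.+1 j -> extremal_step inf k <= step_ratio inf k j.
Proof.
rewrite extremal_stepE.
have [|i Ii [-> minimal]] := @inf_image_attained R _ (Iset a t s k.+1) (step_ratio inf k).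
  by exists (class_rep S (initial_coords s k.+1) (first_map S)); exact: Iset_class_rep.
by exists i.
Qed.

Lemma sup_step_attained k : exists2 i, Iset a t s k.+1 i &
  extremal_step sup k = step_ratio sup k i /\
  forall j, Iset a t s k.+1 j -> step_ratio sup k j <= extremal_step sup k.
Proof.
rewrite extremal_stepE.
have [|i Ii [-> maximal]] := @sup_image_attained R _ (Iset a t s k.+1) (step_ratio sup k).
  by exists (class_rep S (initial_coords s k.+1) (first_map S)); exact: Iset_class_rep.
by exists i.
Qed.

Lemma inf_steps_dual_feasible : dual_feasible 1 (fun k => extremal_step inf k).
Proof.
apply: extremal_step_dual_feasible => k i Ii; rewrite !mul1r.
by have [_ _ [_]] := inf_step_attained k; apply.
Qed.

Lemma sup_steps_dual_feasible : dual_feasible (-1) (fun k => extremal_step sup k).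
Proof.
apply: extremal_step_dual_feasible => k i Ii; rewrite !mulN1r lerN2.
by have [_ _ [_]] := sup_step_attained k; apply.
Qed.

Lemma Sund_le_entropy w : feasible S s w -> Sund a t mu s d <= weighted_entropy S s w.
Proof.
move=> /feasible_duality/(_ inf_steps_dual_feasible).
by rewrite !mul1r sum_extremal_step.
Qed.

Lemma entropy_le_Sbar w : feasible S s w -> weighted_entropy S s w <= Sbar a t mu s d.
Proof.
move=> /feasible_duality/(_ sup_steps_dual_feasible).
by rewrite !mulN1r lerN2 sum_extremal_step.
Qed.

Definition ordered_ratios : Prop :=
  forall i n, (1 <= n < d)%N -> lamS a s i n.+1 <= lamS a s i n.

Section OrderedRatios.
Hypothesis ratios_ordered : ordered_ratios.

Lemma ordered_lam i k k' : (k' : nat) = k.+1 -> lam a i (s k') <= lam a i (s k).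
Proof.
move=> e; rewrite -!lamSE e; apply: ratios_ordered.
by apply/andP; split=> //; rewrite -e; exact: ltn_ord.
Qed.

Lemma ordered_Cn_ge0 p : Pvalid a t s p -> forall k, 0 <= Cn a t s p k.+1.
Proof.
move=> pv; apply: ord_downward_ind => k IH.
rewrite CnE divr_ge0 ?(ltW (chi_gt0 pv _)) // subr_ge0.
have [kd|kd] := ltnP k.+1 d; last first.
  by rewrite big1 ?ler01 // => m km; have := ltn_ord m; rewrite ltnNge (leq_trans kd).
pose k' := Ordinal kd; rewrite -(Cn_sum pv k').
apply: ler_sum => m km; rewrite ler_wpM2l ?IH // !chiE //.
have [pos _ _] := Pvalid_level pv m.
apply: ler_sum => i _; rewrite ler_wpM2l // lerN2 ler_ln ?posrE ?(ratio_gt0 S) //.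
exact: ordered_lam.
Qed.

Lemma ordered_optimum (ext : set R -> R) :
  (forall k, exists2 i, Iset a t s k.+1 i & extremal_step ext k = step_ratio ext k i) ->
  exists2 w, feasible S s w & weighted_entropy S s w = Saux a t mu ext s d d.
Proof.
move=> attained; have {}attained k : exists i,
    Iset a t s k.+1 i /\ extremal_step ext k = step_ratio ext k i.
  by have [i] := attained k; exists i.
have [g gP] := choice attained.
pose dirac k i : R := (i == g k)%:R; pose p := level_vectors dirac.
have pv : Pvalid a t s p.
  apply: Pvalid_level_vectors => [k i|k i nI|k]; first by rewrite /dirac.
    by rewrite /dirac; case: eqP => // ig; have [] := gP k; rewrite -ig (negbTE nI).
  by rewrite (bigD1 (g k)) //= /dirac eqxx big1 ?addr0 // => i /negbTE ->.
have w_feasible := feasible_coefficients pv (ordered_Cn_ge0 pv).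
exists (fun k i => Cn a t s p k.+1 * p k.+1 i) => //.
rewrite -(@complementary_slackness _ (fun k => extremal_step ext k)).
  by under eq_bigr do rewrite w_feasible.2 mulr1; exact: sum_extremal_step.
move=> k i; rewrite /p level_vectorsE /dirac.
have [-> _|_] := eqVneq i (g k); last by rewrite mulr0 eqxx.
by have [Ig tight] := gP k; exact: step_tight.
Qed.

Lemma ordered_cutoff_antitone (delta : R) x : 0 < delta < 1 -> antitone_along s (cutoff S delta x).
Proof.
move=> delta01; apply: antitone_along_adjacent => k1 k2 k12; rewrite leqNgt lt_cutoff // -leNgt.
apply: (@le_trans _ _ (side S x (cutoff S delta x (s k1)) (s k1))); last first.
  by have /andP[] := side_cutoff S delta01 x (s k1).
by apply: ler_prod => l _; rewrite (ltW (ratio_gt0 S _ _)) /=; exact: ordered_lam.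
Qed.

Lemma ordered_cube_mass e y : dual_feasible e y ->
  exists C : R, forall s0 x, 0 < s0 ->
    s0 * (e * \sum_k y k) - C <= e * - ln (cube_mass S (expR (- s0)) x).
Proof.
move=> dual; exists (\sum_k `|e * y k| * lyap_max S) => s0 x s00.
have anti := ordered_cutoff_antitone x (expRN_in01 s00).
have := weak_duality (empirical_weight_ge0 S s x s00) dual.
rewrite (weighted_entropy_empirical anti) [e * (_ / _)]mulrA ler_pdivlMr //; apply: le_trans.
rewrite !mulr_sumr mulr_suml -sumrB; apply: ler_sum => k _.
have /andP[] := weighted_exponent_empirical_bounds s00 anti k.
set c := weighted_exponent _ _ _ _ => c1 c2.
have : `|e * y k * ((c - 1) * s0)| <= `|e * y k| * lyap_max S.
  rewrite normrM ler_wpM2l // ger0_norm ?mulr_ge0 ?subr_ge0 ?(ltW s00) //.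
  by rewrite -ler_pdivlMr // lerBlDl.
rewrite ler_norml => /andP[deviation _].
have -> : e * (y k * c) * s0 = s0 * (e * y k) + e * y k * ((c - 1) * s0) by ring.
by rewrite lerD2l.
Qed.
End OrderedRatios.
End Variational.

(** * Dimensions of the measure from the spectrum *)

Section Spectrum.
Variables (R : realType) (d N : nat) (S : sponge R d N).
Variables (dm : measure_display) (T : measurableType dm) (P : probability T R).
Variables (X : T -> Sigma N).
Hypothesis XP : iid_law (weight S) P X.
Local Notation a := (linear_part S).
Local Notation t := (translation S).
Local Notation mu := (weight S).
Local Notation nu := (sponge_measure S P X).
Local Notation ball_mass := (ball_mass S P X).
Local Notation counting_rate := (counting_rate S).
Implicit Types (x : Sigma N) (q e v s : R) (sigma : {perm 'I_d}) (w : 'I_d -> 'I_N -> R).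
Variable Tf : R -> R.
Hypothesis TfP : forall q, growth_rate (log_moment S P X q) (Tf q).

Lemma Tdelta_cvg_spectrum q : ln (Tdelta nu q delta) / - ln delta @[delta --> 0^'+] --> Tf q.
Proof.
have lim := growth_rate_cvg_ln (@TfP q); apply: cvg_trans lim.
apply: near_eq_cvg; near=> x.
have x0 : 0 < x by near: x; exact: nbhs_right_gt.
by rewrite /log_moment opprK lnK.
Unshelve. all: by end_near. Qed.

Lemma counting_rate_ge0 : 0 <= counting_rate.
Proof. by rewrite divr_ge0 ?(ln_maps_ge0 S) // ltW // lyap_min_gt0. Qed.

Lemma spectrum_ge_feasible q sigma w : feasible S sigma w ->
  - q * weighted_entropy S sigma w <= Tf q.
Proof.
move=> /feasible_realized[C realized]; set entropy := weighted_entropy _ _ _ in realized *.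
have linear := @growth_rate_linear R (Tf q).
apply: (growth_rate_ge (c := `|q| * (C + interleaving_loss S) + Tf q * lyap_max S) linear).
near=> s.
have s0 : 0 < s by near: s; exact: nbhs_pinfty_gt.
have [x near_x] := realized s s0.
have := spectrum_ge_cube XP x (@TfP q) (expRN_in01 s0).
rewrite expRK opprK ler_pdivrMr ?addr_gt0 ?lyap_max_gt0 // => cube_le.
have : `|q * (ln (cube_mass S (expR (- s)) x) + s * entropy)| <= `|q| * C.
  by rewrite normrM ler_wpM2l.
by rewrite ler_norml; move: cube_le; lra.
Unshelve. all: by end_near. Qed.

Lemma spectrum_le_of_cube_mass q e v : q = e * `|q| ->
  (forall v', v' < v -> \forall s \near +oo, forall x,
     s * v' <= e * - ln (cube_mass S (expR (- s)) x)) ->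
  Tf q <= counting_rate - `|q| * v.
Proof.
move=> qe mass_ge; apply/ler_addgt0Pr => eps eps0.
pose v' := v - eps / (`|q| + 1).
have v'v : v' < v by rewrite ltrBlDr ltrDl divr_gt0.
apply: (@le_trans _ _ (counting_rate + - (`|q| * v'))).
  apply: (spectrum_le_cubes XP (@TfP q)); apply: filterS (mass_ge _ v'v) => s cube x.
  have -> : q * ln (cube_mass S (expR (- s)) x) =
      - (`|q| * (e * - ln (cube_mass S (expR (- s)) x))).
    by rewrite {1}qe; ring.
  by have := ler_wpM2l (normr_ge0 q) (cube x); lra.
have : `|q| * (eps / (`|q| + 1)) <= eps by rewrite mulrCA ger_pMr // ler_pdivrMr // mul1r lerDl.
by rewrite /v' mulrBr; lra.
Qed.

Lemma spectrum_le_feasible q e v : q = e * `|q| ->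
  (forall sigma w, Aset a sigma -> feasible S sigma w -> class_supported S sigma w ->
    v <= e * weighted_entropy S sigma w) ->
  Tf q <= counting_rate - `|q| * v.
Proof.
move=> qe entropy_ge; apply: (spectrum_le_of_cube_mass qe) => v' v'v.
apply: contrapT => not_eventually.
have [s1|sigma [w [As wF wI]]] := @feasible_limit _ _ _ S e v'.
  apply: contrapT => not_frequently; apply: not_eventually; near=> s => x.
  rewrite leNgt; apply/negP => small; apply: not_frequently; exists s, x; split; last exact: ltW.
  by near: s; apply: nbhs_pinfty_ge; exact: num_real.
by rewrite leNgt (lt_le_trans v'v) // entropy_ge.
Unshelve. all: by end_near. Qed.

Lemma spectrum_le_dual sigma q e y :
  ordered_ratios S sigma -> dual_feasible S sigma e y -> q = e * `|q| ->
  Tf q <= counting_rate - `|q| * (e * \sum_k y k).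
Proof.
move=> ordered dual qe; have [C cube] := ordered_cube_mass ordered dual.
apply: (spectrum_le_of_cube_mass qe) => v' v'v; near=> s => x.
have s0 : 0 < s by near: s; exact: nbhs_pinfty_gt.
apply: le_trans (cube s x s0); set v := e * _ in v'v *.
have : C / (v - v') <= s by near: s; apply: nbhs_pinfty_ge; exact: num_real.
by rewrite ler_pdivrMr ?subr_gt0 //; lra.
Unshelve. all: by end_near. Qed.

Lemma log_moment_scale q s b C : 0 < s ->
  (forall z, msupp nu z -> q * ln (ball_mass z (expR (- s))) <= q * (C - b * s)) ->
  log_moment S P X q s <= log_moment S P X 0 s + q * (C - b * s).
Proof.
move=> s0 mass_le; have s01 := expRN_in01 s0.
have T0 := Tdelta_gt0 XP 0 s01; have Tq := Tdelta_gt0 XP q s01.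
rewrite /log_moment -[q * _]expRK -lnM ?posrE ?expR_gt0 // ler_ln ?posrE ?mulr_gt0 ?expR_gt0 //.
apply: Tdelta_le => k xs [supp disj].
apply: (@le_trans _ _ ((\sum_(j < k) ball_mass (xs j) (expR (- s)) `^ 0) * expR (q * (C - b * s)))).
  rewrite mulr_suml; apply: ler_sum => j _; rewrite powRr0 mul1r.
  by rewrite powR_expR ?ler_expR ?mass_le //; apply: msupp_ball_mass_gt0 => //; exact: expR_gt0.
rewrite ler_wpM2r ?expR_ge0 //.
by apply: (ball_moment_le_Tdelta XP s01) => // j j' _ _; exact: disj.
Qed.

Lemma spectrum_scale q b C :
  (forall s1, exists2 s, s1 <= s & forall z, msupp nu z ->
     q * ln (ball_mass z (expR (- s))) <= q * (C - b * s)) ->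
  Tf q <= Tf 0 - q * b.
Proof.
move=> freq; rewrite -lerBlDl.
apply: (growth_rate_le_frequently (c := q * C) (growth_rateB (@TfP q) (@TfP 0))) => s1.
have [s] := freq (Num.max 1 s1); rewrite ge_max => /andP[s_ge1 s1s] mass_le; exists s => //.
by have := log_moment_scale (lt_le_trans ltr01 s_ge1) mass_le; lra.
Qed.

Lemma ball_mass_of_spectrum q b : Tf q < - q * b ->
  exists2 s1, 1 <= s1 & forall s z, s1 <= s -> msupp nu z ->
    q * ln (ball_mass z (expR (- s))) <= - q * b * s.
Proof.
move=> Tfq.
have [s1 [_ far]] : \forall s \near +oo, log_moment S P X q s / s < - q * b.
  by apply: (cvgr_lt (Tf q)) => //; exact: TfP.
exists (Num.max 1 (s1 + 1)) => [|s z]; first by rewrite le_max lexx.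
rewrite ge_max => /andP[s_ge1 s1s] zs; have s0 : 0 < s by exact: lt_le_trans s_ge1.
have s01 := expRN_in01 s0; have /andP[e0 _] := s01.
have : log_moment S P X q s / s < - q * b by apply: far; rewrite (lt_le_trans _ s1s) // ltrDl.
rewrite ltr_pdivrMr // => /ltW; apply: le_trans.
rewrite -ln_powR ler_ln ?posrE ?powR_gt0 ?(Tdelta_gt0 XP) ?msupp_ball_mass_gt0 //.
exact: ball_mass_powR_le_Tdelta.
Qed.

Section FrostmanDimension.
Variable v : R.
Hypothesis spectrum_ge : forall q, 0 < q -> - q * v <= Tf q.
Hypothesis spectrum_le : forall q, 0 < q -> Tf q <= counting_rate - q * v.

Lemma spectrum_slope_pinfty : Tf q / - q @[q --> +oo] --> v.
Proof.
apply: (cvg_slope_of_affine_bound (C := counting_rate)); last first.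
  by apply/cvgryPge => A; near=> q; rewrite (le_trans _ (ler_norm q)) //; near: q;
    apply: nbhs_pinfty_ge; exact: num_real.
near=> q; rewrite ger0_norm; first by rewrite -lerBrDr spectrum_le.
by rewrite -lerBlDr sub0r -mulNr spectrum_ge.
Unshelve. all: by end_near. Qed.

Lemma dimF_le : (dimF nu <= v%:E)%E.
Proof.
apply: ge_ereal_sup => _ [s [s_ge0 [C [C1 frostman]]] <-]; rewrite lee_fin -subr_le0.
have C0 : 0 < C by exact: lt_le_trans C1.
apply: (@multiples_bounded_le0 _ _ (Tf 0)) => q q0.
suff scale : Tf q <= Tf 0 - q * s by have := spectrum_ge q0; lra.
apply: (spectrum_scale (C := ln C)) => s1; exists (Num.max 1 s1); first by rewrite le_max lexx orbT.
set s' := Num.max 1 s1; have s'0 : 0 < s' by rewrite lt_max ltr01.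
move=> z zs; have e0 := expR_gt0 (- s'); rewrite ler_pM2l //.
have := frostman z zs _ (expRN_in01 s'0); have m0 := msupp_ball_mass_gt0 XP zs e0.
rewrite ball_massE // lee_fin -ler_ln ?posrE ?mulr_gt0 ?powR_gt0 // lnM ?posrE ?powR_gt0 //.
by rewrite ln_powR expRK mulrN.
Qed.

Lemma frostman_exponent s : 0 <= s -> s < v ->
  exists C : R, 1 <= C /\ forall z, msupp nu z -> forall delta : R, 0 < delta < 1 ->
    ball_mass z delta <= C * delta `^ s.
Proof.
move=> s_ge0 sv; pose q := (counting_rate + 1) / (v - s).
have vs0 : 0 < v - s by rewrite subr_gt0.
have q0 : 0 < q by rewrite divr_gt0 // ltr_wpDl ?counting_rate_ge0.
have qvs : q * (v - s) = counting_rate + 1 by rewrite divfK // gt_eqF.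
have [|s1 s1_ge1 small] := @ball_mass_of_spectrum q s.
  by have := spectrum_le q0; lra.
have s1_ge0 : 0 <= s * s1 by rewrite mulr_ge0 // (le_trans ler01).
exists (expR (s * s1)); split; first by rewrite -expR0 ler_expR.
move=> z zs delta /andP[delta0 _]; rewrite powR_expR // -expRD.
have [far|near] := leP s1 (- ln delta).
  have := small _ z far zs; rewrite opprK lnK ?posrE // mulNr mulrNN -mulrA ler_pM2l // => mass_le.
  rewrite -[leLHS]lnK ?posrE ?(msupp_ball_mass_gt0 XP) // ler_expR (le_trans mass_le) //.
  by rewrite lerDr.
apply: (le_trans (ball_mass_le1 XP _ _)); rewrite -expR0 ler_expR -mulrDr mulr_ge0 //.
by rewrite -lerBlDr sub0r ltW.
Qed.

Lemma dimF_ge : (v%:E <= dimF nu)%E.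
Proof.
apply/lee_addgt0Pr => e e0; have [ve|ev] := leP v e.
  apply: (@le_trans _ _ (0%:E + e%:E)); first by rewrite -EFinD add0r lee_fin.
  rewrite leeD2r //; apply: ereal_sup_ubound; exists 0 => //; split=> //.
  by exists 1; split=> // z zs delta _; rewrite ball_massE // powRr0 mulr1 lee_fin ball_mass_le1.
have [||C [C1 frostman]] := @frostman_exponent (v - e); [by rewrite subr_ge0 ltW|by rewrite gtrBl|].
rewrite -[v](subrK e) EFinD leeD2r //; apply: ereal_sup_ubound; exists (v - e) => //.
split; first by rewrite /= subr_ge0 ltW.
by exists C; split=> // z zs delta delta01; rewrite ball_massE // lee_fin frostman.
Qed.

Lemma dimF_eq : dimF nu = v%:E.
Proof. by apply/eqP; rewrite eq_le dimF_le dimF_ge. Qed.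
End FrostmanDimension.

Section BoxDimension.
Variable v : R.
Hypothesis v_ge0 : 0 <= v.
Hypothesis spectrum_ge : forall q, q < 0 -> - q * v <= Tf q.
Hypothesis spectrum_le : forall q, q < 0 -> Tf q <= counting_rate - q * v.

Lemma spectrum_slope_ninfty : Tf q / - q @[q --> -oo] --> v.
Proof.
apply: (cvg_slope_of_affine_bound (C := counting_rate)); last first.
  apply/cvgryPge => A; near=> q; rewrite -normrN (le_trans _ (ler_norm _)) // lerNr; near: q.
  by apply: nbhs_ninfty_le; exact: num_real.
near=> q; rewrite ger0_norm; first by rewrite -lerBrDr spectrum_le.
by rewrite -lerBlDr sub0r -mulNr spectrum_ge.
Unshelve. all: by end_near. Qed.

Lemma dimBlow_ge : (v%:E <= dimBlow nu)%E.
Proof.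
apply: le_ereal_inf_tmp => _ [s [s_ge0 [c [c0 [dl [dl01 [dl_cvg box]]]]]] <-].
rewrite lee_fin -subr_le0; apply: (@multiples_bounded_le0 _ _ (Tf 0)) => q q0.
have nq0 : - q < 0 by rewrite oppr_lt0.
suff scale : Tf (- q) <= Tf 0 - - q * s by have := spectrum_ge nq0; lra.
apply: (spectrum_scale (C := ln c)) => s1.
have /cvgrPdist_lt/(_ (expR (- s1)) (expR_gt0 _)) := dl_cvg.
move=> [n _ /(_ n (leqnn n))] /=; rewrite sub0r normrN.
have /andP[dl0 _] := dl01 n; rewrite (gtr0_norm dl0) => dln.
exists (- ln (dl n)); first by rewrite lerNr -[leRHS]expRK ler_ln ?posrE ?expR_gt0 // ltW.
move=> z zs; rewrite opprK lnK ?posrE // ler_nM2l //.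
have := box z zs n; have m0 := msupp_ball_mass_gt0 XP zs dl0.
rewrite ball_massE // lee_fin -ler_ln ?posrE ?mulr_gt0 ?powR_gt0 //.
by rewrite lnM ?posrE ?powR_gt0 // ln_powR mulrN opprK.
Qed.

Lemma dimBlow_le_dimBup : (dimBlow nu <= dimBup nu)%E.
Proof.
have half01 n : 0 < (n.+2%:R^-1 : R) < 1.
  by rewrite invr_gt0 ltr0n /= invf_lt1 ?ltr0n // ltr1n.
apply: ereal_inf_le_tmp => _ [s [s_ge0 [c [c0 box]]] <-]; exists s => //; split=> //.
exists c; split=> //; exists (fun n => n.+2%:R^-1); split=> //.
split; first by have := @cvg_harmonic R; rewrite -cvg_shiftS.
by move=> z zs n; exact: box.
Qed.

Lemma box_exponent s : v < s ->
  exists c : R, 0 < c /\ forall z, msupp nu z -> forall delta : R, 0 < delta < 1 ->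
    c * delta `^ s <= ball_mass z delta.
Proof.
move=> vs; pose q := (counting_rate + 1) / (s - v).
have sv0 : 0 < s - v by rewrite subr_gt0.
have s0 : 0 < s by exact: le_lt_trans vs.
have q0 : 0 < q by rewrite divr_gt0 // ltr_wpDl ?counting_rate_ge0.
have nq0 : - q < 0 by rewrite oppr_lt0.
have qsv : q * (s - v) = counting_rate + 1 by rewrite divfK // gt_eqF.
have [|s1 s1_ge1 large] := @ball_mass_of_spectrum (- q) s.
  by have := spectrum_le nq0; lra.
have s1_gt0 : 0 < s1 by exact: lt_le_trans s1_ge1.
have low s' z : s1 <= s' -> msupp nu z -> expR (- (s * s')) <= ball_mass z (expR (- s')).
  move=> s1s' zs; have m0 := msupp_ball_mass_gt0 XP zs (expR_gt0 (- s')).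
  rewrite -[leRHS]lnK ?posrE // ler_expR -(ler_nM2l nq0) (le_trans (large s' z s1s' zs)) //.
  by rewrite le_eqVlt; apply/orP; left; apply/eqP; ring.
exists (expR (- (s * s1))); split; first exact: expR_gt0.
move=> z zs delta /andP[delta0 delta1]; rewrite powR_expR // -expRD.
have ln0 : ln delta <= 0 by rewrite ln_le0 // ltW.
have [far|near] := leP s1 (- ln delta).
  have := low _ z far zs; rewrite opprK lnK ?posrE //; apply: le_trans.
  by rewrite ler_expR mulrN opprK gerDr oppr_le0 mulr_ge0 // ltW.
apply: (@le_trans _ _ (ball_mass z (expR (- s1)))).
  apply: le_trans (low s1 z (lexx _) zs).
  by rewrite ler_expR gerDl mulr_ge0_le0 // ltW.
by apply: ball_mass_mono => //; rewrite -[leRHS]lnK ?posrE // ler_expR lerNl ltW.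
Qed.

Lemma dimBup_le : (dimBup nu <= v%:E)%E.
Proof.
apply/lee_addgt0Pr => e e0; have [|c [c0 box]] := @box_exponent (v + e); first by rewrite ltrDl.
rewrite -EFinD; apply: ereal_inf_lbound; exists (v + e) => //.
split; first by rewrite /= addr_ge0 // ltW.
by exists c; split=> // z zs delta delta01; rewrite ball_massE // lee_fin box.
Qed.

Lemma dimBup_eq : dimBup nu = v%:E.
Proof. by apply/eqP; rewrite eq_le dimBup_le (le_trans dimBlow_ge dimBlow_le_dimBup). Qed.

Lemma dimBlow_eq : dimBlow nu = v%:E.
Proof. by apply/eqP; rewrite eq_le dimBlow_ge (le_trans dimBlow_le_dimBup dimBup_le). Qed.
End BoxDimension.

Lemma ordered_dimF sigma : ordered_ratios S sigma ->
  dimF nu = (Sund a t mu sigma d)%:E.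
Proof.
move=> ordered.
have [|w wF we] := @ordered_optimum _ _ _ S sigma ordered inf.
  by move=> k; have [i Ii [tight _]] := inf_step_attained S sigma k; exists i.
rewrite [Sund _ _ _ _ _](esym we); apply: dimF_eq => q q0; first exact: spectrum_ge_feasible.
have := @spectrum_le_dual sigma q 1 _ ordered (inf_steps_dual_feasible S sigma).
by rewrite (gtr0_norm q0) !mul1r sum_extremal_step we; apply.
Qed.

Lemma ordered_dimB sigma : ordered_ratios S sigma ->
  dimBup nu = (Sbar a t mu sigma d)%:E /\ dimBlow nu = (Sbar a t mu sigma d)%:E.
Proof.
move=> ordered.
have [|w wF we] := @ordered_optimum _ _ _ S sigma ordered sup.
  by move=> k; have [i Ii [tight _]] := sup_step_attained S sigma k; exists i.
have slope_ge q : q < 0 -> - q * weighted_entropy S sigma w <= Tf q.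
  by move=> _; exact: spectrum_ge_feasible.
have slope_le q : q < 0 -> Tf q <= counting_rate - q * weighted_entropy S sigma w.
  move=> q0; have := @spectrum_le_dual sigma q (-1) _ ordered (sup_steps_dual_feasible S sigma).
  by rewrite (ltr0_norm q0) !mulN1r opprK sum_extremal_step we mulrNN; apply.
have v0 := weighted_entropy_ge0 wF.
rewrite [Sbar _ _ _ _ _](esym we).
by split; [exact: dimBup_eq v0 slope_ge slope_le | exact: dimBlow_eq v0 slope_ge slope_le].
Qed.

(** * The variational formulas *)

Definition S_values : set R :=
  \bigcup_(sigma in Aset a) [set Ssig a t mu sigma p | p in Qset a t sigma].

Lemma S_values_feasible z : S_values z ->
  exists sigma w, [/\ Aset a sigma, feasible S sigma w & weighted_entropy S sigma w = z].
Proof. by move=> [sigma As [p /feasible_of_Qset[w wF <-] <-]]; exists sigma, w. Qed.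

Lemma weighted_entropy_S_values sigma w : Aset a sigma -> feasible S sigma w ->
  class_supported S sigma w -> S_values (weighted_entropy S sigma w).
Proof.
by move=> As wF wI; have [p Qp <-] := Qset_of_feasible wF wI; exists sigma => //; exists p.
Qed.

Lemma S_values_neq0 : S_values !=set0.
Proof.
have [s1|sigma [w [As wF wI _]]] := @feasible_limit _ _ _ S 1 (info_max S * (1 / lyap_min S + 1)).
  have s1' : 1 <= Num.max 1 s1 by rewrite le_max lexx.
  have s0 : 0 < Num.max 1 s1 by exact: lt_le_trans s1'.
  exists (Num.max 1 s1), (fun=> first_map S); split; first by rewrite le_max lexx orbT.
  rewrite mul1r (le_trans (cube_info_le _ _ s0)) // mulrCA ler_wpM2l ?info_max_ge0 //.
  by rewrite mulrDr mulr1 mulrA mulr1 lerD2l.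
by exists (weighted_entropy S sigma w); exact: weighted_entropy_S_values.
Qed.

Lemma S_values_ge0 z : S_values z -> 0 <= z.
Proof. by move=> /S_values_feasible[sigma [w [_ wF <-]]]; exact: weighted_entropy_ge0 wF. Qed.

Lemma spectrum_ge_S_values q z : S_values z -> - q * z <= Tf q.
Proof. by move=> /S_values_feasible[sigma [w [_ wF <-]]]; exact: spectrum_ge_feasible. Qed.

Lemma S_values_has_lbound : has_lbound S_values.
Proof. by exists 0 => z; exact: S_values_ge0. Qed.

Lemma S_values_has_ubound : has_ubound S_values.
Proof. by exists (Tf (-1)) => z /(spectrum_ge_S_values (-1)); rewrite opprK mul1r. Qed.

Lemma sup_S_values_ge0 : 0 <= sup S_values.
Proof.
have [z Sz] := S_values_neq0; apply: le_trans (S_values_ge0 Sz) _.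
exact: ub_le_sup S_values_has_ubound _ Sz.
Qed.

Lemma spectrum_ge_inf q : 0 < q -> - q * inf S_values <= Tf q.
Proof.
move=> q0; rewrite mulNr lerNl mulrC -ler_pdivrMr //; apply: lb_le_inf S_values_neq0 _ => z Sz.
by rewrite ler_pdivrMr // mulrC lerNl -mulNr spectrum_ge_S_values.
Qed.

Lemma spectrum_ge_sup q : q < 0 -> - q * sup S_values <= Tf q.
Proof.
move=> q0; rewrite mulrC -ler_pdivlMr ?oppr_gt0 //; apply: ge_sup S_values_neq0 _ => z Sz.
by rewrite ler_pdivlMr ?oppr_gt0 // mulrC spectrum_ge_S_values.
Qed.

Lemma spectrum_le_inf q : 0 < q -> Tf q <= counting_rate - q * inf S_values.
Proof.
move=> q0; rewrite -{2}(gtr0_norm q0); apply: (@spectrum_le_feasible q 1).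
  by rewrite mul1r gtr0_norm.
move=> sigma w As wF wI; rewrite mul1r.
exact: ge_inf S_values_has_lbound _ (weighted_entropy_S_values As wF wI).
Qed.

Lemma spectrum_le_sup q : q < 0 -> Tf q <= counting_rate - q * sup S_values.
Proof.
move=> q0; rewrite -[q * _]mulrNN -(ltr0_norm q0); apply: (@spectrum_le_feasible q (-1)).
  by rewrite (ltr0_norm q0) mulN1r opprK.
move=> sigma w As wF wI; rewrite mulN1r lerN2.
exact: ub_le_sup S_values_has_ubound _ (weighted_entropy_S_values As wF wI).
Qed.

Lemma ereal_inf_S_values :
  ereal_inf [set ereal_inf [set (Ssig a t mu sigma p)%:E | p in Qset a t sigma]
            | sigma in Aset a] = (inf S_values)%:E.
Proof. exact: ereal_inf_iterated S_values_neq0 S_values_has_lbound. Qed.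

Lemma ereal_sup_S_values :
  ereal_sup [set ereal_sup [set (Ssig a t mu sigma p)%:E | p in Qset a t sigma]
            | sigma in Aset a] = (sup S_values)%:E.
Proof. exact: ereal_sup_iterated S_values_neq0 S_values_has_ubound. Qed.

Lemma Sund_le_inf_S_values :
  (maxe 0 (ereal_inf [set (Sund a t mu sigma d)%:E | sigma in Aset a]) <= (inf S_values)%:E)%E.
Proof.
rewrite -ereal_inf_S_values ge_max; apply/andP; split.
  by rewrite ereal_inf_S_values lee_fin; apply: lb_le_inf S_values_neq0 _ => z; exact: S_values_ge0.
apply: le_ereal_inf_tmp => _ [sigma As <-]; apply: le_ereal_inf_tmp => _ [p Qp <-].
have [w wF <-] := feasible_of_Qset Qp.
apply: ge_ereal_inf; exists (Sund a t mu sigma d)%:E; first by exists sigma.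
by rewrite lee_fin Sund_le_entropy.
Qed.

Lemma sup_S_values_le_Sbar :
  ((sup S_values)%:E <= ereal_sup [set (Sbar a t mu sigma d)%:E | sigma in Aset a])%E.
Proof.
rewrite -ereal_sup_S_values.
apply: ge_ereal_sup => _ [sigma As <-]; apply: ge_ereal_sup => _ [p Qp <-].
have [w wF <-] := feasible_of_Qset Qp.
apply: (@le_trans _ _ (Sbar a t mu sigma d)%:E); first by rewrite lee_fin entropy_le_Sbar.
by apply: ereal_sup_ubound; exists sigma.
Qed.
End Spectrum.

Theorem theorem3p8 (R : realType) (d N : nat) (a t : 'I_N -> 'I_d -> R)
  (mu : 'I_N -> R) (dm : measure_display) (T : measurableType dm)
  (P : probability T R) (X : T -> Sigma N) :
  (0 < d)%N -> (0 < N)%N ->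
  (forall i n, 0 < `|a i n| < 1) ->
  (forall i x, cube x -> cube (ifsmap a t i x)) ->
  (forall i j, i != j -> exists x, cube x /\ ifsmap a t i x <> ifsmap a t j x) ->
  (exists r0 : R, 0 < r0 /\ forall (n : 'I_d) (u : R), (u = 0 \/ u = 1) ->
     exists k, forall x y, cube x -> x n = u -> (ifsmap a t k @` cube) y ->
       r0 <= eucl_dist x y) ->
  (forall i, 0 < mu i) -> \sum_i mu i = 1 ->
  (* X is a random sequence with i.i.d. coordinates of law mu, so that
     nu_mu = mu^N o pi^{-1} = law of (coding o X) *)
  (forall k (w : 'I_k -> 'I_N), measurable (X @^-1` cyl w) /\
      P (X @^-1` cyl w) = (\prod_(j < k) mu (w j))%:E) ->
  SPPC a t ->
  let nu := fun A => P ((coding a t \o X) @^-1` A) in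
  (exists Tf : R -> R,
     (forall q : R, ln (Tdelta nu q delta) / - ln delta @[delta --> 0^'+] --> Tf q) /\
     (exists vF : R,
        dimF nu = vF%:E /\
        ereal_inf [set ereal_inf [set (Ssig a t mu s p)%:E | p in Qset a t s]
                  | s in Aset a] = vF%:E /\
        Tf q / - q @[q --> +oo] --> vF /\
        (maxe 0%E (ereal_inf [set (Sund a t mu s d)%:E | s in Aset a]) <= vF%:E)%E) /\
     (exists vB : R,
        dimBup nu = vB%:E /\ dimBlow nu = vB%:E /\
        ereal_sup [set ereal_sup [set (Ssig a t mu s p)%:E | p in Qset a t s]
                  | s in Aset a] = vB%:E /\
        Tf q / - q @[q --> -oo] --> vB /\
        (vB%:E <= ereal_sup [set (Sbar a t mu s d)%:E | s in Aset a])%E)) /\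
  (forall s : {perm 'I_d}, LG_ordered a t s ->
     dimF nu = (Sund a t mu s d)%:E /\
     dimBup nu = (Sbar a t mu s d)%:E /\ dimBlow nu = (Sbar a t mu s d)%:E).
Proof.
move=> d0 N0 ratios cube_in _ face mu0 mu1 law sppc nu.
pose S := Sponge d0 N0 ratios cube_in face mu0 mu1 sppc.
have XP : iid_law (weight S) P X by [].
have [Tf TfP] := choice (growth_rate_log_moment XP).
split.
- exists Tf; split; first exact: (Tdelta_cvg_spectrum TfP).
  have ge_inf := spectrum_ge_inf XP TfP; have le_inf := spectrum_le_inf XP TfP.
  have ge_sup := spectrum_ge_sup XP TfP; have le_sup := spectrum_le_sup XP TfP.
  have sup0 := sup_S_values_ge0 XP TfP.
  split; [exists (inf (S_values S)) | exists (sup (S_values S))].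
  + split; first exact: (dimF_eq XP TfP ge_inf le_inf).
    split; first exact: (ereal_inf_S_values S).
    by split; [exact: (spectrum_slope_pinfty ge_inf le_inf) | exact: (Sund_le_inf_S_values S)].
  + split; first exact: (dimBup_eq XP TfP sup0 ge_sup le_sup).
    split; first exact: (dimBlow_eq XP TfP sup0 ge_sup le_sup).
    split; first exact: (ereal_sup_S_values XP TfP).
    by split; [exact: (spectrum_slope_ninfty ge_sup le_sup) | exact: (sup_S_values_le_Sbar XP TfP)].
- move=> s [_ ordered]; split; first exact: (ordered_dimF XP TfP ordered).
  exact: (ordered_dimB XP TfP ordered).
Qed.
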